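(* Let $T=V/\Delta$ be a torus, where $V$ is a finite-dimensional real vector space of dimension at least $1$ and $\Delta$ a lattice in $V$. Let $H$ be a countable subgroup of $\mathrm{Aff}(T)$ such that $p_{\mathrm a}(H)\subset\mathrm{Aut}(T)$ is not virtually abelian. Assume that the action of $H$ on $V$ (through $p_{\mathrm a}(H)$) is $\mathbf Q$-irreducible for the rational structure on $V$ defined by $\Delta$. Then the action of $H$ on $T$ has a spectral gap.
   Context: $\mathrm{Aut}(T)$ is the group of continuous automorphisms of $T$, identified with the group of $g\in GL(V)$ with $g(\Delta)=\Delta$; $\mathrm{Aff}(T)=\mathrm{Aut}(T)\ltimes T$ is the group of affine transformations of $T$ and $p_{\mathrm a}:\mathrm{Aff}(T)\to\mathrm{Aut}(T)$ the canonical projection. A subspace $W$ of $V$ is rational if it is spanned over $\mathbf R$ by $W\cap\Delta$; the action is $\mathbf Q$-irreducible if there is no $p_{\mathrm a}(H)$-invariant rational subspace of $V$ other than $\{0\}$ and $V$. A group is virtually abelian if it contains an abelian subgroup of finite index. The action of a countable group $H$ by measure preserving transformations on a probability space $(X,\nu)$ has a spectral gap if there is no sequence of unit vectors $\xi_n$ in $L^2_0(X,\nu)=\{\xi\in L^2(X,\nu):\int_X\xi\,d\nu=0\}$ with $\lim_n\|U(h)\xi_n-\xi_n\|=0$ for all $h\in H$, where $U(h)\xi(x)=\xi(h^{-1}x)$. The torus carries its normalized Haar measure. *)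

(* Defs.v *)
From HB Require Import structures.
From mathcomp Require Import all_boot all_order all_algebra.
From mathcomp Require Import all_classical all_reals all_analysis.
From mathcomp Require Import ring_quotient.
From mathcomp Require Export complex.

Set Implicit Arguments.
Unset Strict Implicit.
Unset Printing Implicit Defensive.

Import Order.TTheory GRing.Theory Num.Theory.
Import numFieldNormedType.Exports.

Local Open Scope classical_set_scope.
Local Open Scope ring_scope.
Local Open Scope quotient_scope.

Definition vect_coord (R : realType) (V : vectType R) (v : V) :
  'rV[R]_(\dim {: V}) := \row_i coord (vbasis {: V}) i v.

(* The canonical topology of a finite-dimensional real vector space, carried
   over from R^n by the coordinates in a basis (any basis gives the same one). *)
Definition vect_space (R : realType) (V : vectType R) : Type :=
  initial_topology (@vect_coord R V).

HB.instance Definition _ (R : realType) (V : vectType R) :=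
  Choice.copy (vect_space V) V.
HB.instance Definition _ (R : realType) (V : vectType R) :=
  Topological.copy (vect_space V) (initial_topology (@vect_coord R V)).

Definition is_lattice (R : realType) (V : vectType R) (Delta : zmodClosed V)
    : Prop :=
  exists b : (\dim {: V}).-tuple V,
    basis_of {: V} b /\ forall v : V, v \in Delta <-> inIntSpan b v.

Local Notation zquot := ring_quotient.Quotient.quot.

Section Torus.
Context (R : realType) (V : vectType R) (Delta : zmodClosed V).

Definition torus : Type :=
  quotient_topology (T := vect_space V) (zquot Delta).

HB.instance Definition _ := Topological.copy torus
  (quotient_topology (T := vect_space V) (zquot Delta)).
(* The group law of zquot Delta, on top of the choiceType structure of the
   quotient topology (zquot Delta carries another one). *)
HB.instance Definition _ := GRing.isZmodule.Build torus
  (@ring_quotient.Quotient.addqA V Delta)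
  (@ring_quotient.Quotient.addqC V Delta)
  (@ring_quotient.Quotient.add0q V Delta)
  (@ring_quotient.Quotient.addNq V Delta).
HB.instance Definition _ := isPointed.Build torus 0.

Definition torus_pi (v : V) : torus := \pi_(zquot Delta) v.

Definition borel_torus := g_sigma_algebraType (@open torus).

(* A translation-invariant Borel probability measure on the torus exists and
   is unique; this property singles out the normalized Haar measure. *)
Definition is_haar (mu : probability borel_torus R) : Prop :=
  forall (t : torus) (A : set borel_torus), measurable A ->
    mu [set t + x | x in (A : set torus)] = mu A.

Definition autT_pred (g : 'End(V)) : bool :=
  (lker g == 0%VS) && `[< g @` [set` Delta] = [set` Delta] >].

(* Aut(T), identified with the g in GL(V) such that g(Delta) = Delta. *)
Record autT := AutT { autT_val :> 'End(V); _ : autT_pred autT_val }.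

HB.instance Definition _ := [isSub for autT_val].
HB.instance Definition _ := [Choice of autT by <:].

Lemma autT_ker (g : autT) : lker g == 0%VS.
Proof. by case/andP: (valP g). Qed.

Lemma autT_img (g : autT) : g @` [set` Delta] = [set` Delta].
Proof. by case/andP: (valP g) => _ /asboolP. Qed.

Lemma autT_Delta (g : autT) v : v \in Delta -> g v \in Delta.
Proof.
move=> vD; suff : [set` Delta] (g v) by [].
by rewrite -(autT_img g); exists v.
Qed.

Fact autT_one_subproof : autT_pred \1%VF.
Proof.
apply/andP; split; last first.
  by apply/asboolP; under eq_imagel do rewrite id_lfunE; rewrite image_id.
by apply/lker0P => u v; rewrite !id_lfunE.
Qed.

Fact autT_mul_subproof (g h : autT) : autT_pred (g \o h)%VF.
Proof.
apply/andP; split.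
  apply/lker0P => u v; rewrite !comp_lfunE.
  by move/(lker0P (autT_ker g))/(lker0P (autT_ker h)).
apply/asboolP; under eq_imagel do rewrite comp_lfunE.
by rewrite -(image_comp h g) !autT_img.
Qed.

Fact autT_inv_subproof (g : autT) : autT_pred (g^-1)%VF.
Proof.
apply/andP; split.
  by apply/lker0P; exact: can_inj (lker0_lfunVK (autT_ker g)).
apply/asboolP; rewrite -[in LHS](autT_img g) image_comp.
under eq_imagel do rewrite /= lker0_lfunK ?autT_ker//.
by rewrite image_id.
Qed.

Definition autT_one := AutT autT_one_subproof.
Definition autT_mul g h := AutT (autT_mul_subproof g h).
Definition autT_inv g := AutT (autT_inv_subproof g).

Fact autT_mulA : associative autT_mul.
Proof. by move=> f g h; apply: val_inj; rewrite /= comp_lfunA. Qed.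

Fact autT_mul1 : left_id autT_one autT_mul.
Proof. by move=> g; apply: val_inj; rewrite /= comp_lfun1l. Qed.

Fact autT_mulr1 : right_id autT_one autT_mul.
Proof. by move=> g; apply: val_inj; rewrite /= comp_lfun1r. Qed.

Fact autT_mulV : left_inverse autT_one autT_inv autT_mul.
Proof. by move=> g; apply: val_inj; rewrite /= lker0_compVf ?autT_ker. Qed.

Fact autT_mulrV : right_inverse autT_one autT_inv autT_mul.
Proof. by move=> g; apply: val_inj; rewrite /= lker0_compfV ?autT_ker. Qed.

HB.instance Definition _ := isGroup.Build autT
  autT_mulA autT_mul1 autT_mulr1 autT_mulV autT_mulrV.

(* The automorphism of the torus induced by g. *)
Definition autT_act (g : autT) (t : torus) : torus :=
  torus_pi (g (repr (t : zquot Delta))).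

Lemma torus_piD (u v : V) : torus_pi (u + v) = torus_pi u + torus_pi v.
Proof. exact: (raddfD (\pi_(zquot Delta))). Qed.

Lemma torus_piP (u v : V) : reflect (torus_pi u = torus_pi v) (u - v \in Delta).
Proof.
rewrite ring_quotient.Quotient.idealrBE.
exact: (@eqP (zquot Delta : eqType) _ _).
Qed.

Lemma torus_piK (t : torus) : torus_pi (repr (t : zquot Delta)) = t.
Proof. exact: reprK. Qed.

Lemma autT_act_pi (g : autT) (v : V) :
  autT_act g (torus_pi v) = torus_pi (g v).
Proof.
apply/torus_piP; rewrite -linearB; apply: autT_Delta.
by apply/torus_piP; rewrite torus_piK.
Qed.

Lemma autT_actD (g : autT) : {morph autT_act g : s t / s + t}.
Proof.
move=> s t; rewrite -(torus_piK s) -(torus_piK t).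
by rewrite -torus_piD !autT_act_pi linearD torus_piD.
Qed.

Lemma autT_act0 (g : autT) : autT_act g 0 = 0.
Proof. by apply: (addrI (autT_act g 0)); rewrite -autT_actD !addr0. Qed.

Lemma autT_act1 (t : torus) : autT_act 1%g t = t.
Proof. by rewrite -(torus_piK t) autT_act_pi id_lfunE. Qed.

Lemma autT_actM (g h : autT) (t : torus) :
  autT_act (g * h)%g t = autT_act g (autT_act h t).
Proof. by rewrite -(torus_piK t) !autT_act_pi comp_lfunE. Qed.

(* Aff(T) = Aut(T) |x T: the pair (g, t) stands for x |-> g x + t. *)
Record affT := AffT { affT_lin : autT; affT_trans : torus }.

Definition affT_pair (a : affT) : autT * torus := (affT_lin a, affT_trans a).
Definition pair_affT (p : autT * torus) : affT := AffT p.1 p.2.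
Fact affT_pairK : cancel affT_pair pair_affT. Proof. by case. Qed.

HB.instance Definition _ := Choice.copy affT (can_type affT_pairK).

Definition affT_one : affT := AffT 1%g 0.
Definition affT_mul (a b : affT) : affT :=
  AffT (affT_lin a * affT_lin b)%g
       (autT_act (affT_lin a) (affT_trans b) + affT_trans a).
Definition affT_inv (a : affT) : affT :=
  AffT (affT_lin a)^-1%g (- autT_act (affT_lin a)^-1%g (affT_trans a)).

Fact affT_mulA : associative affT_mul.
Proof.
move=> [f r] [g s] [h t]; rewrite /affT_mul /= mulgA; congr AffT.
by rewrite autT_actD autT_actM addrA.
Qed.

Fact affT_mul1 : left_id affT_one affT_mul.
Proof. by move=> [g t]; rewrite /affT_mul /= mul1g autT_act1 addr0. Qed.

Fact affT_mulr1 : right_id affT_one affT_mul.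
Proof. by move=> [g t]; rewrite /affT_mul /= mulg1 autT_act0 add0r. Qed.

Fact affT_mulV : left_inverse affT_one affT_inv affT_mul.
Proof. by move=> [g t]; rewrite /affT_mul /= mulVg subrr. Qed.

Fact affT_mulrV : right_inverse affT_one affT_inv affT_mul.
Proof.
move=> [g t]; rewrite /affT_mul /= mulgV; congr AffT.
have -> : autT_act g (- autT_act g^-1%g t) = - t; last by rewrite addNr.
apply: (addIr t); rewrite addNr.
rewrite -[X in _ + X](autT_act1 t) -(mulgV g) autT_actM -autT_actD addNr.
exact: autT_act0.
Qed.

HB.instance Definition _ := isGroup.Build affT
  affT_mulA affT_mul1 affT_mulr1 affT_mulV affT_mulrV.

Definition affT_act (a : affT) (x : borel_torus) : borel_torus :=
  autT_act (affT_lin a) x + affT_trans a.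

Lemma affT_act1 x : affT_act 1%g x = x.
Proof. by rewrite /affT_act autT_act1 addr0. Qed.

Lemma affT_actM a b x : affT_act (a * b)%g x = affT_act a (affT_act b x).
Proof. by rewrite /affT_act autT_actD autT_actM addrA. Qed.

(* W is the span of W :&: Delta: since V is finite-dimensional, finitely many
   vectors are enough. *)
Definition rational_subspace (W : {vspace V}) : Prop :=
  exists s : seq V, {subset s <= [predI W & Delta]} /\ W = << s >>%VS.

Definition Q_irreducible (A : set autT) : Prop :=
  forall W : {vspace V}, rational_subspace W ->
    (forall g : autT, A g -> (g @: W <= W)%VS) ->
    W = 0%VS \/ W = fullv.

End Torus.

Arguments autT {R V} Delta.
Arguments affT {R V} Delta.
Arguments torus {R V} Delta.
Arguments borel_torus {R V} Delta.
Arguments affT_lin {R V Delta} a.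

(* A is a subgroup in all uses; finite index is finiteness of the set of left
   cosets aB with a in A. *)
Definition virtually_abelian (G : groupType) (A : set G) : Prop :=
  exists B : groupClosed G,
    [/\ [set` B] `<=` A,
        {in B &, forall x y, x * y = y * x}%g &
        finite_set ((fun a : G => (fun b : G => a * b)%g @` [set` B]) @` A)].

Section SpectralGap.
Context d (X : measurableType d) (R : realType) (nu : probability X R).
Local Open Scope ereal_scope.

Definition L2norm (xi : X -> R[i]) : \bar R :=
  Lnorm nu 2%:E (fun x => (ComplexField.Normc.normc (xi x))%:E).

(* L^2(X, nu) is the complex Hilbert space, Lfun being real-valued; classes
   modulo nu-null sets are handled through representatives. *)
Definition in_L2 (xi : X -> R[i]) : Prop :=
  (fun x => complex.Re (xi x)) \in Lfun nu 2%:E /\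
  (fun x => complex.Im (xi x)) \in Lfun nu 2%:E.

Definition in_L2_0 (xi : X -> R[i]) : Prop :=
  [/\ in_L2 xi, \int[nu]_x (complex.Re (xi x))%:E = 0 &
      \int[nu]_x (complex.Im (xi x))%:E = 0].

Definition koopman (G : groupType) (act : G -> X -> X) (h : G)
  (xi : X -> R[i]) : X -> R[i] := fun x => xi (act h^-1%g x).

(* act is meant to be an action preserving nu when restricted to H, so that
   koopman act h is well defined on classes; this is not assumed here. *)
Definition spectral_gap (G : groupType) (act : G -> X -> X) (H : set G)
    : Prop :=
  ~ exists xi : nat -> X -> R[i],
      (forall n, in_L2_0 (xi n) /\ L2norm (xi n) = 1) /\
      (forall h, H h ->
        L2norm (fun x => koopman act h (xi n) x - xi n x)%R @[n --> \oo] --> 0).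

End SpectralGap.

(* Main.v *)
(* If there is no spectral gap, the squared Fourier coefficients of almost
   invariant unit vectors yield in the limit a finitely additive mean on the
   dual lattice Z^d minus 0 which is invariant under the linear parts of H.
   Let W be a subspace of minimal dimension of positive mean: its orbit is
   finite, and by Furstenberg's lemma on projective actions, a subgroup of
   finite index preserves a flag of W on whose quotients it acts with bounded
   distortion. For a commutator x = 1 + N y of elements of a congruence subgroup
   modulo a large N, this forces y to contract the integral vectors of W to 0,
   hence y to be nilpotent on W, and bounded distortion then gives u x = u on
   the first step of the flag. The vectors (x - 1) b, for b in the lattice and x
   such a commutator, span a rational invariant subspace on which the linear form
   u vanishes; by irreducibility it is 0, so that the commutators are trivial
   and the group is virtually abelian. *)

From HB Require Import structures.
Require Import Defs.
From mathcomp Require Import all_boot all_order all_algebra.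
From mathcomp Require Import all_classical all_reals all_analysis.
From mathcomp Require Import measurable_realfun lra ring.

Set Implicit Arguments.
Unset Strict Implicit.
Unset Printing Implicit Defensive.

Import Order.TTheory GRing.Theory Num.Theory.
Import numFieldNormedType.Exports.

Local Open Scope classical_set_scope.
Local Open Scope ring_scope.

(** * Finite index, ultralimits, means *)

(** To avoid building a measure on a projective space out of a finitely additive mean,
    neighbourhoods of a subspace in the projective space of a quotient are replaced by cones
    [cone U W e], and [U] counts as charged when the mass of its cones stays bounded below as [e]
    tends to 0. Minimality of dimension acts in the same way for subspaces and for cones: two
    distinct translates of a minimal charged subspace meet in negligible mass, so their number is at
    most the total mass divided by the mass of one.

    Bounded distortion leaves the scale of g free. The scale cancels in a commutator x, so |u x| <=
    C^2 |u| on each quotient, and x = 1 + N y gives |u y| <= (C^2 + 1) / N |u|, a contraction by 1/2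
    once N >= 2 (C^2 + 1). Hence the modulus N can only be chosen after the flag.

    A translation multiplies Fourier coefficients by phases, so their squared moduli, and the mean,
    see the linear parts only. Characters are treated as pairs of real functions, cosine and sine,
    in accordance with a real-valued integral. *)

Section FiniteIndex.
Context (G : groupType).
Local Open Scope group_scope.

Definition is_subgroup (B : set G) : Prop :=
  [/\ B 1, forall a b, B a -> B b -> B (a * b) & forall a, B a -> B a^-1].

(* The colouring c separates the left cosets of B that meet A. *)
Definition fin_index (A B : set G) : Prop :=
  exists (F : finType) (c : G -> F),
    forall a b, A a -> A b -> c a = c b -> B (a^-1 * b).

Lemma is_subgroupI (B C : set G) :
  is_subgroup B -> is_subgroup C -> is_subgroup (B `&` C).
Proof.
move=> [B1 BM BV] [C1 CM CV]; split=> [//|a b [] Ba Ca [] Bb Cb|a [] Ba Ca].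
  by split; [exact: BM|exact: CM].
by split; [exact: BV|exact: CV].
Qed.

Lemma fin_index_refl (A : set G) : is_subgroup A -> fin_index A A.
Proof.
by move=> [_ AM AV]; exists unit, (fun=> tt) => a b Aa Ab _; apply/AM/Ab/AV.
Qed.

Lemma fin_indexS (A B C : set G) : B `<=` C -> fin_index A B -> fin_index A C.
Proof.
by move=> BC [F [c cP]]; exists F, c => a b Aa Ab /cP cab; exact/BC/cab.
Qed.

Lemma fin_indexI (A B C : set G) :
  fin_index A B -> fin_index A C -> fin_index A (B `&` C).
Proof.
move=> [F [c cP]] [F' [c' cP']].
exists (F * F')%type, (fun a => (c a, c' a)) => a b Aa Ab [/cP cab /cP' cab'].
by split; [exact: cab|exact: cab'].
Qed.

(** Each colour class of [c] in [A] gets a representative [r (c a)]; the second colour is that of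
    [(r (c a))^-1 * a], which lies in [B]. *)
Lemma fin_index_trans (A B C : set G) : is_subgroup A -> is_subgroup B ->
  B `<=` A -> is_subgroup C ->
  fin_index A B -> fin_index B C -> fin_index A C.
Proof.
move=> [A1 AM AV] [B1 BM BV] BA [C1 CM CV] [F [c cP]] [F' [c' cP']].
pose r (f : F) : G := xget 1 (fun a => A a /\ c a = f).
exists (F * F')%type, (fun a => (c a, c' ((r (c a))^-1 * a))) => a b Aa Ab.
have rP x : A x -> A (r (c x)) /\ c (r (c x)) = c x.
  by move=> Ax; apply: (@xgetPex _ 1 (fun a => A a /\ c a = c x)); exists x.
have rB x : A x -> B ((r (c x))^-1 * x).
  by move=> Ax; have [? ?] := rP x Ax; apply: cP.
case=> cab; rewrite cab => /cP' c'ab.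
have := c'ab _ (rB b Ab); rewrite -{1}cab => /(_ (rB a Aa)).
by rewrite -cab invgM invgK -mulgA mulVKg.
Qed.

(** The core is the intersection of the conjugates of [B] by elements of [A]. An element is coloured
    by its action on the cosets of [B], recorded as a function from colours to colours, and two
    elements acting alike differ by an element of the core. *)
Lemma normal_core (A B : set G) : is_subgroup A -> is_subgroup B ->
  fin_index A B -> exists C : set G,
    [/\ is_subgroup C, C `<=` B, fin_index A C &
        forall a x, A a -> C x -> C (a * x * a^-1)].
Proof.
move=> [A1 AM AV] [B1 BM BV] [F [c cP]].
pose C := [set x | forall a, A a -> B (a^-1 * x * a)].
exists C; split.
- split=> [a Aa|x y Cx Cy a Aa|x Cx a Aa].
  + by rewrite mulg1 mulVg.
  + have -> : a^-1 * (x * y) * a = (a^-1 * x * a) * (a^-1 * y * a).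
      by rewrite !mulgA mulgK.
    by apply: BM; [exact: Cx|exact: Cy].
  + have -> : a^-1 * x^-1 * a = (a^-1 * x * a)^-1.
      by rewrite !invgM invgK !mulgA.
    exact/BV/Cx.
- by move=> x /(_ 1 A1); rewrite invg1 mul1g mulg1.
- pose r (f : F) : G := xget 1 (fun a => A a /\ c a = f).
  have rP x : A x -> A (r (c x)) /\ c (r (c x)) = c x.
    by move=> Ax; apply: (@xgetPex _ 1 (fun a => A a /\ c a = c x)); exists x.
  exists {ffun F -> F}, (fun a => [ffun f => c (a * r f)]) => a b Aa Ab cab h Ah.
  have [] := rP h Ah; set s := r (c h) => Ar cr.
  have Bs : B (s^-1 * h) by apply: cP.
  have : B ((a * s)^-1 * (b * s)).
    apply: cP; [exact: AM|exact: AM|].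
    by move/ffunP : cab => /(_ (c h)); rewrite !ffunE.
  move=> Bab.
  have -> : h^-1 * (a^-1 * b) * h
          = (s^-1 * h)^-1 * ((a * s)^-1 * (b * s)) * (s^-1 * h).
    by rewrite !invgM !invgK !mulgA mulgK (mulgK s).
  exact: BM _ _ (BM _ _ (BV _ Bs) Bab) Bs.
- move=> a x Aa Cx b Ab.
  have -> : b^-1 * (a * x * a^-1) * b = (a^-1 * b)^-1 * x * (a^-1 * b).
    by rewrite invgM invgK !mulgA.
  by apply: Cx; apply: AM (AV _ Aa) Ab.
Qed.

(** A list of values without repetition and of maximal length exhausts the values of [f] on [A]; the
    colour is the position in this list. The conclusion speaks of the fibres of [f], so that [f]
    need not come from an action. *)
Lemma fin_index_orbit (A : set G) (X : eqType) (f : G -> X) (n : nat) :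
  (forall s : seq X, uniq s -> (forall x, x \in s -> exists2 a, A a & x = f a) ->
     (size s <= n)%N) ->
  fin_index A [set x | exists a b, [/\ A a, A b, f a = f b & x = a^-1 * b]].
Proof.
move=> sz.
pose P m := exists s : seq X,
  [/\ uniq s, (forall x, x \in s -> exists2 a, A a & x = f a) & size s = m].
have exP : exists m, `[< P m >] by exists 0%N; apply/asboolP; exists [::].
have leP m : `[< P m >] -> (m <= n)%N.
  by move/asboolP=> [s [us sA <-]]; exact: sz.
case: (ex_maxnP exP leP) => m /asboolP[s [us sA sm]] mmax.
have fs a : A a -> f a \in s.
  move=> Aa; apply/negPn/negP => fas.
  have : (m.+1 <= m)%N.
    apply: mmax; apply/asboolP; exists (f a :: s); split => /=.
    - by rewrite fas us.
    - by move=> x; rewrite inE => /orP[/eqP ->|/sA //]; exists a.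
    - by rewrite sm.
  by rewrite ltnn.
exists 'I_(size s).+1, (fun a => inord (index (f a) s)) => a b Aa Ab cab.
exists a, b; split=> //.
have := congr1 val cab; rewrite /= !inordK ?ltnS ?index_size// => iab.
by rewrite -(nth_index (f a) (fs a Aa)) iab nth_index// fs.
Qed.

End FiniteIndex.

Section UltraLimit.
Context (R : realType).

(** Along one free ultrafilter all bounded sequences converge at once, so the limit mean is defined,
    and additive, on all sets without passing to subsequences. *)
Definition free_ultra : set_system nat :=
  get [set U : set_system nat | UltraFilter U /\ \oo `<=` U].

Lemma free_ultraP : UltraFilter free_ultra /\ \oo `<=` free_ultra.
Proof.
exact: (@getPex _ [set U : set_system nat | UltraFilter U /\ \oo `<=` U])
  (ultraFilterLemma eventually_filter).
Qed.

#[local] Instance free_ultra_proper : ProperFilter free_ultra.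
Proof. by case: free_ultraP => ? _; exact: ultra_proper. Qed.

Definition ulim (u : nat -> R) : R := lim (u @ free_ultra).

Lemma ulim_cvg (u : nat -> R) (M : R) :
  (forall n, `|u n| <= M) -> u @ free_ultra --> ulim u.
Proof.
move=> uM; apply/cvg_ex => /=.
have FU : UltraFilter (u @ free_ultra).
  split; first exact: fmap_proper_filter.
  move=> G GF sFG; rewrite predeqE => A; split; last exact: sFG.
  move=> GA; case: free_ultraP => UU _.
  have [//|UA] := in_ultra_setVsetC (u @^-1` A) UU.
  have GnA : G (~` A) by exact: sFG.
  by have /filter_ex [? []] : G (A `&` (~` A)) by exact: filterI.
have := @segment_compact R (- M) M; rewrite compact_ultra => /(_ _ FU).
case.
  suff : free_ultra (u @^-1` `[- M, M]) by [].
  by apply: filterE => n /=; rewrite in_itv /= -ler_norml.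
by move=> l [_ ?]; exists l.
Qed.

Lemma ulim_unique (u : nat -> R) (l : R) : u @ free_ultra --> l -> ulim u = l.
Proof. by move=> /cvg_lim; apply; exact: Rhausdorff. Qed.

Lemma cvg_free_ultra (u : nat -> R) (l : R) :
  u @ \oo --> l -> u @ free_ultra --> l.
Proof.
move=> ul; apply: cvg_trans ul => A /= ?.
by case: free_ultraP => _ sU; exact: sU.
Qed.

Lemma ulim_near (u : nat -> R) (M e : R) : (forall n, `|u n| <= M) -> 0 < e ->
  free_ultra [set n | `|u n - ulim u| <= e].
Proof.
move=> uM e0; have /cvgrPdist_le /(_ _ e0) := ulim_cvg uM.
by apply: filterS => n /=; rewrite distrC.
Qed.

Lemma ler_ulim (u v : nat -> R) (M M' : R) : (forall n, `|u n| <= M) ->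
  (forall n, `|v n| <= M') -> (forall n, u n <= v n) -> ulim u <= ulim v.
Proof.
move=> /ulim_cvg uc /ulim_cvg vc uv.
apply: (ler_cvg_to uc vc); exact: nearW.
Qed.

End UltraLimit.

Section Mean.
Context (R : realType) (T : Type).

(** The total mass is not normalised, so that restricting a mean to a subset gives a mean again. *)
Definition is_mean (m : set T -> R) : Prop :=
  (forall A, 0 <= m A) /\
  (forall A B, A `&` B = set0 -> m (A `|` B) = m A + m B).

Context (m : set T -> R) (mP : is_mean m).

Lemma mean_ge0 A : 0 <= m A. Proof. by case: mP. Qed.

Lemma mean0 : m set0 = 0.
Proof.
case: mP => _ /(_ set0 set0); rewrite setI0 setU0 => /(_ erefl) h.
by apply: (addrI (m set0)); rewrite addr0 -h.
Qed.

Lemma meanID A B : m A = m (A `&` B) + m (A `\` B).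
Proof.
case: mP => _ <-; first by rewrite setUIDK.
by rewrite setDE setIACA setICr setI0.
Qed.

Lemma le_mean A B : A `<=` B -> m A <= m B.
Proof.
by move=> AB; rewrite (meanID B A) setIidr// lerDl mean_ge0.
Qed.

Lemma meanUI A B : m (A `|` B) + m (A `&` B) = m A + m B.
Proof.
rewrite (meanID (A `|` B) A) (setIidr (@subsetUl _ A B)) setDUD setDv set0U -addrA.
by congr (_ + _); rewrite addrC setIC -meanID.
Qed.

Lemma le_meanU A B : m (A `|` B) <= m A + m B.
Proof. by rewrite -meanUI lerDl mean_ge0. Qed.

(* X indexes a family of shrinking neighbourhoods E x e, e -> 0+, of common
   mass at least [delta], with negligible pairwise intersections in the limit. *)
Lemma mean_size_bound (X : eqType) (E : X -> R -> set T) (delta : R)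
    (s : seq X) :
  (forall x (e e' : R), e <= e' -> E x e `<=` E x e') ->
  (forall x (e : R), x \in s -> 0 < e -> delta <= m (E x e)) ->
  (forall x y (eta : R), x \in s -> y \in s -> x != y -> 0 < eta ->
     exists2 e : R, 0 < e & m (E x e `&` E y e) <= eta) ->
  uniq s -> (size s)%:R * delta <= m setT.
Proof.
move=> Emono Emass Ecap us.
(* The overlap of one neighbourhood with the union of the others is small; monotonicity in [e]
   provides a common threshold for all of them. *)
have Ecap1 x (t : seq X) (eta : R) : x \in s -> {subset t <= s} -> x \notin t ->
    0 < eta -> exists2 e : R, 0 < e & forall e', 0 < e' -> e' <= e ->
      m (E x e' `&` \big[setU/set0]_(y <- t) E y e') <= eta.
  move=> xs; elim: t eta => [|y t IH] eta ts xt eta0.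
    exists 1 => // e' _ _; rewrite big_nil setI0 mean0; exact: ltW.
  have h2 : 0 < eta / 2 by rewrite divr_gt0.
  move: xt; rewrite inE negb_or => /andP[xy xt].
  have [|e1 e10 h1] := IH _ _ xt h2.
    by move=> z zt; apply: ts; rewrite inE zt orbT.
  have [|e20 e2 h20] := Ecap x y _ xs _ xy h2; first by apply: ts; rewrite inE eqxx.
  exists (Num.min e1 e20); first by rewrite lt_min e10.
  move=> e' e'0; rewrite le_min => /andP[e'1 e'2].
  rewrite big_cons setIUr (le_trans (le_meanU _ _))// (splitr eta) lerD//.
    by apply: le_trans h20; apply: le_mean; apply: setISS; exact: Emono.
  exact: h1.
have main (t : seq X) (eta : R) : {subset t <= s} -> uniq t -> 0 < eta ->
    exists2 e : R, 0 < e & forall e', 0 < e' -> e' <= e ->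
      (size t)%:R * delta - eta <= m (\big[setU/set0]_(y <- t) E y e').
  elim: t eta => [|x t IH] eta ts /=.
    move=> _ eta0; exists 1 => // e' _ _; rewrite mul0r big_nil mean0.
    by rewrite sub0r oppr_le0 ltW.
  move=> /andP[xt ut] eta0.
  have h2 : 0 < eta / 2 by rewrite divr_gt0.
  have xs : x \in s by apply: ts; rewrite inE eqxx.
  have tss : {subset t <= s} by move=> z zt; apply: ts; rewrite inE zt orbT.
  have [e1 e10 h1] := IH _ tss ut h2.
  have [e2 e20 h20] := Ecap1 x t _ xs tss xt h2.
  exists (Num.min e1 e2); first by rewrite lt_min e10.
  move=> e' e'0; rewrite le_min => /andP[e'1 e'2].
  have := h1 _ e'0 e'1; have := h20 _ e'0 e'2; have := Emass x e' xs e'0.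
  rewrite big_cons; have := meanUI (E x e') (\big[setU/set0]_(y <- t) E y e').
  rewrite -[(size t).+1]addn1 natrD mulrDl mul1r.
  set a := m _; set b := m _; set c := m _; set d := m _; lra.
apply/ler_addgt0Pr => eta eta0.
have [e e0 he] := main s eta (fun _ => id) us eta0.
rewrite -lerBlDr (le_trans (he _ e0 (lexx _)))//; exact: le_mean.
Qed.

End Mean.

(** * Entrywise norm and ultralimits of real matrices *)

Section EntrywiseNorm.
Context (R : realType).

Definition nrm1 m n (A : 'M[R]_(m, n)) : R := \sum_i \sum_j `|A i j|.

Lemma nrm1_ge0 m n (A : 'M[R]_(m, n)) : 0 <= nrm1 A.
Proof. by apply: sumr_ge0 => i _; apply: sumr_ge0. Qed.

Lemma nrm10 m n : nrm1 (0 : 'M[R]_(m, n)) = 0.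
Proof.
by apply: big1 => i _; apply: big1 => j _; rewrite mxE normr0.
Qed.

Lemma le_nrm1_entry m n (A : 'M[R]_(m, n)) i j : `|A i j| <= nrm1 A.
Proof.
rewrite /nrm1 (bigD1 i)//= (bigD1 j)//= -addrA lerDl addr_ge0//.
  by apply: sumr_ge0.
by apply: sumr_ge0 => k _; apply: sumr_ge0.
Qed.

Lemma nrm1_eq0 m n (A : 'M[R]_(m, n)) : nrm1 A = 0 -> A = 0.
Proof.
move=> A0; apply/matrixP => i j; rewrite mxE; apply/eqP.
by rewrite -normr_le0 -A0 le_nrm1_entry.
Qed.

Lemma nrm1D m n (A B : 'M[R]_(m, n)) : nrm1 (A + B) <= nrm1 A + nrm1 B.
Proof.
rewrite /nrm1 -big_split; apply: ler_sum => i _.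
rewrite -big_split; apply: ler_sum => j _; rewrite mxE; exact: ler_normD.
Qed.

Lemma nrm1Z m n a (A : 'M[R]_(m, n)) : nrm1 (a *: A) = `|a| * nrm1 A.
Proof.
rewrite /nrm1 mulr_sumr; apply: eq_bigr => i _.
by rewrite mulr_sumr; apply: eq_bigr => j _; rewrite mxE normrM.
Qed.

Lemma nrm1N m n (A : 'M[R]_(m, n)) : nrm1 (- A) = nrm1 A.
Proof. by rewrite -scaleN1r nrm1Z normrN1 mul1r. Qed.

Lemma nrm1B m n (A B : 'M[R]_(m, n)) : nrm1 (A - B) <= nrm1 A + nrm1 B.
Proof. by rewrite -(nrm1N B) nrm1D. Qed.

Lemma nrm1M m n p (A : 'M[R]_(m, n)) (B : 'M[R]_(n, p)) :
  nrm1 (A *m B) <= nrm1 A * nrm1 B.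
Proof.
rewrite /nrm1 mulr_suml; apply: ler_sum => i _.
under eq_bigr do rewrite mxE.
apply: (@le_trans _ _ (\sum_k \sum_j `|A i j| * `|B j k|)).
  by apply: ler_sum => k _; rewrite (le_trans (ler_norm_sum _ _ _))//;
    apply: ler_sum => j _; rewrite normrM.
rewrite exchange_big mulr_suml; apply: ler_sum => j _.
rewrite -mulr_sumr ler_wpM2l// (bigD1 j)//= lerDl.
by apply: sumr_ge0 => k _; apply: sumr_ge0.
Qed.

Lemma nrm1_row_mx m n1 n2 (A : 'M[R]_(m, n1)) (B : 'M[R]_(m, n2)) :
  nrm1 (row_mx A B) = nrm1 A + nrm1 B.
Proof.
rewrite /nrm1 -big_split; apply: eq_bigr => i _.
rewrite big_split_ord; congr (_ + _); apply: eq_bigr => j _.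
  by rewrite row_mxEl.
by rewrite row_mxEr.
Qed.

Lemma nrm1_lt1_int m n (A : 'M[int]_(m, n)) :
  nrm1 (map_mx intr A) < 1 -> A = 0.
Proof.
move=> A1; apply/matrixP => i j; rewrite mxE; apply/eqP.
have := le_lt_trans (le_nrm1_entry _ i j) A1.
rewrite mxE -intr_norm ltrz1 => Aij.
by rewrite -normr_eq0 eq_le normr_ge0 andbT -ltzD1 add0r.
Qed.

(* Replaces every appeal to norms on quotient spaces. *)
Lemma le_nrm1_ker d p q (A : 'M[R]_(d, p)) (B : 'M[R]_(d, q)) :
  (forall v : 'rV_d, v *m A = 0 -> v *m B = 0) ->
  exists2 C : R, 0 < C & forall v : 'rV_d, nrm1 (v *m B) <= C * nrm1 (v *m A).
Proof.
move=> AB; have BE : B = A *m (pinvmx A *m B).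
  apply/subr0_eq; apply/row_matrixP => i; rewrite row0.
  have -> : B - A *m (pinvmx A *m B) = (1%:M - A *m pinvmx A) *m B.
    by rewrite mulmxBl mul1mx mulmxA.
  rewrite row_mul; apply: AB.
  by rewrite -row_mul mulmxBl mul1mx mulmxKpV// subrr row0.
exists (nrm1 (pinvmx A *m B) + 1); first by rewrite ltr_wpDl// nrm1_ge0.
move=> v; rewrite {1}BE mulmxA (le_trans (nrm1M _ _))// mulrC.
by rewrite ler_wpM2r ?nrm1_ge0// lerDl.
Qed.

Lemma nrm1_eq0_eps m n (A : 'M[R]_(m, n)) (C : R) :
  (forall e : R, 0 < e -> nrm1 A <= C * e) -> A = 0.
Proof.
move=> AC; apply: nrm1_eq0; apply/eqP; rewrite eq_le nrm1_ge0 andbT.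
apply/ler_addgt0Pr => e e0; rewrite add0r.
have C0 : 0 < `|C| + 1 by rewrite ltr_wpDl.
apply: le_trans (AC (e / (`|C| + 1)) (divr_gt0 e0 C0)) _.
rewrite mulrA ler_pdivrMr// mulrC ler_wpM2l ?(ltW e0)//.
by rewrite (le_trans (ler_norm C))// lerDl.
Qed.

Definition ulim_mx m n (F : nat -> 'M[R]_(m, n)) : 'M[R]_(m, n) :=
  \matrix_(i, j) ulim (fun k => F k i j).

Lemma ulim_mx_near m n (F : nat -> 'M[R]_(m, n)) (M e : R) :
  (forall k, nrm1 (F k) <= M) -> 0 < e ->
  free_ultra [set k | nrm1 (F k - ulim_mx F) <= e].
Proof.
move=> FM e0; have FU := @free_ultra_proper.
pose e' : R := e / ((m * n)%:R + 1).
have e'0 : 0 < e' by rewrite divr_gt0// ltr_wpDl.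
have : free_ultra
    [set k | forall ij : 'I_m * 'I_n, `|(F k - ulim_mx F) ij.1 ij.2| <= e'].
  apply: filter_forall => -[i j] /=.
  have FijM k : `|F k i j| <= M by exact: le_trans (le_nrm1_entry _ i j) (FM k).
  by have := ulim_near FijM e'0; apply: filterS => k /=; rewrite !mxE.
apply: filterS => k /= h.
apply: (@le_trans _ _ (\sum_(i < m) \sum_(j < n) e')).
  by apply: ler_sum => i _; apply: ler_sum => j _; exact: (h (i, j)).
rewrite !sumr_const !card_ord -mulrnA -[e' *+ _]mulr_natr /e' mulrAC.
by rewrite ler_pdivrMr ?ltr_wpDl// ler_wpM2l ?(ltW e0)// mulnC lerDl.
Qed.

End EntrywiseNorm.

Global Opaque nrm1.

(** * Projective actions of matrix groups *)

Section QuotientDirections.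
Context (R : realType) (d : nat).

(* The vectors whose class in R^d / W makes a small angle with U / W:
   [v *m cokermx U] is a norm of v modulo U. *)
Definition cone (U W : 'M[R]_d) (e : R) : set 'rV[R]_d :=
  [set v | nrm1 (v *m cokermx U) <= e * nrm1 (v *m cokermx W)].

Lemma cone_mono (U W : 'M[R]_d) (e e' : R) :
  e <= e' -> cone U W e `<=` cone U W e'.
Proof.
by move=> ee' v /le_trans; apply; rewrite ler_wpM2r// nrm1_ge0.
Qed.

Lemma mul_cokermx_eq0 (U : 'M[R]_d) (v : 'rV[R]_d) :
  v *m cokermx U = 0 <-> (v <= U)%MS.
Proof. by rewrite submxE; split=> [->|/eqP]. Qed.

(** The map to the pair of quotients by [U1] and [U2] has kernel [U1 :&: U2], so the norm modulo the
    intersection is at most a multiple of the sum of the two norms. *)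
Lemma cone_cap (U1 U2 W : 'M[R]_d) : exists2 C : R, 0 < C &
  forall e, cone U1 W e `&` cone U2 W e `<=` cone (U1 :&: U2)%MS W (C * e).
Proof.
have [v|C C0 CP] := @le_nrm1_ker R d _ _ (row_mx (cokermx U1) (cokermx U2))
    (cokermx (U1 :&: U2)%MS).
  rewrite mul_mx_row -[RHS]row_mx0 => /eq_row_mx[/mul_cokermx_eq0 v1].
  move=> /mul_cokermx_eq0 v2.
  by apply/mul_cokermx_eq0; rewrite sub_capmx v1.
exists (C * 2); first by rewrite mulr_gt0.
move=> e v [] h1 h2; apply: le_trans (CP v) _.
rewrite mul_mx_row nrm1_row_mx -!mulrA ler_wpM2l ?(ltW C0)//.
by rewrite mulrDl mul1r lerD.
Qed.

Lemma cone_act (U W g : 'M[R]_d) : g \in unitmx -> (W *m g :=: W)%MS ->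
  exists2 C : R, 0 < C &
  forall e v, 0 <= e -> cone U W e v -> cone (U *m g) W (C * e) (v *m g).
Proof.
move=> gu Wg.
have [v|C C0 CP] := @le_nrm1_ker R d _ _ (cokermx U) (g *m cokermx (U *m g)).
  move=> /mul_cokermx_eq0 vU; rewrite mulmxA; apply/mul_cokermx_eq0.
  exact: submxMr.
have [v|C' C'0 C'P] := @le_nrm1_ker R d _ _ (g *m cokermx W) (cokermx W).
  rewrite mulmxA => /mul_cokermx_eq0; rewrite -Wg => vW.
  by apply/mul_cokermx_eq0; move: vW; rewrite submxMfree// row_free_unit.
exists (C * C'); first by rewrite mulr_gt0.
move=> e v e0 h; rewrite /cone /= -mulmxA (le_trans (CP v))// -!mulrA.
rewrite ler_wpM2l ?(ltW C0)// (le_trans h)// mulrCA ler_wpM2l//.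
by have := C'P v; rewrite mulmxA.
Qed.

Lemma cone_full (U W : 'M[R]_d) (e : R) v : 0 <= e -> (v <= U)%MS -> cone U W e v.
Proof.
move=> e0 /mul_cokermx_eq0 vU; rewrite /cone /= vU nrm10 mulr_ge0//.
exact: nrm1_ge0.
Qed.

(** [P] realises [U / W] inside the space of row vectors. The action of [g] on the quotient is then
    read off [P *m g *m P], and limits of such actions can be taken among matrices of a fixed
    size. *)
Lemma relative_projection (U W : 'M[R]_d) : (W <= U)%MS ->
  exists P : 'M[R]_d, [/\ W *m P = 0, (P <= U)%MS, P *m P = P &
    forall u : 'rV_d, (u <= U)%MS -> (u - u *m P <= W)%MS].
Proof.
move=> WU; have UU := capmx_compl U; have DW := capmx_diff U W.
have DU : (U <= (U :\: W) + W)%MS.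
  have := addsmxS (submx_refl (U :\: W)%MS) (capmxSr U W).
  by rewrite addsmx_diff_cap_eq.
exists (proj_mx U U^C%MS *m proj_mx (U :\: W)%MS W).
have PU : (proj_mx U U^C%MS *m proj_mx (U :\: W)%MS W <= U :\: W)%MS.
  by rewrite proj_mx_sub.
split.
- by rewrite mulmxA (proj_mx_id UU WU) (proj_mx_0 DW (submx_refl W)).
- exact: submx_trans PU (diffmxSl _ _).
- rewrite mulmxA (proj_mx_id UU (submx_trans PU (diffmxSl _ _))).
  exact: (proj_mx_id DW PU).
- move=> u uU; rewrite mulmxA (proj_mx_id UU uU) proj_mx_compl_sub//.
  exact: submx_trans uU DU.
Qed.

Lemma small_factor3 (Y1 Y2 Y3 c1 c2 c3 : R) : 0 < c1 -> 0 < c2 -> 0 < c3 ->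
  exists e : R, [/\ 0 < e <= 1, Y1 * e <= c1, Y2 * e <= c2 & Y3 * e <= c3].
Proof.
have H (Y c : R) : 0 < c -> exists2 e0 : R, 0 < e0 &
    forall e, 0 < e -> e <= e0 -> Y * e <= c.
  move=> c0; exists (c / (`|Y| + 1)); first by rewrite divr_gt0// ltr_wpDl.
  move=> e e0; rewrite ler_pdivlMr ?ltr_wpDl// => h.
  rewrite (le_trans _ h)// mulrC ler_wpM2l ?(ltW e0)//.
  by rewrite (le_trans (ler_norm Y))// lerDl.
move=> /(H Y1)[e1 e10 h1] /(H Y2)[e2 e20 h2] /(H Y3)[e3 e30 h3].
set e := Num.min 1 (Num.min e1 (Num.min e2 e3)).
have e0 : 0 < e by rewrite !lt_min ltr01 e10 e20.
have : e <= e by [].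
rewrite {2}/e !le_min => /and4P[ee1 /h1 h1' /h2 h2' /h3 h3'].
by exists e; rewrite e0 ee1; split; [|exact: h1'|exact: h2'|exact: h3'].
Qed.

(** The numerical end of the dichotomy that follows. There [a] and [r] are the norms of v and of v g
    modulo W, and [L] is the norm of v g modulo the part of U killed by S. Both are compared with
    [q * a]: [L] is at most [2 * (q * a * w)] and [C3 * r] at least [q * a * (c / 4)]; the
    hypothesis [e1 * c = 8 * C3 * w] makes [e1] the ratio of the two bounds. *)
Lemma furstenberg_arith (C1 C2 C3 C4 C5 c w e0 e1 eta a q M KU nS nT nP
    L r vgU vgS vgP t ut : R) :
  0 < C2 -> 0 < C3 -> 0 < e1 -> e1 = C1 * c -> e1 * c = 8 * C3 * w ->
  0 <= a -> 0 < q -> C5 * eta <= c / 4 -> C2 * C5 * nS * eta <= w ->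
  C2 * (C4 * M * (KU + nS)) * e0 <= q * w -> (1 + C4 * nT) * e0 <= c / 4 ->
  C4 * M * nP * e0 <= q * (c / 4) ->
  L <= C2 * (vgU + vgS) -> vgU <= C4 * (e0 * a) * M * KU ->
  vgS <= q * (C5 * a * eta) * nS + C4 * (e0 * a) * M * nS ->
  vgP <= C3 * r ->
  q * ut <= vgP + C4 * (e0 * a) * M * nP + q * (C5 * a * eta) ->
  t <= ut + C4 * (e0 * a) * nT -> c * a <= e0 * a + t ->
  L <= e1 * r.
Proof.
move=> C20 C30 e10 e1c e1w a0 q0 h1 h2 j1 j2 j3 Lle hU hS hP hu ht tge.
have qa0 : 0 <= q * a by rewrite mulr_ge0// ltW.
have Lle2 : L <= 2 * (q * a * w).
  have k1 := ler_wpM2l a0 j1; have k2 := ler_wpM2l qa0 h2.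
  have k3 := ler_wpM2l (ltW C20) (lerD hU hS).
  clear -k1 k2 k3 Lle; lra.
have rge : q * a * (c / 4) <= C3 * r.
  have k1 := ler_wpM2l qa0 j2; have k2 := ler_wpM2l a0 j3.
  have k3 := ler_wpM2l qa0 h1; have k4 := ler_wpM2l (ltW q0) tge.
  have k5 := ler_wpM2l (ltW q0) ht.
  clear -k1 k2 k3 k4 k5 hP hu; lra.
rewrite (le_trans Lle2)// -(ler_pM2l C30).
have := ler_wpM2l (ltW e10) rge.
have -> : e1 * (q * a * (c / 4)) = q * a / 4 * (e1 * c) by clear; lra.
rewrite e1w [e1 * (C3 * r)]mulrCA.
have -> // : q * a / 4 * (8 * C3 * w) = C3 * (2 * (q * a * w)).
by clear; lra.
Qed.

(* The contraction step of Furstenberg's lemma, made quantitative: if g acts on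
   U / W almost like q T with T singular, a direction close to U / W is close
   to ker T or is sent by g close to ker S, which contains the image of T. *)
Lemma furstenberg_dichotomy (U W P T S : 'M[R]_d) (e1 : R) :
  W *m P = 0 -> P *m P = P ->
  (forall u : 'rV_d, (u <= U)%MS -> (u - u *m P <= W)%MS) ->
  P *m T = T -> P *m S = S -> T *m S = 0 -> 0 < e1 ->
  exists2 eta : R, 0 < eta & forall (g : 'M[R]_d) (q : R), 0 < q ->
    (U *m g <= U)%MS -> (W *m g <= W)%MS ->
    nrm1 (q^-1 *: (P *m g *m P) - T) <= eta ->
    exists2 e0 : R, 0 < e0 & forall v, cone U W e0 v ->
      cone (U :&: kermx T)%MS W e1 v \/ cone (U :&: kermx S)%MS W e1 (v *m g).
Proof.
move=> WP PP PU PT PS TS e10.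
have capK (X : 'M[R]_d) : exists2 C : R, 0 < C & forall v : 'rV_d,
    nrm1 (v *m cokermx (U :&: kermx X)%MS) <=
    C * (nrm1 (v *m cokermx U) + nrm1 (v *m X)).
  have [v|C C0 CP] := @le_nrm1_ker R d _ _ (row_mx (cokermx U) X)
      (cokermx (U :&: kermx X)%MS).
    rewrite mul_mx_row -[RHS]row_mx0 => /eq_row_mx[/mul_cokermx_eq0 v1 v2].
    by apply/mul_cokermx_eq0; rewrite sub_capmx v1; apply/sub_kermxP.
  by exists C => // v; rewrite -nrm1_row_mx -mul_mx_row.
have [C1 C10 hK] := capK T; have [C2 C20 hK'] := capK S.
have [v|C3 C30 hP] := @le_nrm1_ker R d _ _ (cokermx W) P.
  by move=> /mul_cokermx_eq0/submxP[D ->]; rewrite -mulmxA WP mulmx0.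
pose Q := proj_mx U U^C%MS.
have [v|C4 C40 hz] := @le_nrm1_ker R d _ _ (cokermx U) (1%:M - Q).
  move=> /mul_cokermx_eq0 vU.
  by rewrite mulmxBr mulmx1 proj_mx_id ?subrr// capmx_compl.
pose nS := nrm1 S; pose nT := nrm1 T; pose nP := nrm1 P.
have nS0 : 0 <= nS := nrm1_ge0 _; have nT0 : 0 <= nT := nrm1_ge0 _.
have nP0 : 0 <= nP := nrm1_ge0 _.
have [c c0 e1c] : exists2 c : R, 0 < c & e1 = C1 * c.
  by exists (e1 / C1); rewrite ?divr_gt0// mulrC divfK// gt_eqF.
have [w w0 e1w] : exists2 w : R, 0 < w & e1 * c = 8 * C3 * w.
  have C38 : 0 < 8 * C3 by rewrite mulr_gt0.
  exists (e1 * c / (8 * C3)); first by rewrite divr_gt0// mulr_gt0.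
  by rewrite [RHS]mulrC divfK// gt_eqF.
pose C5 := C3 + C4 * nP.
have C50 : 0 <= C5 by rewrite addr_ge0 ?mulr_ge0 ?(ltW C30) ?(ltW C40).
have c40 : 0 < c / 4 by rewrite divr_gt0.
(* [eta] is fixed before [g], which will be picked close to its limit; [e0] comes after [g] and [q]
   and absorbs the norm of [g]. *)
have [eta [/andP[eta0 _] h1 h2 _]] :=
  small_factor3 C5 (C2 * C5 * nS) 0 c40 w0 ltr01.
exists eta => // g q q0 Ug Wg; set D := _ - T => Deta.
pose M := nrm1 g; have M0 : 0 <= M := nrm1_ge0 _.
pose KU := nrm1 (cokermx U); have KU0 : 0 <= KU := nrm1_ge0 _.
have qw0 : 0 < q * w by rewrite mulr_gt0.
have qc0 : 0 < q * (c / 4) by rewrite mulr_gt0.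
have [e0 [/andP[e00 e0le1] j1 j2 j3]] := small_factor3
  (C2 * (C4 * M * (KU + nS))) (1 + C4 * nT) (C4 * M * nP) qw0 c40 qc0.
exists e0 => // v; rewrite /cone /=.
set a := nrm1 (v *m cokermx W) => nv.
have a0 : 0 <= a := nrm1_ge0 _.
have [|/negP] := pselect (nrm1 (v *m cokermx (U :&: kermx T)%MS) <= e1 * a).
  by left.
rewrite -ltNge => ka; right.
(* [v] is split into a component in [U] and an error proportional to [e0]. *)
have [u [z [vE uU zle]]] : exists u z : 'rV[R]_d,
    [/\ v = u + z, (u <= U)%MS & nrm1 z <= C4 * (e0 * a)].
  exists (v *m Q), (v - v *m Q); split; first by rewrite addrC subrK.
    exact: proj_mx_sub.
  rewrite -[X in X - _]mulmx1 -mulmxBr (le_trans (hz v))//.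
  by rewrite ler_wpM2l// ltW.
have e0a : e0 * a <= a by rewrite ler_piMl.
have uPle : nrm1 (u *m P) <= C5 * a.
  have -> : u = v - z by rewrite vE addrK.
  rewrite mulmxBl (le_trans (nrm1B _ _))// /C5 mulrDl lerD//.
  rewrite (le_trans (nrm1M _ _))// mulrAC ler_wpM2r//.
  by rewrite (le_trans zle)// ler_wpM2l// ltW.
have PD : P *m D = D by rewrite /D mulmxBr -scalemxAr !mulmxA PP PT.
have uDle : nrm1 (u *m D) <= C5 * a * eta.
  rewrite -PD mulmxA (le_trans (nrm1M _ _))//.
  by apply: ler_pM => //; exact: nrm1_ge0.
(* Replacing [u] by [u *m P] costs a vector of [W], which stays in [W] under [g] and is killed by
   [P]. *)
have ugP : u *m g *m P = q *: (u *m T + u *m D).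
  rewrite -mulmxDr /D [T + _]addrC subrK -scalemxAr scalerA mulfV ?gt_eqF//.
  rewrite scale1r !mulmxA; apply/subr0_eq; rewrite -!mulmxBl.
  have /submxP[X ->] : ((u - u *m P) *m g <= W)%MS.
    exact: submx_trans (submxMr _ (PU _ uU)) Wg.
  by rewrite -mulmxA WP mulmx0.
have vgU : nrm1 (v *m g *m cokermx U) <= C4 * (e0 * a) * M * KU.
  have -> : v *m g *m cokermx U = z *m g *m cokermx U.
    rewrite {1}vE !mulmxDl.
    have /mul_cokermx_eq0 -> : (u *m g <= U)%MS.
      exact: submx_trans (submxMr _ uU) Ug.
    by rewrite add0r.
  rewrite (le_trans (nrm1M _ _))// ler_wpM2r// (le_trans (nrm1M _ _))//.
  by rewrite ler_wpM2r.
have vgS : nrm1 (v *m g *m S) <= q * (C5 * a * eta) * nS + C4 * (e0 * a) * M * nS.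
  rewrite vE !mulmxDl (le_trans (nrm1D _ _))// lerD//.
    rewrite -PS mulmxA ugP -scalemxAl mulmxDl -[u *m T *m S]mulmxA TS mulmx0.
    rewrite add0r nrm1Z gtr0_norm// -mulrA ler_wpM2l ?(ltW q0)//.
    by rewrite (le_trans (nrm1M _ _))// ler_wpM2r.
  rewrite (le_trans (nrm1M _ _))// ler_wpM2r// (le_trans (nrm1M _ _))//.
  by rewrite ler_wpM2r.
have vTle : nrm1 (v *m T) <= nrm1 (u *m T) + C4 * (e0 * a) * nT.
  rewrite {1}vE mulmxDl (le_trans (nrm1D _ _))// lerD2l.
  by rewrite (le_trans (nrm1M _ _))// ler_wpM2r.
have uTle : q * nrm1 (u *m T) <= nrm1 (v *m g *m P) + C4 * (e0 * a) * M * nP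
    + q * (C5 * a * eta).
  have -> : q * nrm1 (u *m T) = nrm1 (v *m g *m P - z *m g *m P - q *: (u *m D)).
    have -> : v *m g *m P - z *m g *m P = q *: (u *m T + u *m D).
      by rewrite -!mulmxBl -ugP vE addrK.
    by rewrite scalerDr addrK nrm1Z gtr0_norm.
  rewrite (le_trans (nrm1B _ _))// lerD//.
    rewrite (le_trans (nrm1B _ _))// lerD2l (le_trans (nrm1M _ _))//.
    by rewrite ler_wpM2r// (le_trans (nrm1M _ _))// ler_wpM2r.
  by rewrite nrm1Z gtr0_norm// ler_wpM2l// ltW.
(* Failure of the first alternative bounds [v *m T] from below: [v] is close to [U] but not to the
   kernel of [T] in [U]. *)
have tge : c * a <= e0 * a + nrm1 (v *m T).
  rewrite -(ler_pM2l C10) mulrA -e1c; apply: le_trans (ltW ka) _.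
  apply: le_trans (hK v) _; rewrite ler_pM2l// lerD2r//.
exact: (furstenberg_arith C20 C30 e10 e1c e1w a0 q0 h1 h2 j1 j2 j3
  (hK' (v *m g)) vgU vgS (hP (v *m g)) uTle vTle tge).
Qed.

End QuotientDirections.

Section InvariantMean.
Context (R : realType) (d : nat) (G : groupType) (rho : G -> 'M[R]_d).
Context (rho1 : rho 1%g = 1%:M).
Context (rhoM : forall a b, rho (a * b)%g = rho a *m rho b).
Context (m : set 'rV[R]_d -> R) (mP : is_mean m).

Lemma rhoV a : rho a *m rho a^-1%g = 1%:M.
Proof. by rewrite -rhoM mulgV. Qed.

Lemma rhoVr a : rho a^-1%g *m rho a = 1%:M.
Proof. by rewrite -rhoM mulVg. Qed.

Lemma rho_unit a : rho a \in unitmx.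
Proof. by have [] := mulmx1_unit (rhoV a). Qed.

Definition stable (B : set G) (W : 'M[R]_d) : Prop :=
  forall g, B g -> (W *m rho g <= W)%MS.

Definition invariant (B : set G) : Prop :=
  forall g, B g -> forall E, m [set v | E (v *m rho g)] = m E.

Lemma stable_eqmx (B : set G) (W : 'M[R]_d) g : is_subgroup B -> stable B W ->
  B g -> (W *m rho g :=: W)%MS.
Proof.
move=> [_ _ BV] sW Bg; apply/eqmxP; rewrite sW//=.
have := submxMr (rho g) (sW _ (BV _ Bg)).
by rewrite -mulmxA rhoVr mulmx1.
Qed.

Definition stabilizer (B : set G) (U : 'M[R]_d) : set G :=
  [set g | B g /\ (U *m rho g == U)%MS].

Lemma stabilizer_subgroup (B : set G) (U : 'M[R]_d) :
  is_subgroup B -> is_subgroup (stabilizer B U).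
Proof.
move=> [B1 BM BV]; split.
- by split=> //; rewrite rho1 mulmx1; apply/eqmxP.
- move=> a b [Ba /eqmxP Ua] [Bb /eqmxP Ub]; split; first exact: BM.
  rewrite rhoM mulmxA; apply/eqmxP.
  exact: eqmx_trans (eqmxMr _ Ua) Ub.
- move=> a [Ba /eqmxP Ua]; split; first exact: BV.
  apply/eqmxP/eqmx_sym; have := eqmxMr (rho a^-1%g) Ua.
  by rewrite -mulmxA rhoV mulmx1.
Qed.

(** Serves twice: with cones relative to a subspace, and with the subspaces themselves, where [E]
    ignores its second argument. The brackets [<<_>>] choose one matrix per row space, so that
    distinct matrices are distinct subspaces. *)
Lemma stabilizer_fin_index (B : set G) (U : 'M[R]_d)
    (E : 'M[R]_d -> R -> set 'rV[R]_d) (delta : R) : is_subgroup B ->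
  0 < delta ->
  (forall X (e e' : R), e <= e' -> E X e `<=` E X e') ->
  (forall g (e : R), B g -> 0 < e -> delta <= m (E <<U *m rho g>>%MS e)) ->
  (forall a b (eta : R), B a -> B b ->
     <<U *m rho a>>%MS != <<U *m rho b>>%MS -> 0 < eta -> exists2 e : R, 0 < e &
     m (E <<U *m rho a>>%MS e `&` E <<U *m rho b>>%MS e) <= eta) ->
  fin_index B (stabilizer B U).
Proof.
move=> Bgrp delta0 Emono Emass Ecap; have [B1 BM BV] := Bgrp.
(* Row vectors carry a right action; with the inverse, equality of [f a] and [f b] says that
   [a^-1 * b] fixes [U]. *)
pose f a := <<U *m rho a^-1%g>>%MS.
apply: fin_indexS (@fin_index_orbit G B _ f (Num.trunc (m setT / delta)) _).
  move=> _ [a] [b] [Ba Bb fab ->]; split; first by apply: BM => //; exact: BV.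
  have /eqmxP/(eqmxMr (rho b)) : (U *m rho a^-1%g == U *m rho b^-1%g)%MS.
    exact/genmxP.
  rewrite -!mulmxA rhoVr mulmx1 -rhoM => ?; exact/eqmxP.
move=> s us sB; rewrite truncn_ge_nat ?divr_ge0 ?mean_ge0 ?(ltW delta0)//.
rewrite ler_pdivlMr//.
apply: (@mean_size_bound R _ m mP _ E) => //.
- by move=> x e /sB[a Ba ->] e0; apply: Emass => //; exact: BV.
- move=> x y eta /sB[a Ba ->] /sB[b Bb ->] xy eta0.
  by apply: Ecap => //; exact: BV.
Qed.

(** A substitute for positive measure of the closed subset defined by [U] in the projective space of
    the quotient by [W]: all its neighbourhoods share a lower bound on their mass. *)
Definition massive (W U : 'M[R]_d) : Prop :=
  exists2 delta : R, 0 < delta & forall e : R, 0 < e -> delta <= m (cone U W e).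

Lemma not_massive (W U : 'M[R]_d) (eta : R) : ~ massive W U -> 0 < eta ->
  exists2 e : R, 0 < e & m (cone U W e) <= eta.
Proof.
move=> nU eta0; apply: contrapT => h; apply: nU; exists eta => // e e0.
by rewrite leNgt; apply/negP => /ltW he; apply: h; exists e.
Qed.

Lemma cone_eqmx (U U' W : 'M[R]_d) : (U :=: U')%MS -> exists2 C : R, 0 < C &
  forall e, cone U W e `<=` cone U' W (C * e).
Proof.
move=> UU'; have [v|C C0 CP] := @le_nrm1_ker R d _ _ (cokermx U) (cokermx U').
  by move=> /mul_cokermx_eq0; rewrite UU' => /mul_cokermx_eq0.
exists C => // e v h; apply: le_trans (CP v) _.
by rewrite -mulrA ler_wpM2l// ltW.
Qed.

(* |u g| / |u| varies by a factor at most C over the nonzero classes u in U / W: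
   the projective action on U / W is bounded. *)
Definition bounded_distortion (B : set G) (W U : 'M[R]_d) (C : R) : Prop :=
  forall g, B g -> forall u u' : 'rV[R]_d, (u <= U)%MS -> (u' <= U)%MS ->
    nrm1 (u *m rho g *m cokermx W) * nrm1 (u' *m cokermx W) <=
    C * (nrm1 (u *m cokermx W) * nrm1 (u' *m rho g *m cokermx W)).

Lemma massive_act (B : set G) (W U : 'M[R]_d) (delta : R) g :
  is_subgroup B -> invariant B -> stable B W -> B g ->
  (forall e : R, 0 < e -> delta <= m (cone U W e)) ->
  forall e : R, 0 < e -> delta <= m (cone <<U *m rho g>>%MS W e).
Proof.
move=> Bgrp minv sW Bg Um e e0.
have [C C0 CP] := cone_act U (rho_unit g) (stable_eqmx Bgrp sW Bg).
have [C' C'0 C'P] := @cone_eqmx (U *m rho g) <<U *m rho g>>%MS W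
  (eqmx_sym (genmxE _)).
have e'0 : 0 < e / (C' * C) by rewrite divr_gt0// mulr_gt0.
apply: le_trans (Um _ e'0) _; rewrite -(minv g Bg (cone <<U *m rho g>>%MS W e)).
apply: (le_mean mP) => v.
move=> /(CP _ _ (ltW e'0))/C'P.
suff -> : C' * (C * (e / (C' * C))) = e by [].
by rewrite mulrA mulrC divfK// gt_eqF// mulr_gt0.
Qed.

(** Distinct translates of [U] meet in a subspace of smaller dimension, which is not massive. Their
    thin cones thus overlap in arbitrarily small mass while each keeps mass at least [delta], which
    bounds the number of translates. *)
Lemma massive_stabilizer (B : set G) (W W0 U : 'M[R]_d) :
  is_subgroup B -> invariant B -> stable B W -> stable B W0 ->
  (W <= U)%MS -> (U <= W0)%MS -> massive W U ->
  (forall X : 'M[R]_d, (W <= X)%MS -> (X <= W0)%MS -> (\rank X < \rank U)%N ->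
     ~ massive W X) ->
  fin_index B (stabilizer B U).
Proof.
move=> Bgrp minv sW sW0 WU UW0 [delta delta0 Um] Umin.
apply: (@stabilizer_fin_index B U (fun X e => cone X W e) delta) => //.
- by move=> X e e'; exact: cone_mono.
- by move=> g e Bg e0; apply: (massive_act Bgrp minv sW Bg Um).
move=> a b eta Ba Bb ab eta0.
set X := <<U *m rho a>>%MS; set Y := <<U *m rho b>>%MS.
have rkU g : \rank <<U *m rho g>>%MS = \rank U.
  by rewrite mxrank_gen mxrankMfree// row_free_unit rho_unit.
have subX g : B g -> (W <= <<U *m rho g>>)%MS && (<<U *m rho g>> <= W0)%MS.
  move=> Bg; rewrite !genmxE -{1}(stable_eqmx Bgrp sW Bg) submxMr//=.
  exact: submx_trans (submxMr _ UW0) (sW0 _ Bg).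
have /andP[WX XW0] := subX a Ba; have /andP[WY YW0] := subX b Bb.
have rkXY : (\rank (X :&: Y) < \rank U)%N.
  rewrite -(rkU a) ltnNge; apply/negP => rk; move/eqP: ab; apply.
  have XY : (X <= X :&: Y)%MS.
    rewrite -(mxrank_leqif_sup (capmxSl X Y)) eqn_leq rk andbT.
    exact: mxrankS (capmxSl X Y).
  have {XY}XY : (X <= Y)%MS by apply: submx_trans XY (capmxSr _ _).
  rewrite -[LHS]genmx_id -[RHS]genmx_id; apply/genmxP.
  rewrite -/X -/Y XY /= -(mxrank_leqif_sup XY) /X /Y.
  by rewrite (rkU a) (rkU b).
have nXY : ~ massive W (X :&: Y)%MS.
  apply: Umin => //; first by rewrite sub_capmx WX WY.
  exact: submx_trans (capmxSl _ _) XW0.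
have [e e0 he] := not_massive nXY eta0.
have [C C0 CP] := cone_cap X Y W.
exists (e / C); first by rewrite divr_gt0.
apply: le_trans he; apply: (le_mean mP) => v /CP.
by rewrite mulrCA mulfV ?gt_eqF// mulr1.
Qed.

(** Under unbounded distortion, the normalised actions of some [g n] and of their inverses have
    nonzero limits [T] and [S] with [T *m S = 0]. The dichotomy covers a thin cone around [U] by a
    cone around the kernel of [T] in [U] and the preimage under some [g n] of a cone around that of
    [S]. By minimality neither kernel is massive, which contradicts the mass of [U]. *)
Lemma massive_bounded_distortion (B : set G) (W W0 U : 'M[R]_d) :
  is_subgroup B -> invariant B -> stable B W -> stable B U ->
  (W <= U)%MS -> (U <= W0)%MS -> massive W U ->
  (forall X : 'M[R]_d, (W <= X)%MS -> (X <= W0)%MS -> (\rank X < \rank U)%N ->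
     ~ massive W X) ->
  exists C, bounded_distortion B W U C.
Proof.
move=> Bgrp minv sW sU WU UW0 [delta delta0 Um] Umin.
have [B1 BM BV] := Bgrp.
have [P [WP PU PP Pproj]] := relative_projection WU.
pose Q g := P *m rho g *m P.
have XgP p (X : 'M[R]_(p, d)) g : (X <= U)%MS -> B g ->
    X *m rho g *m P = X *m P *m rho g *m P.
  move=> XU Bg; apply/row_matrixP => i; rewrite !row_mul.
  apply/subr0_eq; rewrite -!mulmxBl.
  have /submxP[D ->] : ((row i X - row i X *m P) *m rho g <= W)%MS.
    apply: submx_trans (submxMr _ (Pproj _ _)) (sW _ Bg).
    exact: submx_trans (row_sub _ _) XU.
  by rewrite -mulmxA WP mulmx0.
have QV g : B g -> Q g *m Q g^-1%g = P.
  move=> Bg; rewrite /Q !mulmxA -[P *m rho g *m P *m P]mulmxA PP.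
  rewrite -XgP; last 2 first.
  - exact: submx_trans (submxMr _ PU) (sU _ Bg).
  - exact: BV.
  by rewrite -[P *m _ *m _]mulmxA rhoV mulmx1 PP.
(* The distortion of [g] on the quotient is at most a constant times the product of the norms of
   [Q g] and [Q g^-1]. *)
suff [C CP] : exists C, forall g, B g -> nrm1 (Q g) * nrm1 (Q g^-1%g) <= C.
  have [v|C3 C30 hP] := @le_nrm1_ker R d _ _ (cokermx W) P.
    by move=> /mul_cokermx_eq0/submxP[D ->]; rewrite -mulmxA WP mulmx0.
  set k := nrm1 (cokermx W); have k0 : 0 <= k := nrm1_ge0 _.
  have hQ g (u : 'rV[R]_d) : B g -> (u <= U)%MS ->
      nrm1 (u *m rho g *m cokermx W) <= C3 * k * nrm1 (Q g) * nrm1 (u *m cokermx W).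
    move=> Bg uU; have ugU : (u *m rho g <= U)%MS.
      exact: submx_trans (submxMr _ uU) (sU _ Bg).
    have -> : u *m rho g *m cokermx W = u *m P *m Q g *m cokermx W.
      have /mul_cokermx_eq0 := Pproj _ ugU.
      rewrite mulmxBl => /subr0_eq ->; rewrite XgP// /Q !mulmxA.
      by rewrite -[u *m P *m P]mulmxA PP.
    rewrite (le_trans (nrm1M _ _))//.
    apply: (@le_trans _ _ (C3 * nrm1 (u *m cokermx W) * nrm1 (Q g) * k)).
      rewrite ler_wpM2r// (le_trans (nrm1M _ _))// ler_wpM2r ?nrm1_ge0//.
    by rewrite mulrAC (mulrAC C3) -mulrA [nrm1 _ * nrm1 _]mulrC mulrA (mulrAC C3).
  exists (C3 * k * (C3 * k) * C) => g Bg u u' uU u'U.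
  have h1 := hQ g u Bg uU.
  have u'gU : (u' *m rho g <= U)%MS.
    exact: submx_trans (submxMr _ u'U) (sU _ Bg).
  have := hQ _ _ (BV _ Bg) u'gU.
  rewrite -[u' *m rho g *m rho _]mulmxA rhoV mulmx1 => h2.
  have := ler_pM (nrm1_ge0 _) (nrm1_ge0 _) h1 h2 => /le_trans; apply.
  set x := nrm1 (u *m cokermx W); set y := nrm1 (u' *m _ *m _).
  have xy0 : 0 <= C3 * k * (C3 * k) * (x * y).
    by rewrite !mulr_ge0// ?nrm1_ge0// ltW.
  have := ler_wpM2l xy0 (CP g Bg); set q := nrm1 (Q g); set q' := nrm1 _.
  by clearbody x y q q'; clear; lra.
apply: contrapT => noC.
have /choice[g gP] : forall n : nat, exists g : G,
    B g /\ n.+1%:R < nrm1 (Q g) * nrm1 (Q g^-1%g).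
  move=> n; apply: contrapT => h; apply: noC; exists n.+1%:R => x Bx.
  by rewrite leNgt; apply/negP => hx; apply: h; exists x.
have Bg n : B (g n) by case: (gP n).
have qq n : 0 < nrm1 (Q (g n)) /\ 0 < nrm1 (Q (g n)^-1%g).
  have [_ /(lt_trans (ltr0Sn R n))] := gP n.
  rewrite lt0r mulf_eq0 negb_or => /andP[/andP[a0 b0] _].
  by rewrite !lt0r a0 b0 !nrm1_ge0.
have q0 n : 0 < nrm1 (Q (g n)) by case: (qq n).
have q'0 n : 0 < nrm1 (Q (g n)^-1%g) by case: (qq n).
pose Tn n := (nrm1 (Q (g n)))^-1 *: Q (g n).
pose Sn n := (nrm1 (Q (g n)^-1%g))^-1 *: Q (g n)^-1%g.
have nTn n : nrm1 (Tn n) = 1.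
  by rewrite nrm1Z gtr0_norm ?invr_gt0// mulVf// gt_eqF.
have nSn n : nrm1 (Sn n) = 1.
  by rewrite nrm1Z gtr0_norm ?invr_gt0// mulVf// gt_eqF.
(* [Q (g n)] times [Q (g n)^-1] is [P], here divided by a product of norms exceeding [n.+1]; hence
   [T *m S = 0] in the limit. *)
have TSn n : nrm1 (Tn n *m Sn n) <= nrm1 P * n.+1%:R^-1.
  rewrite -scalemxAl -scalemxAr QV// scalerA nrm1Z -invfM.
  rewrite gtr0_norm ?invr_gt0 ?mulr_gt0// mulrC ler_wpM2l ?nrm1_ge0//.
  rewrite lef_pV2 ?posrE ?mulr_gt0// ltW//.
  by case: (gP n).
have PTn n : P *m Tn n = Tn n by rewrite -scalemxAr !mulmxA PP.
have PSn n : P *m Sn n = Sn n by rewrite -scalemxAr !mulmxA PP.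
pose T := ulim_mx Tn; pose S := ulim_mx Sn.
have approx (eta : R) : 0 < eta -> exists n,
    [/\ nrm1 (Tn n - T) <= eta, nrm1 (Sn n - S) <= eta & n.+1%:R^-1 <= eta].
  move=> eta0; have FU := @free_ultra_proper.
  have Tb n : nrm1 (Tn n) <= 1 by rewrite nTn.
  have Sb n : nrm1 (Sn n) <= 1 by rewrite nSn.
  have h1 := ulim_mx_near Tb eta0; have h2 := ulim_mx_near Sb eta0.
  have h3 : free_ultra [set n : nat | n.+1%:R^-1 <= eta].
    apply: (proj2 free_ultraP).
    have /cvgr0Pnorm_le/(_ _ eta0) := @cvg_harmonic R.
    by apply: filterS => k /=; exact: le_trans (ler_norm _).
  have [n [[k1 k2] k3]] := filter_ex (filterI (filterI h1 h2) h3).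
  exact: (ex_intro _ n (And3 k1 k2 k3)).
have Pfix (X : 'M[R]_d) (Xn : nat -> 'M[R]_d) : (forall n, P *m Xn n = Xn n) ->
    (forall eta : R, 0 < eta -> exists n, nrm1 (Xn n - X) <= eta) -> P *m X = X.
  move=> PX lX; apply/eqP; rewrite -subr_eq0; apply/eqP.
  apply: (@nrm1_eq0_eps _ _ _ _ (nrm1 P + 1)) => e e0; have [n hn] := lX e e0.
  have -> : P *m X - X = (Xn n - X) - P *m (Xn n - X).
    by rewrite mulmxBr PX opprB [RHS]addrC addrA subrK.
  rewrite (le_trans (nrm1B _ _))// mulrDl mul1r [leRHS]addrC lerD//.
  by rewrite (le_trans (nrm1M _ _))// ler_wpM2l// nrm1_ge0.
have PT : P *m T = T.
  by apply: (Pfix _ _ PTn) => eta /approx[n [k _ _]]; exact: (ex_intro _ n k).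
have PS : P *m S = S.
  by apply: (Pfix _ _ PSn) => eta /approx[n [_ k _]]; exact: (ex_intro _ n k).
have nz (X : 'M[R]_d) (Xn : nat -> 'M[R]_d) : (forall n, nrm1 (Xn n) = 1) ->
    (forall eta : R, 0 < eta -> exists n, nrm1 (Xn n - X) <= eta) -> X <> 0.
  have h2 : (0 : R) < 2^-1 by rewrite invr_gt0.
  have h1 : (2^-1 : R) < 1 by rewrite invf_lt1// ltr1n.
  move=> nX lX X0; have [n] := lX _ h2; rewrite X0 subr0 nX => h3.
  by have := le_lt_trans h3 h1; rewrite ltxx.
have T0 : T <> 0 by apply: (nz _ _ nTn) => eta /approx[n [k _ _]]; exact: (ex_intro _ n k).
have S0 : S <> 0 by apply: (nz _ _ nSn) => eta /approx[n [_ k _]]; exact: (ex_intro _ n k).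
have TS : T *m S = 0.
  apply: (@nrm1_eq0_eps _ _ _ _ (nrm1 P + 1 + nrm1 T)) => e e0.
  have [n [h1 h2 h3]] := approx e e0.
  have -> : T *m S = Tn n *m Sn n - (Tn n - T) *m Sn n - T *m (Sn n - S).
    by rewrite mulmxBl mulmxBr !subKr.
  rewrite (le_trans (nrm1B _ _))// mulrDl lerD//.
    rewrite (le_trans (nrm1B _ _))// mulrDl mul1r lerD//.
      by rewrite (le_trans (TSn n))// ler_wpM2l// nrm1_ge0.
    by rewrite (le_trans (nrm1M _ _))// nSn mulr1.
  by rewrite (le_trans (nrm1M _ _))// ler_wpM2l// nrm1_ge0.
have notm (X : 'M[R]_d) : P *m X = X -> X <> 0 ->
    ~ massive W (U :&: kermx X)%MS.
  move=> PX X0; apply: Umin.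
  - rewrite sub_capmx WU; apply/sub_kermxP.
    by rewrite -PX mulmxA WP mul0mx.
  - exact: submx_trans (capmxSl _ _) UW0.
  - rewrite ltnNge; apply/negP => rk; apply: X0.
    have UX : (U <= U :&: kermx X)%MS.
      rewrite -(mxrank_leqif_sup (capmxSl _ _)) eqn_leq rk andbT.
      exact: mxrankS (capmxSl _ _).
    rewrite -PX; apply/sub_kermxP; apply: submx_trans PU _.
    exact: submx_trans UX (capmxSr _ _).
have d4 : 0 < delta / 2 / 2 by rewrite !divr_gt0.
have [e1 e10 he1] := not_massive (notm T PT T0) d4.
have [e2 e20 he2] := not_massive (notm S PS S0) d4.
pose e := Num.min e1 e2.
have e0 : 0 < e by rewrite lt_min e10.
have [eta eta0 etaP] := furstenberg_dichotomy WP PP Pproj PT PS TS e0.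
have [n [hn _ _]] := approx eta eta0.
have [e' e'0 he'] := etaP _ _ (q0 n) (sU _ (Bg n)) (sW _ (Bg n)) hn.
have := Um _ e'0; apply/negP; rewrite -ltNge.
apply: le_lt_trans (le_mean mP (A := cone U W e')
  (B := cone (U :&: kermx T)%MS W e `|`
        [set v | cone (U :&: kermx S)%MS W e (v *m rho (g n))]) _) _.
  by move=> v /he'.
apply: le_lt_trans (le_meanU mP _ _) _; rewrite minv//.
have k1 : m (cone (U :&: kermx T)%MS W e) <= delta / 2 / 2.
  apply: le_trans he1; apply: (le_mean mP); apply: cone_mono.
  by rewrite ge_min lexx.
have k2 : m (cone (U :&: kermx S)%MS W e) <= delta / 2 / 2.
  apply: le_trans he2; apply: (le_mean mP); apply: cone_mono.
  by rewrite ge_min lexx orbT.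
apply: le_lt_trans (lerD k1 k2) _.
by rewrite -splitr ltr_pdivrMr// ltr_pMr// ltr1n.
Qed.

End InvariantMean.

(** * Flags of bounded distortion and contraction by commutators *)

Lemma halving_seq_cvg0 (R : realType) (a b : nat -> R) :
  (forall j, a j.+1 <= a j / 2 + b j) ->
  (forall e : R, 0 < e -> exists J, forall j, (J <= j)%N -> b j <= e) ->
  forall e : R, 0 < e -> exists J, forall j, (J <= j)%N -> a j <= e.
Proof.
move=> ab b0 e e0.
have e4 : 0 < e / 2 / 2 by rewrite !divr_gt0.
have [J bJ] := b0 _ e4.
have aJ k : a (J + k)%N <= `|a J| / 2 ^+ k + e / 2.
  elim: k => [|k IH].
    by rewrite addn0 expr0 divr1 (le_trans (ler_norm _))// lerDl divr_ge0// ltW.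
  rewrite addnS (le_trans (ab _))// exprSr invfM mulrA.
  have := bJ _ (leq_addr k J); move: IH.
  move: (a _) (b _) (`|_| / _) => x y z; lra.
pose k0 := (Num.trunc (`|a J| / (e / 2))).+1.
exists (J + k0)%N => j /subnKC <-; rewrite -addnA (le_trans (aJ _))//.
rewrite [leRHS]splitr lerD2r ler_pdivrMr ?exprn_gt0// mulrC -ler_pdivrMr ?divr_gt0//.
have e2 : 0 < e / 2 by rewrite divr_gt0.
apply: (@le_trans _ _ k0%:R).
  by rewrite ltW// truncnS_gt.
rewrite -natrX ler_nat (leq_trans (leq_addr (j - (J + k0)) k0))//.
by rewrite ltnW// ltn_expl.
Qed.

Lemma le_half_le0 (R : realType) (x : R) : x <= 2^-1 * x -> x <= 0.
Proof. lra. Qed.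

(** One step of the recursion in [contracts_step]: [a] and [a'] are the norms modulo W of an iterate
    and of the next one, [u] the norm modulo W of its component in U, and [z] the norm of the
    remaining component, at most [C] times the norm [b] modulo U. *)
Lemma contraction_arith (R : realType) (C a a' b u z k l : R) :
  0 <= C -> 0 <= k -> 0 <= b -> a' <= u / 2 + z * l -> u <= a + z * k ->
  z * l <= C * b * l -> z * k <= C * b * k ->
  a' <= a / 2 + (C * (k + l) + 1) * b.
Proof.
move=> C0 k0 b0 h1 h2 h3 h4.
have h5 : 0 <= C * b * k by rewrite !mulr_ge0.
lra.
Qed.

Section Flag.
Context (R : realType) (d : nat) (G : groupType) (rho : G -> 'M[R]_d).
Context (rho1 : rho 1%g = 1%:M).
Context (rhoM : forall a b, rho (a * b)%g = rho a *m rho b).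
Context (m : set 'rV[R]_d -> R) (mP : is_mean m).

Definition rcommg (a b : G) : G := (a * b * a^-1 * b^-1)%g.

Lemma stableS (B B' : set G) (W : 'M[R]_d) : B' `<=` B -> stable rho B W ->
  stable rho B' W.
Proof. by move=> BB sW g /BB; exact: sW. Qed.

Lemma bounded_distortionS (B B' : set G) (W U : 'M[R]_d) C : B' `<=` B ->
  bounded_distortion rho B W U C -> bounded_distortion rho B' W U C.
Proof. by move=> BB h g /BB; exact: h. Qed.

(** All the mass lies in [W0], so [W0] is massive, and a massive [U] of least dimension between [W]
    and [W0] exists. *)
Lemma quotient_step (B : set G) (W W0 : 'M[R]_d) :
  is_subgroup B -> invariant rho m B -> stable rho B W -> stable rho B W0 ->
  (W < W0)%MS -> m [set v | (v <= W)%MS] = 0 ->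
  m [set v | ~~ (v <= W0)%MS] = 0 -> 0 < m setT ->
  exists (U : 'M[R]_d) (B' : set G) (C : R), [/\ (W < U)%MS, (U <= W0)%MS &
    [/\ is_subgroup B', B' `<=` B, fin_index B B', stable rho B' U &
        bounded_distortion rho B' W U C]].
Proof.
move=> Bgrp minv sW sW0 WW0 mW mW0 mT.
have W0m : massive m W W0.
  exists (m setT) => // e e0.
  have := le_meanU mP (cone W0 W e) [set v | ~~ (v <= W0)%MS].
  rewrite mW0 addr0; apply: le_trans; apply: (le_mean mP) => v _ /=.
  by have [vW0|] := boolP (v <= W0)%MS; [left; exact: cone_full (ltW e0) vW0|right].
pose Pr n := exists U : 'M[R]_d,
  [/\ (W <= U)%MS, (U <= W0)%MS, massive m W U & \rank U = n].
have exP : exists n, `[< Pr n >].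
  by exists (\rank W0); apply/asboolP; exists W0; split=> //; exact: ltmxW.
case: (ex_minnP exP) => n /asboolP[U [WU UW0 Um rkU]] nmin.
have Umin (X : 'M[R]_d) : (W <= X)%MS -> (X <= W0)%MS -> (\rank X < \rank U)%N ->
    ~ massive m W X.
  move=> WX XW0 rkX Xm; move: rkX; rewrite ltnNge => /negP; apply.
  by rewrite rkU; apply: nmin; apply/asboolP; exists X.
(* [W] itself is not massive: for aperture 1/2, the cone around [W] relative to [W] is just [W],
   which has mean 0. *)
have WltU : (W < U)%MS.
  rewrite ltmxE WU; apply/negP => UW; case: Um => delta delta0 Um.
  have [C C0 CP] := cone_eqmx W (eqmxP (introT andP (conj UW WU))).
  have e0 : 0 < 2^-1 / C by rewrite divr_gt0// invr_gt0.
  have := Um _ e0; apply/negP; rewrite -ltNge (le_lt_trans _ delta0)// -mW.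
  apply: (le_mean mP) => v /CP; rewrite mulrCA mulfV ?gt_eqF// mulr1 => vW.
  apply/mul_cokermx_eq0/nrm1_eq0/eqP; rewrite eq_le nrm1_ge0 andbT.
  exact: le_half_le0 vW.
have fB := massive_stabilizer rho1 rhoM mP Bgrp minv sW sW0 WU UW0 Um Umin.
have sB := @stabilizer_subgroup R d G rho rho1 rhoM B U Bgrp.
have BB : stabilizer rho B U `<=` B by move=> g [].
have sU : stable rho (stabilizer rho B U) U by move=> g [_ /andP[]].
have minv' : invariant rho m (stabilizer rho B U) by move=> g /BB; exact: minv.
have [C CP] := massive_bounded_distortion rho1 rhoM mP sB minv'
  (stableS BB sW) sU WU UW0 Um Umin.
by exists U, (stabilizer rho B U), C.
Qed.

Definition contracts (y W W0 : 'M[R]_d) : Prop :=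
  forall v : 'rV[R]_d, (v <= W0)%MS -> forall e : R, 0 < e ->
  exists J, forall j, (J <= j)%N -> nrm1 (v *m y ^+ j *m cokermx W) <= e.

(* In a commutator the unknown scaling factors cancel. *)
Lemma commutator_bound (B : set G) (W U : 'M[R]_d) (C : R) a b :
  is_subgroup B -> stable rho B W -> stable rho B U ->
  bounded_distortion rho B W U C -> B a -> B b ->
  forall u : 'rV[R]_d, (u <= U)%MS ->
  nrm1 (u *m rho (rcommg a b) *m cokermx W) <= C ^+ 2 * nrm1 (u *m cokermx W).
Proof.
move=> Bgrp sW sU dist Ba Bb u uU; have [B1 BM BV] := Bgrp.
have subU (v : 'rV[R]_d) g : B g -> (v <= U)%MS -> (v *m rho g <= U)%MS.
  by move=> Bg vU; exact: submx_trans (submxMr _ vU) (sU _ Bg).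
pose u1 := u *m rho a; pose u2 := u1 *m rho b.
pose u3 := u2 *m rho a^-1%g; pose u4 := u3 *m rho b^-1%g.
have u1U : (u1 <= U)%MS by exact: subU.
have u2U : (u2 <= U)%MS by exact: subU.
have u3U : (u3 <= U)%MS by apply: subU => //; exact: BV.
have u4U : (u4 <= U)%MS by apply: subU => //; exact: BV.
have -> : u *m rho (rcommg a b) = u4 by rewrite /rcommg !rhoM !mulmxA.
have := dist a Ba u u3 uU u3U; have := dist b Bb u1 u4 u1U u4U.
have -> : u3 *m rho a = u2 by rewrite /u3 -mulmxA rhoVr// mulmx1.
have -> : u4 *m rho b = u3 by rewrite /u4 -mulmxA rhoVr// mulmx1.
rewrite -/u1 -/u2.
have [u20|u20] := eqVneq (nrm1 (u2 *m cokermx W)) 0.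
  move=> _ _; have u2W : (u2 <= W)%MS by exact/mul_cokermx_eq0/nrm1_eq0.
  have u4W : (u4 <= W)%MS.
    rewrite /u4 /u3 -mulmxA -rhoM.
    apply: submx_trans (submxMr _ u2W) (sW _ _).
    by apply: BM; exact: BV.
  have /mul_cokermx_eq0 -> := u4W.
  by rewrite nrm10 mulr_ge0 ?sqr_ge0 ?nrm1_ge0.
move: u20; have := nrm1_ge0 (u2 *m cokermx W).
have := nrm1_ge0 (u *m cokermx W).
have := nrm1_ge0 (u1 *m cokermx W); have := nrm1_ge0 (u3 *m cokermx W).
have := nrm1_ge0 (u4 *m cokermx W).
move: (nrm1 (u *m _)) (nrm1 (u1 *m _)) (nrm1 (u2 *m _)) (nrm1 (u3 *m _))
  (nrm1 (u4 *m _)) => x0 x1 x2 x3 x4.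
move=> x40 x30 x10 x00 x20 x2n h1 h2.
have {x2n}x2p : 0 < x2 by rewrite lt0r x2n.
rewrite -(ler_pM2l x2p).
have [C0|C0] := lerP 0 C.
  apply: le_trans h1 _; apply: le_trans (ler_wpM2l C0 h2) _.
  by rewrite mulrCA mulrA expr2 [x0 * x2]mulrC mulrCA.
have : x2 * x4 <= 0.
  by apply: le_trans h1 _; rewrite mulr_le0_ge0 ?(ltW C0)// mulr_ge0.
move=> /le_trans; apply.
exact: mulr_ge0 x20 (mulr_ge0 (sqr_ge0 C) x00).
Qed.

(** By [commutator_bound] and the size of [N], the operator [y] at least halves norms on [U / W].
    Its iterates approach [U] by hypothesis, so their norms modulo [W] obey a halving recursion with
    an error tending to 0. *)
Lemma contracts_step (B : set G) (W U W0 : 'M[R]_d) (C : R) a b (N : R) y :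
  is_subgroup B -> stable rho B W -> stable rho B U ->
  bounded_distortion rho B W U C -> B a -> B b ->
  2 * (C ^+ 2 + 1) <= N -> rho (rcommg a b) = 1%:M + N *: y ->
  contracts y U W0 -> contracts y W W0.
Proof.
move=> Bgrp sW sU dist Ba Bb CN xE cU v vW0.
have N0 : 0 < N.
  by rewrite (lt_le_trans _ CN)// mulr_gt0// ltr_wpDl// sqr_ge0.
have half (u : 'rV[R]_d) : (u <= U)%MS ->
    nrm1 (u *m y *m cokermx W) <= nrm1 (u *m cokermx W) / 2.
  move=> uU; have := commutator_bound Bgrp sW sU dist Ba Bb uU.
  rewrite xE => h.
  have : N * nrm1 (u *m y *m cokermx W) <=
      (C ^+ 2 + 1) * nrm1 (u *m cokermx W).
    have -> : N * nrm1 (u *m y *m cokermx W) =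
        nrm1 (u *m (1%:M + N *: y) *m cokermx W - u *m cokermx W).
      rewrite mulmxDr mulmx1 mulmxDl [_ + _ *m cokermx W]addrC addrK.
      by rewrite -scalemxAr -scalemxAl nrm1Z gtr0_norm.
    by rewrite (le_trans (nrm1B _ _))// mulrDl mul1r lerD2r.
  move: (nrm1_ge0 (u *m cokermx W)).
  move: (nrm1 (u *m y *m _)) (nrm1 (u *m cokermx W)) => s t t0 Ns.
  rewrite -(ler_pM2l N0) (le_trans Ns)//.
  by rewrite [N * _]mulrA ler_pdivlMr// mulrC mulrA ler_wpM2r.
have [w|C4 C40 hz] := @le_nrm1_ker R d _ _ (cokermx U) (1%:M - proj_mx U U^C%MS).
  move=> /mul_cokermx_eq0 wU.
  by rewrite mulmxBr mulmx1 proj_mx_id ?subrr// capmx_compl.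
pose D := C4 * (nrm1 (cokermx W) + nrm1 (y *m cokermx W)) + 1.
have D0 : 0 < D by rewrite ltr_wpDl// mulr_ge0 ?addr_ge0 ?nrm1_ge0// ltW.
apply: (@halving_seq_cvg0 R _ (fun j => D * nrm1 (v *m y ^+ j *m cokermx U))).
  move=> j; rewrite exprSr -mulmxE mulmxA; set w := v *m y ^+ j.
  pose u := w *m proj_mx U U^C%MS; pose z := w *m (1%:M - proj_mx U U^C%MS).
  have wE : w = u + z by rewrite /z mulmxBr mulmx1 addrC subrK.
  have uU : (u <= U)%MS by exact: proj_mx_sub.
  have zle := hz w; rewrite -/z in zle; clearbody u z.
  have h1 : nrm1 (w *m y *m cokermx W) <=
      nrm1 (u *m cokermx W) / 2 + nrm1 z * nrm1 (y *m cokermx W).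
    rewrite {1}wE !mulmxDl (le_trans (nrm1D _ _))// lerD//; first exact: half.
    by rewrite -mulmxA nrm1M.
  have h2 : nrm1 (u *m cokermx W) <=
      nrm1 (w *m cokermx W) + nrm1 z * nrm1 (cokermx W).
    have -> : u = w - z by rewrite wE addrK.
    by rewrite mulmxBl (le_trans (nrm1B _ _))// lerD2l nrm1M.
  have k1 := ler_wpM2r (nrm1_ge0 (y *m cokermx W)) zle.
  have k2 := ler_wpM2r (nrm1_ge0 (cokermx W)) zle.
  exact: (contraction_arith (ltW C40) (nrm1_ge0 _) (nrm1_ge0 _) h1 h2 k1 k2).
move=> e e0; have [J hJ] := cU v vW0 (e / D) (divr_gt0 e0 D0).
by exists J => j /hJ; rewrite ler_pdivlMr// mulrC.
Qed.

(** Induction on the codimension of [W] in [W0], each step enlarging [W] to the [U] of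
    [quotient_step]. Only the final subgroup and the threshold [N0] are kept; [N0] depends on the
    distortion constants alone, so [N] may be chosen afterwards. *)
Lemma flag_contracts (B : set G) (W W0 : 'M[R]_d) :
  is_subgroup B -> invariant rho m B -> stable rho B W -> stable rho B W0 ->
  (W <= W0)%MS ->
  (forall X : 'M[R]_d, (X < W0)%MS -> m [set v | (v <= X)%MS] = 0) ->
  m [set v | ~~ (v <= W0)%MS] = 0 -> 0 < m setT ->
  exists (B' : set G) (N0 : R), [/\ is_subgroup B', B' `<=` B, fin_index B B' &
    forall a b N y, B' a -> B' b -> N0 <= N ->
      rho (rcommg a b) = 1%:M + N *: y -> contracts y W W0].
Proof.
move: {2}(\rank W0 - \rank W)%N (leqnn (\rank W0 - \rank W)) => n.
elim: n B W => [|n IH] B W rk Bgrp minv sW sW0 WW0 mlt mW0 mT.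
  have W0W : (W0 <= W)%MS.
    rewrite -(mxrank_leqif_sup WW0) eqn_leq mxrankS//.
    by rewrite -subn_eq0 -leqn0.
  (* Here [W0] is contained in [W], and [y] only has to preserve [W0]; the threshold 1 makes [N]
     nonzero, so that [y] is recovered from the commutator. *)
  exists B, 1; split=> //; first exact: fin_index_refl.
  move=> a b N y Ba Bb N1 xE v vW0 e e0; exists 0%N => j _.
  suff /mul_cokermx_eq0 -> : (v *m y ^+ j <= W)%MS by rewrite nrm10 ltW.
  apply: submx_trans W0W.
  have N0 : N != 0 by rewrite gt_eqF// (lt_le_trans ltr01).
  have yE : y = N^-1 *: (rho (rcommg a b) - 1%:M).
    by rewrite xE addrC addKr scalerA mulVf// scale1r.
  have [_ BM BV] := Bgrp.
  have step (w : 'rV[R]_d) : (w <= W0)%MS -> (w *m y <= W0)%MS.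
    move=> wW0; rewrite yE -scalemxAr scalemx_sub// mulmxBr mulmx1.
    apply: addmx_sub; last by rewrite eqmx_opp.
    apply: submx_trans (submxMr _ wW0) (sW0 _ _).
    exact: BM _ _ (BM _ _ (BM _ _ Ba Bb) (BV _ Ba)) (BV _ Bb).
  elim: j => [|j IHj]; first by rewrite expr0 mulmx1.
  by rewrite exprSr -mulmxE mulmxA step.
have [W0W|nW0W] := boolP (W0 <= W)%MS.
  apply: IH => //; move: (mxrankS W0W); rewrite -subn_eq0 => /eqP ->; exact: leq0n.
have WltW0 : (W < W0)%MS by rewrite ltmxE WW0.
have [U [B1 [C [WU UW0 [B1grp B1B fB1 sU dist]]]]] :=
  quotient_step Bgrp minv sW sW0 WltW0 (mlt _ WltW0) mW0 mT.
have rkU : (\rank W0 - \rank U <= n)%N.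
  rewrite leq_subLR (leq_trans _ (leq_add (rank_ltmx WU) (leqnn n)))//.
  by rewrite addSn -addnS -leq_subLR.
have [|B2 [N0 [B2grp B21 fB2 cB2]]] :=
  IH B1 U rkU B1grp _ sU (stableS B1B sW0) UW0 mlt mW0 mT.
  by move=> g /B1B; exact: minv.
exists B2, (Num.max N0 (2 * (C ^+ 2 + 1))); split=> //.
- exact: subset_trans B21 B1B.
- exact: fin_index_trans Bgrp B1grp B1B B2grp fB1 fB2.
move=> a b N y B2a B2b; rewrite ge_max => /andP[N0N CN] xE.
apply: (contracts_step (B := B2) (U := U) _ _ _ _ B2a B2b CN xE) => //.
- exact: stableS (subset_trans B21 B1B) sW.
- exact: stableS B21 sU.
- exact: bounded_distortionS B21 dist.
- exact: cB2 B2a B2b N0N xE.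
Qed.

(* Otherwise the iterates of x = 1 + N y would grow along u but fix u y. *)
Lemma distortion_unipotent (B : set G) (U : 'M[R]_d) (C : R) x (N : R) y :
  is_subgroup B -> stable rho B U -> bounded_distortion rho B 0 U C ->
  B x -> 0 < N -> rho x = 1%:M + N *: y ->
  forall J (u : 'rV[R]_d), (u <= U)%MS -> u *m y ^+ J = 0 -> u *m y = 0.
Proof.
move=> [B1 BM BV] sU dist Bx N0 xE; elim=> [|J IH] u uU.
  by rewrite expr0 mulmx1 => ->; rewrite mul0mx.
rewrite exprS -mulmxE mulmxA => uyJ.
have yE : y = N^-1 *: (rho x - 1%:M).
  by rewrite xE addrC addKr scalerA mulVf ?scale1r// gt_eqF.
have wU : (u *m y <= U)%MS.
  rewrite yE -scalemxAr scalemx_sub// mulmxBr mulmx1 addmx_sub ?eqmx_opp//.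
  exact: submx_trans (submxMr _ uU) (sU _ Bx).
have wy := IH _ wU uyJ; set w := u *m y in wU wy *.
have Bxi i : B (x ^+ i)%g.
  by elim: i => [|i IHi]; [rewrite expg0|rewrite expgS; exact: BM].
have wx i : w *m rho (x ^+ i)%g = w.
  elim: i => [|i IHi]; first by rewrite expg0 rho1 mulmx1.
  by rewrite expgS rhoM mulmxA xE mulmxDr mulmx1 -scalemxAr wy scaler0 addr0.
have ux i : u *m rho (x ^+ i)%g = u + (i%:R * N) *: w.
  elim: i => [|i IHi]; first by rewrite expg0 rho1 mulmx1 mul0r scale0r addr0.
  rewrite expgS rhoM mulmxA xE mulmxDr mulmx1 -scalemxAr mulmxDl IHi.
  by rewrite -scalemxAl wx -addrA -scalerDl mulrSr mulrDl mul1r.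
apply: contrapT => /eqP w0.
have wK : 0 < nrm1 (w *m cokermx (0 : 'M[R]_d)).
  rewrite lt0r nrm1_ge0 andbT; apply/negP => /eqP/nrm1_eq0/mul_cokermx_eq0.
  by rewrite submx0; apply/negP.
have bd i : i%:R * (N * nrm1 (w *m cokermx (0 : 'M[R]_d))) <=
    (C + 1) * nrm1 (u *m cokermx (0 : 'M[R]_d)).
  have := dist _ (Bxi i) _ _ uU wU; rewrite wx ux mulrA ler_pM2r// => h.
  rewrite mulrA.
  have -> : i%:R * N * nrm1 (w *m cokermx (0 : 'M[R]_d)) =
      nrm1 ((u + (i%:R * N) *: w) *m cokermx (0 : 'M[R]_d) - u *m cokermx (0 : 'M[R]_d)).
    rewrite mulmxDl addrC addKr -scalemxAl nrm1Z ger0_norm//.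
    by rewrite mulr_ge0// ltW.
  by rewrite (le_trans (nrm1B _ _))// mulrDl mul1r lerD2r.
have Nw0 : 0 < N * nrm1 (w *m cokermx (0 : 'M[R]_d)) by rewrite mulr_gt0.
have := bd (Num.trunc ((C + 1) * nrm1 (u *m cokermx (0 : 'M[R]_d)) /
   (N * nrm1 (w *m cokermx (0 : 'M[R]_d))))).+1.
rewrite -ler_pdivlMr// leNgt => /negP; apply.
exact: truncnS_gt.
Qed.

End Flag.

(** * Integral matrix groups preserving a mean on the lattice *)

Section IntegralGroup.
Context (R : realType) (d : nat) (G : groupType) (rhoZ : G -> 'M[int]_d).
Context (rhoZ1 : rhoZ 1%g = 1%:M).
Context (rhoZM : forall a b, rhoZ (a * b)%g = rhoZ a *m rhoZ b).
Local Notation toR := (map_mx (intr : int -> R)).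
Local Notation rho := (fun g => toR (rhoZ g)).
Context (m : set 'rV[R]_d -> R) (mP : is_mean m).

Lemma toR_rho1 : rho 1%g = 1%:M.
Proof. by rewrite /= rhoZ1 map_mx1. Qed.

Lemma toR_rhoM a b : rho (a * b)%g = rho a *m rho b.
Proof. by rewrite /= rhoZM map_mxM. Qed.

Definition integral : set 'rV[R]_d := [set v | exists k : 'rV[int]_d, v = toR k].

(* Integral vectors tending to 0 are eventually 0. *)
Lemma contracts_nilpotent p (Y : 'M[int]_(p, d)) (y : 'M[int]_d) (W0 : 'M[R]_d) :
  (toR Y <= W0)%MS -> contracts (toR y) 0 W0 ->
  exists J, toR Y *m toR y ^+ J = 0.
Proof.
move=> YW0 cy.
have [v|C C0 hC] := @le_nrm1_ker R d _ _ (cokermx (0 : 'M[R]_d)) 1%:M.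
  by move=> /mul_cokermx_eq0; rewrite submx0 => /eqP ->; rewrite mul0mx.
have toRX j : toR y ^+ j = toR (y ^+ j).
  elim: j => [|j IH]; first by rewrite !expr0 map_mx1.
  by rewrite !exprSr -!mulmxE map_mxM IH.
have Ji (i : 'I_p) : exists J, forall j, (J <= j)%N ->
    row i (toR Y) *m toR y ^+ j = 0.
  have e0 : 0 < (2 * C)^-1 by rewrite invr_gt0 mulr_gt0.
  have [J hJ] := cy (row i (toR Y)) (submx_trans (row_sub _ _) YW0) _ e0.
  exists J => j /hJ h; rewrite -map_row toRX -map_mxM.
  suff -> : row i Y *m y ^+ j = 0 by rewrite map_mx0.
  apply: (@nrm1_lt1_int R); rewrite map_mxM -toRX map_row -[X in nrm1 X]mulmx1.
  rewrite (le_lt_trans (hC _))//.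
  apply: le_lt_trans (ler_wpM2l (ltW C0) h) _.
  by rewrite invfM mulrCA mulfV ?gt_eqF// mulr1 invf_lt1// ltr1n.
have [J JP] := choice Ji.
exists (\max_i J i)%N; apply/row_matrixP => i; rewrite row_mul row0.
exact/JP/leq_bigmax.
Qed.

(** The kernel of reduction modulo [p]; the reduction itself is the colouring, with values in the
    finite set of matrices over ['F_p]. *)
Lemma congruence_subgroup (A : set G) (p : nat) : prime p ->
  exists B : set G, [/\ is_subgroup B, fin_index A B & forall g, B g ->
    exists y : 'M[int]_d, toR (rhoZ g) = 1%:M + p%:R *: toR y].
Proof.
move=> pp; pose c g : 'M['F_p]_d := map_mx intr (rhoZ g).
have c1 : c 1%g = 1%:M by rewrite /c rhoZ1 map_mx1.
have cM a b : c (a * b)%g = c a *m c b by rewrite /c rhoZM map_mxM.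
exists [set g | c g = 1%:M]; split.
- split=> [//|a b|a] /=; first by rewrite cM => -> ->; rewrite mulmx1.
  by move=> ca; have := cM a^-1%g a; rewrite mulVg c1 ca mulmx1.
- exists 'M['F_p]_d, c => a b _ _ cab /=.
  by rewrite cM -cab -cM mulVg c1.
- move=> g /= cg; exists (\matrix_(i, j) ((rhoZ g - 1%:M) i j %/ p)%Z).
  apply/matrixP => i j; rewrite !mxE.
  have pd : (p %| (rhoZ g - 1%:M) i j)%Z.
    rewrite (dvdz_pcharf (pchar_Fp pp)) !mxE rmorphB /= rmorph_nat.
    by move/matrixP: cg => /(_ i j); rewrite !mxE => ->; rewrite subrr.
  have : (rhoZ g - 1%:M) i j = ((rhoZ g - 1%:M) i j %/ p)%Z * p by rewrite divzK.
  set q := (_ %/ _)%Z; rewrite !mxE => /eqP; rewrite subr_eq => /eqP ->.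
  rewrite rmorphD rmorphM /= rmorph_nat addrC mulrC.
  by rewrite addrK mulzK // eqz_nat -lt0n prime_gt0.
Qed.

(** For an integral [Y] of maximal rank with rows in [W0], appending one more integral vector of
    [W0] cannot raise the rank. *)
Lemma integral_span (W0 : 'M[R]_d) : exists p (Y : 'M[int]_(p, d)),
  (toR Y <= W0)%MS /\
  forall k : 'rV[int]_d, (toR k <= W0)%MS -> (toR k <= toR Y)%MS.
Proof.
pose P n := exists p (Y : 'M[int]_(p, d)), (toR Y <= W0)%MS /\ \rank (toR Y) = n.
have exP : exists n, `[< P n >].
  exists 0%N; apply/asboolP; exists 0%N, 0; rewrite map_mx0 sub0mx.
  by rewrite mxrank0.
have leP n : `[< P n >] -> (n <= d)%N.
  by move=> /asboolP[p [Y [_ <-]]]; exact: rank_leq_col.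
case: (ex_maxnP exP leP) => n /asboolP[p [Y [YW0 rkY]]] nmax.
exists p, Y; split=> // k kW0.
have YYk : (toR Y <= toR (col_mx Y k))%MS.
  by have := submx_refl (toR (col_mx Y k)); rewrite {1}map_col_mx col_mx_sub => /andP[].
have kYk : (toR k <= toR (col_mx Y k))%MS.
  by have := submx_refl (toR (col_mx Y k)); rewrite {1}map_col_mx col_mx_sub => /andP[].
apply: submx_trans kYk _; rewrite -(mxrank_leqif_sup YYk) eqn_leq mxrankS//=.
rewrite rkY; apply: nmax; apply/asboolP; exists (p + 1)%N, (col_mx Y k).
by rewrite map_col_mx col_mx_sub YW0.
Qed.

(** The vector [u] is taken in the first step of the flag, where distortion is bounded relative to
    0. Normalisation of [C] by [A] is part of the conclusion because the subspace built later from
    commutators of [C] has to be invariant under all of [A]. *)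
Lemma fixed_vector_of_mean (A : set G) : is_subgroup A ->
  invariant rho m A -> m (~` integral) = 0 -> m [set 0] = 0 -> 0 < m setT ->
  exists (C : set G) (u : 'rV[R]_d),
    [/\ is_subgroup C, C `<=` A, fin_index A C,
        forall a x, A a -> C x -> C (a * x * a^-1)%g & u != 0 /\
        forall a b, C a -> C b -> u *m rho (rcommg a b) = u].
Proof.
move=> Agrp minv mint m00 mT.
pose mW (W : 'M[R]_d) := m [set v | (v <= W)%MS].
have exP : exists n, `[< exists2 W, 0 < mW W & \rank W = n >].
  exists d; apply/asboolP; exists 1%:M; last exact: mxrank1.
  by apply: lt_le_trans mT _; apply: (le_mean mP) => v _; exact: submx1.
case: (ex_minnP exP) => n /asboolP[W0 mW0 rkW0] nmin.
have mlt (X : 'M[R]_d) : (\rank X < \rank W0)%N -> mW X = 0.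
  move=> rkX; apply/eqP; rewrite eq_le mean_ge0// andbT leNgt; apply/negP => mX.
  move: rkX; rewrite ltnNge => /negP; apply; rewrite rkW0.
  by apply: nmin; apply/asboolP; exists X.
have unit g : toR (rhoZ g) \in unitmx := rho_unit toR_rho1 toR_rhoM g.
have fB0 : fin_index A (stabilizer rho A W0).
  apply: (@stabilizer_fin_index R d G rho toR_rho1 toR_rhoM m mP A W0
    (fun X _ => [set v | (v <= X)%MS]) (mW W0)) => //.
  - by move=> X e e' _ v.
  - move=> g e Ag e0; rewrite -(minv g Ag); apply: (le_mean mP) => v /= vW0.
    by rewrite genmxE submxMr.
  move=> a b eta Aa Ab ab eta0; exists 1 => //.
  set X := <<W0 *m rho a>>%MS; set Y := <<W0 *m rho b>>%MS.
  apply: (@le_trans _ _ (mW (X :&: Y)%MS)).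
    by apply: (le_mean mP) => v [/= vX vY]; rewrite sub_capmx vX.
  have rkW g : \rank <<W0 *m rho g>>%MS = \rank W0.
    by rewrite mxrank_gen mxrankMfree// row_free_unit.
  rewrite mlt ?ltW// -(rkW a) ltnNge; apply/negP => rk; move/eqP: ab; apply.
  have XY : (X <= X :&: Y)%MS.
    rewrite -(mxrank_leqif_sup (capmxSl X Y)) eqn_leq rk andbT.
    exact: mxrankS (capmxSl X Y).
  have {XY}XY : (X <= Y)%MS by apply: submx_trans XY (capmxSr _ _).
  rewrite -[LHS]genmx_id -[RHS]genmx_id; apply/genmxP.
  rewrite -/X -/Y XY /= -(mxrank_leqif_sup XY) /X /Y.
  by rewrite (rkW a) (rkW b).
pose B0 := stabilizer rho A W0.
have B0grp : is_subgroup B0 := stabilizer_subgroup toR_rho1 toR_rhoM W0 Agrp.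
have B0A : B0 `<=` A by move=> g [].
have sW0 : stable rho B0 W0 by move=> g [_ /andP[]].
(* The mean restricted to [W0] is invariant under the stabilizer [B0], and all proper subspaces of
   [W0] are null for it. *)
pose m0 E := m (E `&` [set v | (v <= W0)%MS]).
have m0P : is_mean m0.
  split=> [E|E F EF]; first exact: (mean_ge0 mP).
  rewrite /m0 setIUl; apply: mP.2.
  by rewrite setIACA EF set0I.
have m0inv : invariant rho m0 B0.
  move=> g Bg E; rewrite /m0.
  rewrite -(minv g (B0A _ Bg) (E `&` [set v | (v <= W0)%MS])); congr m.
  apply/seteqP; split=> v [/= Ev vW]; split=> //=.
    exact: submx_trans (submxMr _ vW) (sW0 _ Bg).
  have := stable_eqmx toR_rho1 toR_rhoM B0grp sW0 Bg => W0g.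
  by move: vW; rewrite -W0g submxMfree// row_free_unit.
have m0T : 0 < m0 setT by rewrite /m0 setTI.
have m0W0 : m0 [set v | ~~ (v <= W0)%MS] = 0.
  rewrite -(mean0 mP) /m0; congr m; apply/seteqP; split=> // v [/= /negP]; exact.
have m0lt (X : 'M[R]_d) : (X < W0)%MS -> m0 [set v | (v <= X)%MS] = 0.
  move=> /rank_ltmx rkX; apply/eqP; rewrite eq_le mean_ge0// andbT.
  by rewrite -(mlt X rkX); apply: (le_mean mP) => v [].
have W0n0 : ((0 : 'M[R]_d) < W0)%MS.
  rewrite ltmxE sub0mx; apply/negP; rewrite submx0 => /eqP W00.
  move: mW0; rewrite /mW W00 ltNge => /negP; apply; rewrite -m00.
  by apply: (le_mean mP) => v /=; rewrite submx0 => /eqP.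
have s0 B : stable rho B (0 : 'M[R]_d) by move=> g _; rewrite mul0mx.
have [U [B1 [C1 [U0 UW0 [B1grp B10 fB1 sU dist]]]]] :=
  quotient_step toR_rho1 toR_rhoM m0P B0grp m0inv (s0 _) sW0 W0n0
    (m0lt _ W0n0) m0W0 m0T.
have m0inv1 : invariant rho m0 B1 by move=> g /B10; exact: m0inv.
have [B2 [N0 [B2grp B21 fB2 cB2]]] := flag_contracts toR_rho1 toR_rhoM m0P
  B1grp m0inv1 sU (stableS B10 sW0) UW0 m0lt m0W0 m0T.
(* Two thresholds: [N0] for the part of the flag from [U] to [W0], and the bound of [contracts_step]
   for the first step, from 0 to [U]. *)
pose M := Num.max N0 (2 * (C1 ^+ 2 + 1)).
have [p pM pp] := prime_above (Num.trunc M).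
have Mp : M <= p%:R.
  by rewrite ltW// (lt_le_trans (truncnS_gt M))// ler_nat.
have p0 : 0 < p%:R :> R by rewrite ltr0n prime_gt0.
have [Gp [Gpgrp fGp Gp1]] := congruence_subgroup A pp.
have fB1A := fin_index_trans Agrp B0grp B0A B1grp fB0 fB1.
have fB2A := fin_index_trans Agrp B1grp (subset_trans B10 B0A) B2grp fB1A fB2.
have B3grp := is_subgroupI B2grp Gpgrp.
have [C [Cgrp CB3 fC Cnorm]] := normal_core Agrp B3grp (fin_indexI fB2A fGp).
have CB2 : C `<=` B2 by move=> g /CB3[].
have [u uU un0] : exists2 u : 'rV[R]_d, (u <= U)%MS & u != 0.
  have [/existsP[i Ui]|] := boolP [exists i, row i U != 0].
    by exists (row i U) => //; exact: row_sub.
  rewrite negb_exists => /forallP U00; move: U0; rewrite ltmxE sub0mx submx0.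
  move=> /negP[]; apply/eqP/row_matrixP => i; rewrite row0.
  by apply/eqP/negbNE/U00.
exists C, u; split=> //.
  exact: subset_trans CB2 (subset_trans B21 (subset_trans B10 B0A)).
split=> // a b Ca Cb.
have [C1' CM CV] := Cgrp.
have Cx : C (rcommg a b).
  exact: CM _ _ (CM _ _ (CM _ _ Ca Cb) (CV _ Ca)) (CV _ Cb).
have [y xE] := Gp1 _ (CB3 _ Cx).2.
have sU2 := stableS B21 sU; have dist2 := bounded_distortionS B21 dist.
have cU : contracts (toR y) U W0.
  apply: cB2 (CB2 _ Ca) (CB2 _ Cb) _ xE.
  by rewrite (le_trans _ Mp)// le_max lexx.
have c0 : contracts (toR y) 0 W0.
  apply: (contracts_step toR_rho1 toR_rhoM B2grp (s0 _) sU2 dist2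
    (CB2 _ Ca) (CB2 _ Cb) _ xE) cU.
  by rewrite (le_trans _ Mp)// le_max lexx orbT.
have [q [Y [YW0 Ymax]]] := integral_span W0.
(* The integral vectors carry all the mass. If those in [W0] spanned a smaller subspace, it would be
   null by minimality, and [W0] with it. *)
have W0Y : (W0 <= toR Y)%MS.
  rewrite -(mxrank_leqif_sup YW0) eqn_leq mxrankS//= leqNgt; apply/negP => rkY.
  have : mW <<toR Y>>%MS = 0 by apply: mlt; rewrite mxrank_gen.
  move=> mY; move: mW0; rewrite ltNge => /negP; apply.
  rewrite -[leRHS]addr0 -{1}mY -mint; apply: le_trans (le_meanU mP _ _).
  apply: (le_mean mP) => v /= vW0.
  have [[k vk]|] := pselect (integral v); last by right.
  by left => /=; rewrite genmxE vk; apply: Ymax; rewrite -vk.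
have [J yJ] := contracts_nilpotent YW0 c0.
have uyJ : u *m toR y ^+ J = 0.
  have /submxP[D ->] := submx_trans uU (submx_trans UW0 W0Y).
  by rewrite -mulmxA yJ mulmx0.
have uy := distortion_unipotent toR_rho1 toR_rhoM B2grp sU2 dist2 (CB2 _ Cx) p0
  xE uU uyJ.
by rewrite xE mulmxDr mulmx1 -scalemxAr uy scaler0 addr0.
Qed.

End IntegralGroup.

(** * Fourier coefficients and Parseval's identity *)

Section TrigonometricFamily.
Context (R : realType) (d : nat) (T : Type) (c s : 'rV[int]_d -> T -> R).

(* c and s behave like the real and imaginary parts of the characters of a
   torus. *)
Record trig_family : Prop := TrigFamily {
  trig_c0 : forall x, c 0 x = 1;
  trig_cD : forall k l x, c (k + l) x = c k x * c l x - s k x * s l x;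
  trig_sD : forall k l x, s (k + l) x = s k x * c l x + c k x * s l x;
  trig_cN : forall k x, c (- k) x = c k x;
  trig_sN : forall k x, s (- k) x = - s k x;
  trig_cs : forall k x, c k x ^+ 2 + s k x ^+ 2 = 1 }.

(* The closure of the trigonometric polynomials under bounded pointwise
   limits. *)
Inductive trig_class : (T -> R) -> Prop :=
| trig_class_c k : trig_class (c k)
| trig_class_s k : trig_class (s k)
| trig_class_lin a f g : trig_class f -> trig_class g ->
    trig_class (fun x => a * f x + g x)
| trig_class_lim (u : nat -> T -> R) f M : (forall n, trig_class (u n)) ->
    (forall n x, `|u n x| <= M) -> (forall x, u n x @[n --> \oo] --> f x) ->
    trig_class f.

Context (cs : trig_family).

Lemma trig_normc k x : `|c k x| <= 1.
Proof.
rewrite -(expr_le1 (ltn0Sn 1)) // real_normK ?num_real// -(trig_cs cs k x).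
by rewrite lerDl sqr_ge0.
Qed.

Lemma trig_norms k x : `|s k x| <= 1.
Proof.
rewrite -(expr_le1 (ltn0Sn 1)) // real_normK ?num_real// -(trig_cs cs k x).
by rewrite lerDr sqr_ge0.
Qed.

Lemma trig_cc k l x : c k x * c l x = 2^-1 * c (k + l) x + 2^-1 * c (k - l) x.
Proof.
rewrite !(trig_cD cs) (trig_cN cs) (trig_sN cs).
move: (c k x) (c l x) (s k x) (s l x) => p q r t; lra.
Qed.

Lemma trig_ss k l x : s k x * s l x = 2^-1 * c (k - l) x - 2^-1 * c (k + l) x.
Proof.
rewrite !(trig_cD cs) (trig_cN cs) (trig_sN cs).
move: (c k x) (c l x) (s k x) (s l x) => p q r t; lra.
Qed.

Lemma trig_sc k l x : s k x * c l x = 2^-1 * s (k + l) x + 2^-1 * s (k - l) x.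
Proof.
rewrite !(trig_sD cs) (trig_cN cs) (trig_sN cs).
move: (c k x) (c l x) (s k x) (s l x) => p q r t; lra.
Qed.

Lemma trig_s0 x : s 0 x = 0.
Proof. by have := trig_sN cs 0 x; rewrite oppr0; lra. Qed.

Lemma trig_class_ext f g : trig_class f -> (forall x, f x = g x) -> trig_class g.
Proof. by move=> + /funext <-. Qed.

Lemma trig_class_bounded f : trig_class f -> exists M, forall x, `|f x| <= M.
Proof.
elim=> {f} [k|k|a f g _ [M fM] _ [N gN]|u f M _ _ uM uf].
- by exists 1; exact: trig_normc.
- by exists 1; exact: trig_norms.
- exists (`|a| * M + N) => x; rewrite (le_trans (ler_normD _ _))// lerD//.
  by rewrite normrM ler_wpM2l.
- exists M => x; have /cvg_norm ufx := uf x.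
  by apply: (ler_cvg_to ufx (cvg_cst M)); exact: nearW.
Qed.

Lemma trig_class_0 : trig_class (fun=> 0).
Proof.
apply: trig_class_ext (trig_class_lin (-1) (trig_class_c 0) (trig_class_c 0)) _.
by move=> x; rewrite mulN1r addNr.
Qed.

Lemma trig_classZ a f : trig_class f -> trig_class (fun x => a * f x).
Proof.
move=> cf; apply: trig_class_ext (trig_class_lin a cf trig_class_0) _ => x.
by rewrite addr0.
Qed.

Lemma trig_classD f g : trig_class f -> trig_class g ->
  trig_class (fun x => f x + g x).
Proof.
move=> cf cg; apply: trig_class_ext (trig_class_lin 1 cf cg) _ => x.
by rewrite mul1r.
Qed.

Lemma trig_classB f g : trig_class f -> trig_class g ->
  trig_class (fun x => f x - g x).
Proof.
move=> cf cg; apply: trig_class_ext (trig_class_lin (-1) cg cf) _ => x.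
by rewrite mulN1r addrC.
Qed.

Lemma trig_class_cst a : trig_class (fun=> a).
Proof.
apply: trig_class_ext (trig_classZ a (trig_class_c 0)) _ => x.
by rewrite (trig_c0 cs) mulr1.
Qed.

(** A bounded limit passes through a product with a fixed bounded factor, so the induction treats
    one factor at a time: first [c k] or [s k] times a member, then a member times a member. *)
Lemma trig_classM f g : trig_class f -> trig_class g ->
  trig_class (fun x => f x * g x).
Proof.
have step (h : T -> R) : (forall k, trig_class (fun x => h x * c k x)) ->
    (forall k, trig_class (fun x => h x * s k x)) ->
    (exists M, forall x, `|h x| <= M) ->
    forall g, trig_class g -> trig_class (fun x => h x * g x).
  move=> hc hs [M hM] {}g; elim=> {g} [k|k|a g1 g2 _ h1 _ h2|u g N cu hu uN ug].
  - exact: hc.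
  - exact: hs.
  - apply: trig_class_ext (trig_class_lin a h1 h2) _ => x.
    by rewrite mulrDr mulrCA.
  - apply: (@trig_class_lim (fun n x => h x * u n x) _ (M * N)) => //.
    + move=> n x; rewrite normrM ler_pM//.
    + by move=> x; apply: cvgM; [exact: cvg_cst|exact: ug].
have hc k : forall g, trig_class g -> trig_class (fun x => c k x * g x).
  apply: step => [l|l|].
  - apply: trig_class_ext (trig_class_lin 2^-1 (trig_class_c (k + l))
      (trig_classZ 2^-1 (trig_class_c (k - l)))) _ => x.
    by rewrite trig_cc.
  - apply: trig_class_ext (trig_class_lin 2^-1 (trig_class_s (l + k))
      (trig_classZ 2^-1 (trig_class_s (l - k)))) _ => x.
    by rewrite [RHS]mulrC trig_sc.
  - by exists 1; exact: trig_normc.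
have hs k : forall g, trig_class g -> trig_class (fun x => s k x * g x).
  apply: step => [l|l|].
  - apply: trig_class_ext (trig_class_lin 2^-1 (trig_class_s (k + l))
      (trig_classZ 2^-1 (trig_class_s (k - l)))) _ => x.
    by rewrite trig_sc.
  - apply: trig_class_ext (trig_classB (trig_classZ 2^-1 (trig_class_c (k - l)))
      (trig_classZ 2^-1 (trig_class_c (k + l)))) _ => x.
    by rewrite trig_ss.
  - by exists 1; exact: trig_norms.
move=> cf cg; apply: step g cg.
- by move=> k; apply: trig_class_ext (hc k f cf) _ => x; rewrite mulrC.
- by move=> k; apply: trig_class_ext (hs k f cf) _ => x; rewrite mulrC.
- exact: trig_class_bounded.
Qed.

Lemma trig_classX f n : trig_class f -> trig_class (fun x => f x ^+ n).
Proof.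
move=> cf; elim: n => [|n IH].
  by apply: trig_class_ext (trig_class_cst 1) _ => x; rewrite expr0.
by apply: trig_class_ext (trig_classM cf IH) _ => x; rewrite exprS.
Qed.

Lemma trig_class_sum (I : Type) (r : seq I) (F : I -> T -> R) :
  (forall i, trig_class (F i)) -> trig_class (fun x => \sum_(i <- r) F i x).
Proof.
move=> cF; elim: r => [|i r IH].
  by apply: trig_class_ext trig_class_0 _ => x; rewrite big_nil.
by apply: trig_class_ext (trig_classD (cF i) IH) _ => x; rewrite big_cons.
Qed.

(* |f| is the limit of p_0 = 0, p_(n+1) = p_n + (f^2 - p_n^2) / 2. *)
Lemma trig_class_norm1 f : trig_class f -> (forall x, `|f x| <= 1) ->
  trig_class (fun x => `|f x|).
Proof.
move=> cf f1.
pose p := fix p n : T -> R :=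
  if n is n'.+1 then fun x => p n' x + 2^-1 * (f x ^+ 2 - p n' x ^+ 2)
  else fun=> 0.
have cp n : trig_class (p n).
  elim: n => [|n IH] /=; first exact: trig_class_0.
  apply: trig_classD => //; apply: trig_classZ; apply: trig_classB.
    exact: trig_classX.
  exact: trig_classX.
have pP n x : 0 <= p n x <= `|f x| /\
    `|f x| - p n x <= `|f x| * (1 - `|f x| / 2) ^+ n.
  elim: n => [|n [/andP[p0 pf] IH]] /=.
    by rewrite lexx normr_ge0 expr0 mulr1 subr0.
  rewrite -(real_normK (num_real (f x))); have := f1 x.
  move: (normr_ge0 (f x)) p0 pf IH; move: `|f x| (p n x) => t q t0 q0 qt IH t1.
  have e0 : 0 <= (t - q) * (t + q) by rewrite mulr_ge0// ?subr_ge0// addr_ge0.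
  have e1 : 0 <= (t - q) * (2 - (t + q)).
    by rewrite mulr_ge0 ?subr_ge0// (_ : 2 = 1 + 1)// lerD// (le_trans qt).
  split; first by apply/andP; split; lra.
  have e2 : 0 <= 1 - t / 2 by lra.
  have e3 := ler_wpM2r e2 IH; rewrite [_ ^+ n.+1]exprSr [leRHS]mulrA.
  apply: le_trans e3; have e4 : 0 <= (t - q) * q by rewrite mulr_ge0// subr_ge0.
  lra.
apply: (@trig_class_lim p _ 1) => //.
  move=> n x; have [/andP[p0 pf] _] := pP n x.
  by rewrite ger0_norm// (le_trans pf).
move=> x; apply/cvgrPdist_le => e e0.
have zx : `|1 - `|f x| / 2| < 1 \/ f x = 0.
  have [->|fx0] := eqVneq (f x) 0; [by right|left].
  have := f1 x; have : 0 < `|f x| by rewrite normr_gt0.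
  move: `|f x| => t t0 t1; rewrite ltr_norml; apply/andP; split; lra.
case: zx => [zx|fx0]; last first.
  apply: nearW => n; have [/andP[p0 pf] _] := pP n x.
  move: pf; rewrite fx0 normr0 => pf.
  by rewrite (_ : p n x = 0) ?subrr ?normr0 ?(ltW e0)//; apply: le_anti; rewrite pf.
have /cvgrPdist_le /(_ _ e0) := cvg_geometric `|f x| zx.
apply: filterS => n; rewrite sub0r normrN /= => h.
have [/andP[p0 pf] pe] := pP n x.
by rewrite ger0_norm ?subr_ge0// (le_trans pe)// (le_trans _ h)// ler_norm.
Qed.

(** [g] takes values in [0, 1] and is positive exactly where [f] is, so [1 - (1 - g x) ^+ n] tends
    to the indicator. *)
Lemma trig_class_pos f : trig_class f -> trig_class \1_[set x | 0 < f x].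
Proof.
move=> cf; have [M fM] := trig_class_bounded cf.
pose f1 x := (`|M| + 1)^-1 * f x.
have M0 : 0 < `|M| + 1 by rewrite ltr_wpDl.
have cf1 : trig_class f1 by exact: trig_classZ.
have f1b x : `|f1 x| <= 1.
  rewrite normrM gtr0_norm ?invr_gt0// mulrC ler_pdivrMr// mul1r.
  by rewrite (le_trans (fM x))// (le_trans (ler_norm M))// lerDl.
pose g x := 2^-1 * (f1 x + `|f1 x|).
have cg : trig_class g.
  by apply/trig_classZ/trig_classD => //; exact: trig_class_norm1.
have gpos x : 0 < f x -> 0 < g x <= 1.
  move=> fx; have f10 : 0 < f1 x by rewrite mulr_gt0 ?invr_gt0.
  have := f1b x; rewrite /g gtr0_norm// => ?; apply/andP; split; lra.
have gneg x : ~ 0 < f x -> g x = 0.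
  move=> /negP; rewrite -leNgt => fx.
  have f10 : f1 x <= 0 by rewrite mulr_ge0_le0 ?invr_ge0// ltW.
  by rewrite /g ler0_norm// subrr mulr0.
apply: (@trig_class_lim (fun n x => 1 - (1 - g x) ^+ n) _ 1).
- move=> n; apply: trig_classB; first exact: trig_class_cst.
  by apply/trig_classX/trig_classB => //; exact: trig_class_cst.
- move=> n x; have [/gpos/andP[g0 g1]|/gneg ->] := pselect (0 < f x); last first.
    by rewrite subr0 expr1n subrr normr0.
  have h1 : 0 <= 1 - g x by rewrite subr_ge0.
  have h2 : (1 - g x) ^+ n <= 1 by rewrite exprn_ile1// gerBl ltW.
  rewrite ger0_norm ?subr_ge0// gerBl exprn_ge0//.
- move=> x; rewrite indicE; have [fx|fx] := pselect (0 < f x).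
    rewrite mem_set// -[X in _ --> X](subr0 1).
    apply: cvgB; first exact: cvg_cst.
    apply: cvg_expr; have /andP[g0 g1] := gpos x fx.
    by rewrite ger0_norm ?subr_ge0// gtrBl.
  rewrite memNset//; under eq_fun do rewrite (gneg x fx) subr0 expr1n subrr.
  exact: cvg_cst.
Qed.

Lemma trig_class_sigma : sigma_algebra setT [set A | trig_class \1_A].
Proof.
split.
- by apply: trig_class_ext trig_class_0 _ => x; rewrite indic0.
- move=> A cA; apply: trig_class_ext (trig_classB (trig_class_cst 1) cA) _ => x.
  rewrite !indicE setTD in_setC; case: (x \in A) => /=; lra.
- move=> A cA.
  (* The indicator of a finite union, as a polynomial in the indicators of its members. *)
  pose u n x := 1 - \prod_(i < n) (1 - \1_(A i) x) : R.
  have prodE n x : \prod_(i < n) (1 - \1_(A i) x) =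
      (~~ `[< exists2 i, (i < n)%N & A i x >])%:R :> R.
    elim: n => [|n IH].
      rewrite big_ord0; case: asboolP => // -[//].
    rewrite big_ord_recr IH /= indicE; have [Anx|Anx] := pselect (A n x).
      rewrite mem_set// subrr mulr0; case: asboolP => // h; exfalso; apply: h.
      by exists n.
    rewrite memNset// subr0 mulr1; congr (~~ _)%:R; apply/asboolP/asboolP.
      by move=> [i ltin Ai]; exists i => //; rewrite ltnW.
    case=> i; rewrite ltnS leq_eqVlt => /predU1P[-> //|ltin] Ai.
    by exists i.
  apply: (@trig_class_lim u _ 1).
  + move=> n; apply: trig_classB; first exact: trig_class_cst.
    elim: n => [|n IH].
      by apply: trig_class_ext (trig_class_cst 1) _ => x; rewrite big_ord0.
    apply: trig_class_ext (trig_classM IH (trig_classB (trig_class_cst 1) (cA n))) _.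
    by move=> x; rewrite big_ord_recr.
  + move=> n x; rewrite /u prodE; case: asboolP => _ /=.
      by rewrite subr0 normr1.
    by rewrite subrr normr0.
  + move=> x; rewrite indicE.
    have [[n _ Anx]|Ax] := pselect ((\bigcup_k A k) x).
      rewrite mem_set; last by exists n.
      apply: cvg_near_cst; exists n.+1 => // k /= nk; rewrite /u prodE.
      case: asboolP => [_|h]; first by rewrite subr0.
      by exfalso; apply: h; exists n.
    rewrite memNset//; apply: cvg_near_cst; apply: nearW => k; rewrite /u prodE.
    case: asboolP => [[i _ Ai]|_]; last by rewrite subrr.
    by exfalso; apply: Ax; exists i.
Qed.

End TrigonometricFamily.

(** * Real square integrable functions and measure-preserving maps *)

Section SquareIntegrable.
Import HBNNSimple.
Context dsp (T : measurableType dsp) (R : realType) (mu : probability T R).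
Implicit Types f g h : T -> R.

Local Notation itg f := (mu.-integrable setT (EFin \o f)).
Local Notation Ex f := (\int[mu]_x f x).

Definition square_integrable f : Prop :=
  measurable_fun setT f /\ itg (fun x => f x ^+ 2).

Definition inner f g : R := Ex (fun x => f x * g x).

Lemma integrable_bounded f M : measurable_fun setT f ->
  (forall x, `|f x| <= M) -> itg f.
Proof.
move=> mf fM; apply: (le_integrable measurableT (g := EFin \o cst M)).
- exact/measurable_EFinP.
- by move=> x _; rewrite /= lee_fin (le_trans (fM x))// ler_norm.
- exact: finite_measure_integrable_cst.
Qed.

Lemma integrable_dom f g : measurable_fun setT f ->
  (forall x, `|f x| <= g x) -> itg g -> itg f.
Proof.
move=> mf fg; apply: le_integrable; [exact: measurableT|exact/measurable_EFinP|].
by move=> x _; rewrite /= lee_fin (le_trans (fg x))// ler_norm.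
Qed.

Lemma Rintegral_cvg (u : nat -> T -> R) f g :
  (forall n, measurable_fun setT (u n)) -> (forall n x, `|u n x| <= g x) ->
  itg g -> (forall x, u n x @[n --> \oo] --> f x) ->
  Ex (u n) @[n --> \oo] --> Ex f.
Proof.
move=> mu_ ug ig uf.
have mf : measurable_fun setT f.
  by apply: (measurable_fun_cvg mu_) => x _; exact: uf.
have [|||||intf _ h] := @dominated_convergence _ T R mu setT measurableT
    (fun n => EFin \o u n) (EFin \o f) (EFin \o g).
- by move=> n; apply/measurable_EFinP.
- exact/measurable_EFinP.
- by apply: aeW => x _; apply: cvg_EFin; [exact: nearW|exact: uf].
- by [].
- by apply: aeW => x n _; rewrite /= lee_fin.
- have fin : (\int[mu]_x (f x)%:E)%E \is a fin_num by exact: integrable_fin_num.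
  by move: h; rewrite -(fineK fin) => /fine_cvgP[_].
Qed.

Lemma square_integrable_bounded f M : measurable_fun setT f ->
  (forall x, `|f x| <= M) -> square_integrable f.
Proof.
move=> mf fM; split=> //; apply: (@integrable_bounded _ (M ^+ 2)).
  exact: measurable_funX.
by move=> x; rewrite normrX lerXn2r// nnegrE// (le_trans _ (fM x)).
Qed.

Lemma integrableM f g : square_integrable f -> square_integrable g ->
  itg (fun x => f x * g x).
Proof.
move=> [mf f2] [mg g2].
apply: (@integrable_dom _ (fun x => f x ^+ 2 + g x ^+ 2)).
- exact: measurable_funM.
- move=> x; rewrite normrM -(real_normK (num_real (f x))).
  rewrite -(real_normK (num_real (g x))).
  have := normr_ge0 (f x); have := normr_ge0 (g x).
  move: `|f x| `|g x| => s t s0 t0; have := sqr_ge0 (t - s).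
  have := mulr_ge0 t0 s0; nra.
- exact: (integrableD measurableT f2 g2).
Qed.

Lemma square_integrableD f g : square_integrable f -> square_integrable g ->
  square_integrable (fun x => f x + g x).
Proof.
move=> [mf f2] [mg g2]; split; first exact: measurable_funD.
apply: (@integrable_dom _ (fun x => 2 * (f x ^+ 2 + g x ^+ 2))).
- exact/measurable_funX/measurable_funD.
- move=> x; rewrite ger0_norm ?sqr_ge0//; have := sqr_ge0 (f x - g x).
  by move: (f x) (g x) => s t; nra.
- exact: (integrableZl measurableT _ (integrableD measurableT f2 g2)).
Qed.

Lemma square_integrableZ a f : square_integrable f ->
  square_integrable (fun x => a * f x).
Proof.
move=> [mf f2]; split.
  by apply: measurable_funM => //; exact: measurable_cst.
have := integrableZl measurableT (a ^+ 2) f2; apply: eq_integrable => // x _ /=.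
by rewrite -EFinM -exprMn.
Qed.

Lemma square_integrableB f g : square_integrable f -> square_integrable g ->
  square_integrable (fun x => f x - g x).
Proof.
move=> L2f /(square_integrableZ (-1)) /(square_integrableD L2f).
by under [in X in X -> _]eq_fun do rewrite mulN1r.
Qed.

Lemma square_integrable_sum (I : Type) (r : seq I) (F : I -> T -> R) :
  (forall i, square_integrable (F i)) ->
  square_integrable (fun x => \sum_(i <- r) F i x).
Proof.
move=> LF; elim: r => [|i r IH].
  under eq_fun do rewrite big_nil.
  by apply: (@square_integrable_bounded _ 0) => [|x]; rewrite ?normr0.
by under eq_fun do rewrite big_cons; exact: square_integrableD.
Qed.

Lemma Rintegral_lin a f g : itg f -> itg g ->
  Ex (fun x => a * f x + g x) = a * Ex f + Ex g.
Proof.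
move=> fi gi; have afi : itg (fun x => a * f x).
  exact: (integrableZl measurableT a fi).
exact: (etrans (RintegralD measurableT afi gi)
  (congr1 (+%R^~ (Ex g)) (RintegralZl a measurableT fi))).
Qed.

Lemma innerC f g : inner f g = inner g f.
Proof. by apply: eq_Rintegral => x _; rewrite mulrC. Qed.

Lemma inner_ge0 f : 0 <= inner f f.
Proof. by apply: Rintegral_ge0 => x _; rewrite -expr2 sqr_ge0. Qed.

Lemma innerDl f g h : square_integrable f -> square_integrable g ->
  square_integrable h -> inner (fun x => f x + g x) h = inner f h + inner g h.
Proof.
move=> Lf Lg Lh; rewrite /inner -RintegralD//; try exact: integrableM.
by apply: eq_Rintegral => x _; rewrite mulrDl.
Qed.

Lemma innerZl a f h : square_integrable f -> square_integrable h ->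
  inner (fun x => a * f x) h = a * inner f h.
Proof.
move=> Lf Lh; rewrite /inner -RintegralZl//; last exact: integrableM.
by apply: eq_Rintegral => x _; rewrite mulrA.
Qed.

Lemma innerBl f g h : square_integrable f -> square_integrable g ->
  square_integrable h -> inner (fun x => f x - g x) h = inner f h - inner g h.
Proof.
move=> Lf Lg Lh; rewrite -[in RHS]mulN1r -innerZl// -innerDl//.
  by congr inner; apply/funext => x; rewrite mulN1r.
exact: square_integrableZ.
Qed.

Lemma inner_suml (I : Type) (r : seq I) (F : I -> T -> R) h :
  (forall i, square_integrable (F i)) -> square_integrable h ->
  inner (fun x => \sum_(i <- r) F i x) h = \sum_(i <- r) inner (F i) h.
Proof.
move=> LF Lh; elim: r => [|i r IH].
  rewrite big_nil.
  have -> : (fun x => \sum_(i <- [::]) F i x) = (fun x => 0 * h x).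
    by apply/funext => x; rewrite big_nil mul0r.
  by rewrite innerZl// mul0r.
rewrite big_cons -IH -innerDl//; last exact: square_integrable_sum.
by congr (inner _ h); apply/funext => x; rewrite big_cons.
Qed.

Lemma innerDD f g : square_integrable f -> square_integrable g ->
  inner (fun x => f x + g x) (fun x => f x + g x) <=
  2 * inner f f + 2 * inner g g.
Proof.
move=> Lf Lg; have LD := square_integrableD Lf Lg.
have LB := square_integrableB Lf Lg.
have eD h : square_integrable h ->
    inner h (fun x => f x + g x) = inner h f + inner h g.
  by move=> Lh; rewrite innerC innerDl// (innerC f) (innerC g).
have eB h : square_integrable h ->
    inner h (fun x => f x - g x) = inner h f - inner h g.
  by move=> Lh; rewrite innerC innerBl// (innerC f) (innerC g).
have := inner_ge0 (fun x => f x - g x).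
rewrite innerBl// innerDl// !eD// !eB// (innerC g f).
move: (inner f f) (inner g g) (inner f g) => p q r; lra.
Qed.

(** [P] will be the Parseval property, already known for simple functions. The approximations stay
    between 0 and [f], so [f ^+ 2] dominates the squared errors. *)
Lemma square_integrable_nneg_approx f (P : (T -> R) -> Prop) :
  square_integrable f -> (forall x, 0 <= f x) ->
  (forall g, (exists (r : seq R) (A : R -> set T), (forall y, measurable (A y)) /\
      g = fun x => \sum_(y <- r) y * \1_(A y) x) -> P g) ->
  forall e : R, 0 < e -> exists g, [/\ P g, square_integrable g &
    inner (fun x => f x - g x) (fun x => f x - g x) <= e].
Proof.
move=> Lf f0 Psimple e e0; have [mf f2] := Lf.
have mEf : measurable_fun setT (EFin \o f) by exact/measurable_EFinP.
pose u n : T -> R := nnsfun_approx measurableT mEf n.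
have mu_ n : measurable_fun setT (u n) by [].
have u0 n x : 0 <= u n x by [].
have uf x : u n x @[n --> \oo] --> f x.
  have := cvg_nnsfun_approx measurableT mEf (fun x _ => f0 x) (x := x) I.
  by move=> /fine_cvgP[_].
have ule n x : u n x <= f x.
  by rewrite /u nnsfun_approxE -lee_fin; apply: le_approx => // y _; rewrite lee_fin.
have Lu n : square_integrable (u n).
  split=> //; apply: (integrable_dom _ _ f2); first exact: measurable_funX.
  by move=> x; rewrite ger0_norm ?sqr_ge0// lerXn2r// nnegrE.
have : inner (fun x => f x - u n x) (fun x => f x - u n x) @[n --> \oo] --> (0 : R).
  have E0 : Ex (fun=> 0 : R) = 0.
    by rewrite Rintegral_cst// mul0r.
  rewrite -[X in _ --> X]E0.
  apply: (@Rintegral_cvg (fun n x => (f x - u n x) * (f x - u n x)) _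
    (fun x => f x ^+ 2)) => //.
  - by move=> n; apply: measurable_funM; exact: measurable_funB.
  - move=> n x; rewrite -expr2 ger0_norm ?sqr_ge0// lerXn2r ?nnegrE// ?subr_ge0//.
    by rewrite gerBl.
  - move=> x; rewrite -[X in _ --> X](mulr0 0) -(subrr (f x)).
    by apply: cvgM; apply: cvgB => //; exact: cvg_cst.
move=> /cvgrPdist_le /(_ _ e0) [N _ /(_ N (leqnn N))].
rewrite sub0r normrN => h; exists (u N); split=> //.
  apply: Psimple; exists (finmap.enum_fset (fset_set (range (u N)))), (fun y => u N @^-1` [set y]).
  split; first by move=> y; rewrite -[_ @^-1` _]setTI; exact: mu_.
  apply/funext => x; rewrite {1}/u fimfunE fsbig_finite//.
by rewrite (le_trans _ h)// ler_norm.
Qed.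

Context (phi : T -> T) (mphi : measurable_fun setT phi).
Context (phiP : forall A, measurable A -> mu (phi @^-1` A) = mu A).

Lemma preserving_integral (f : T -> \bar R) :
  (\int[pushforward mu phi]_x f x = \int[mu]_x f x)%E.
Proof. by apply: eq_measure_integral => A mA _; exact: phiP. Qed.

Lemma preserving_integrable f : itg f -> itg (fun x => f (phi x)).
Proof.
move=> /integrableP[/measurable_EFinP mf fi]; apply/integrableP.
have mff : measurable_fun setT (fun x => f (phi x)) by exact: measurableT_comp mf mphi.
split; first exact/measurable_EFinP.
move: fi; rewrite -preserving_integral ge0_integral_pushforward//.
by apply: measurableT_comp => //; exact/measurable_EFinP.
Qed.

Lemma preserving_Rintegral f : itg f -> Ex (fun x => f (phi x)) = Ex f.
Proof.
move=> fi; have mf : measurable_fun setT (EFin \o f) by case/integrableP: (fi).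
rewrite /Rintegral -[in RHS]preserving_integral.
by rewrite (integral_pushforward mphi mf (preserving_integrable fi) measurableT).
Qed.

Lemma preserving_square_integrable f : square_integrable f ->
  square_integrable (fun x => f (phi x)).
Proof.
move=> [mf f2]; split; first exact: measurableT_comp mf mphi.
exact: (preserving_integrable (f := fun x => f x ^+ 2)).
Qed.

End SquareIntegrable.

Lemma add_halves (R : realType) (x : R) : 2^-1 * x + 2^-1 * x = x.
Proof. lra. Qed.

Section Parseval.
Context dsp (T : measurableType dsp) (R : realType) (d : nat).
Context (c s : 'rV[int]_d -> T -> R) (cs : trig_family c s).
Context (mc : forall k, measurable_fun setT (c k)).
Context (ms : forall k, measurable_fun setT (s k)).

Lemma measurable_trig_class f : trig_class c s f -> measurable_fun setT f.
Proof.
elim=> {f} [k|k|a f g _ mf _ mg|u f M _ mu_ uM uf] //.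
- by apply: measurable_funD => //; apply: measurable_funM => //; exact: measurable_cst.
- by apply: (measurable_fun_cvg mu_) => x _; exact: uf.
Qed.

Context (borel : forall A, measurable A -> trig_class c s \1_A).

(** Measurability of a composition with [phi] propagates along the constructors of [trig_class],
    which contains all indicators by [borel]; so a map need only be tested on [c k] and [s k]. The
    same induction serves for preservation of the measure. *)
Lemma measurable_of_trig (phi : T -> T) :
  (forall k, measurable_fun setT (c k \o phi)) ->
  (forall k, measurable_fun setT (s k \o phi)) -> measurable_fun setT phi.
Proof.
move=> hc hs; have H f : trig_class c s f -> measurable_fun setT (f \o phi).
  elim=> {f} [k|k|a f g _ mf _ mg|u f M _ mu_ uM uf] //.
    apply: (@measurable_funD _ _ _ _ (fun x => a * f (phi x)) (g \o phi)) => //.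
    by apply: measurable_funM => //; exact: measurable_cst.
  by apply: (measurable_fun_cvg mu_) => x _; exact: uf.
move=> _ A mA; rewrite setTI; apply/measurable_indicP.
rewrite (_ : \1_(phi @^-1` A) = \1_A \o phi); first exact/H/borel.
by apply/funext => x; rewrite /= !indicE.
Qed.

Lemma preserving_of_trig (mu : probability T R) (phi : T -> T) :
  measurable_fun setT phi ->
  (forall k, \int[mu]_x c k (phi x) = \int[mu]_x c k x) ->
  (forall k, \int[mu]_x s k (phi x) = \int[mu]_x s k x) ->
  forall A, measurable A -> mu (phi @^-1` A) = mu A.
Proof.
move=> mphi hc hs.
have bint f (psi : T -> T) : measurable_fun setT psi -> trig_class c s f ->
    mu.-integrable setT (EFin \o (fun x => f (psi x))).
  move=> mpsi cf; have [M fM] := trig_class_bounded cs cf.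
  apply: (integrable_bounded mu (f := fun x => f (psi x)) _ (fun x => fM (psi x))).
  exact: (measurableT_comp (measurable_trig_class cf) mpsi).
have bint1 f : trig_class c s f -> mu.-integrable setT (EFin \o f).
  exact: (bint f id (@measurable_id _ _ _)).
have E f : trig_class c s f -> \int[mu]_x f (phi x) = \int[mu]_x f x.
  elim=> {f} [k|k|a f g cf hf cg hg|u f M cu hu uM uf] //.
    rewrite (Rintegral_lin a (bint f phi mphi cf) (bint g phi mphi cg)) hf hg.
    by rewrite (Rintegral_lin a (bint1 f cf) (bint1 g cg)).
  have mu_ n := measurable_trig_class (cu n).
  have iM : mu.-integrable setT (EFin \o cst M).
    exact: finite_measure_integrable_cst.
  have l1 : \int[mu]_x u n x @[n --> \oo] --> \int[mu]_x f x.
    exact: (Rintegral_cvg mu_ uM iM uf).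
  have l2 : \int[mu]_x u n (phi x) @[n --> \oo] --> \int[mu]_x f (phi x).
    apply: (Rintegral_cvg (u := fun n x => u n (phi x)) _ _ iM) => //.
    by move=> n; exact: (measurableT_comp (mu_ n) mphi).
  have l3 : \int[mu]_x u n x @[n --> \oo] --> \int[mu]_x f (phi x).
    by under eq_fun do rewrite -hu.
  exact: (cvg_unique (@Rhausdorff R) l3 l1).
move=> A mA; have mpA : measurable (phi @^-1` A) by rewrite -[X in _ X]setTI; exact: mphi.
have := E _ (borel mA).
rewrite (_ : (fun x => _) = \1_(phi @^-1` A)); last first.
  by apply/funext => x; rewrite /= !indicE.
rewrite /Rintegral !integral_indic// !setIT => h.
by rewrite -(fineK (fin_num_measure mu A mA)) -h fineK// fin_num_measure.
Qed.

Context (mu : probability T R).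
Context (Ec : forall k, k != 0 -> \int[mu]_x c k x = 0).
Context (Es : forall k, k != 0 -> \int[mu]_x s k x = 0).

Local Notation L2 := (square_integrable mu).
Local Notation ip := (inner mu).

Lemma L2_trig_class f : trig_class c s f -> L2 f.
Proof.
move=> cf; have [M fM] := trig_class_bounded cs cf.
exact: (square_integrable_bounded mu (measurable_trig_class cf) fM).
Qed.

Lemma L2c k : L2 (c k). Proof. exact: L2_trig_class (trig_class_c _ _ _). Qed.
Lemma L2s k : L2 (s k). Proof. exact: L2_trig_class (trig_class_s _ _ _). Qed.

Lemma integrable_c k : mu.-integrable setT (EFin \o c k).
Proof. exact: (integrable_bounded mu (mc k) (trig_normc cs k)). Qed.

Lemma integrable_s k : mu.-integrable setT (EFin \o s k).
Proof. exact: (integrable_bounded mu (ms k) (trig_norms cs k)). Qed.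

Lemma Rintegral_c k : \int[mu]_x c k x = (k == 0)%:R.
Proof.
have [->|k0] := eqVneq; last exact: Ec.
rewrite (_ : c 0 = cst 1); last by apply/funext => x; exact: (trig_c0 cs).
rewrite Rintegral_cst// mul1r; exact: (congr1 fine (probability_setT mu)).
Qed.

Lemma Rintegral_s k : \int[mu]_x s k x = 0.
Proof.
have [->|k0] := eqVneq k 0; last exact: Es.
rewrite (_ : s 0 = cst 0); last by apply/funext => x; exact: (trig_s0 cs).
by rewrite Rintegral_cst// mul0r.
Qed.

Lemma Rintegral_comb (a b : R) f g : mu.-integrable setT (EFin \o f) ->
  mu.-integrable setT (EFin \o g) ->
  \int[mu]_x (a * f x + b * g x) = a * \int[mu]_x f x + b * \int[mu]_x g x.
Proof.
move=> fi gi; have bgi : mu.-integrable setT (EFin \o (fun x => b * g x)).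
  exact: (integrableZl measurableT b gi).
rewrite Rintegral_lin//; congr (_ + _).
exact: (RintegralZl b measurableT gi).
Qed.

Lemma inner_cc k l : ip (c k) (c l) = 2^-1 * (k + l == 0)%:R + 2^-1 * (k - l == 0)%:R.
Proof.
rewrite /inner; under eq_Rintegral do rewrite (trig_cc cs).
by rewrite (Rintegral_comb _ _ (integrable_c _) (integrable_c _)) !Rintegral_c.
Qed.

Lemma inner_ss k l : ip (s k) (s l) = 2^-1 * (k - l == 0)%:R - 2^-1 * (k + l == 0)%:R.
Proof.
rewrite /inner; under eq_Rintegral do rewrite (trig_ss cs) -mulNr.
by rewrite (Rintegral_comb _ _ (integrable_c _) (integrable_c _)) !Rintegral_c mulNr.
Qed.

Lemma inner_sc k l : ip (s k) (c l) = 0.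
Proof.
rewrite /inner; under eq_Rintegral do rewrite (trig_sc cs).
by rewrite (Rintegral_comb _ _ (integrable_s _) (integrable_s _)) !Rintegral_s !mulr0 addr0.
Qed.

(* The squared modulus of the k-th Fourier coefficient of a real f. *)
Definition energy (f : T -> R) (k : 'rV[int]_d) : R :=
  ip f (c k) ^+ 2 + ip f (s k) ^+ 2.

Lemma energy_ge0 f k : 0 <= energy f k.
Proof. by rewrite addr_ge0 ?sqr_ge0. Qed.

(** As [c (- k) = c k] and [s (- k) = - s k], every function other than those at 0 occurs twice in
    the family, with squared norm 1/2. Over a list closed under negation the two halves add up, and
    partial sums become orthogonal projections. *)
Definition symmetric_seq (K : seq 'rV[int]_d) : Prop :=
  uniq K /\ forall k, k \in K -> - k \in K.

Definition symmetrize (K : seq 'rV[int]_d) := undup (K ++ map -%R K).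

Lemma symmetrizeP K : symmetric_seq (symmetrize K).
Proof.
split=> [|k]; first exact: undup_uniq.
rewrite !mem_undup !mem_cat => /orP[kK|/mapP[l lK ->]].
  by rewrite map_f ?orbT.
by rewrite opprK lK.
Qed.

Lemma sub_symmetrize K : {subset K <= symmetrize K}.
Proof. by move=> k kK; rewrite mem_undup mem_cat kK. Qed.

Definition partial_sum K (f : T -> R) (x : T) : R :=
  \sum_(k <- K) (ip f (c k) * c k x + ip f (s k) * s k x).

Definition remainder K (f : T -> R) (x : T) : R := f x - partial_sum K f x.

Lemma L2_partial_sum K f : L2 (partial_sum K f).
Proof.
apply: square_integrable_sum => k; apply: square_integrableD.
  exact/square_integrableZ/L2c.
exact/square_integrableZ/L2s.
Qed.

Lemma L2_remainder K f : L2 f -> L2 (remainder K f).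
Proof. by move=> Lf; apply: square_integrableB => //; exact: L2_partial_sum. Qed.

Lemma sum_seq_delta (K : seq 'rV[int]_d) (F : 'rV[int]_d -> R) l : uniq K ->
  l \in K -> \sum_(k <- K) F k * (k == l)%:R = F l.
Proof.
move=> uK lK; rewrite (bigD1_seq l)//= eqxx mulr1 big1 ?addr0// => k /negbTE ->.
by rewrite mulr0.
Qed.

Lemma inner_cN f k : ip f (c (- k)) = ip f (c k).
Proof. by congr (inner _ f); apply/funext => x; exact: (trig_cN cs). Qed.

Lemma inner_sN f k : L2 f -> ip f (s (- k)) = - ip f (s k).
Proof.
move=> Lf; rewrite -mulN1r (innerC _ f (s k)) -innerZl//; last exact: L2s.
by rewrite innerC; congr (inner _ _ f); apply/funext => x; rewrite (trig_sN cs) mulN1r.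
Qed.

Lemma partial_sum_cl K f l : symmetric_seq K -> L2 f -> l \in K ->
  ip (partial_sum K f) (c l) = ip f (c l).
Proof.
move=> [uK sK] Lf lK; rewrite /partial_sum inner_suml; last 2 first.
- move=> k; apply: square_integrableD.
    exact/square_integrableZ/L2c.
  exact/square_integrableZ/L2s.
- exact: L2c.
rewrite (eq_bigr (fun k => 2^-1 * (ip f (c k) * (k == - l)%:R) +
    2^-1 * (ip f (c k) * (k == l)%:R))); last first.
  move=> k _; rewrite innerDl; [|exact/square_integrableZ/L2c|
    exact/square_integrableZ/L2s|exact: L2c].
  rewrite !innerZl; [|exact: L2s|exact: L2c|exact: L2c|exact: L2c].
  rewrite inner_sc mulr0 addr0 inner_cc addr_eq0 subr_eq0.
  by rewrite mulrDr !(mulrCA _ 2^-1).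
rewrite big_split -!mulr_sumr /= !sum_seq_delta//; last exact: sK.
by rewrite inner_cN add_halves.
Qed.

Lemma partial_sum_sl K f l : symmetric_seq K -> L2 f -> l \in K ->
  ip (partial_sum K f) (s l) = ip f (s l).
Proof.
move=> [uK sK] Lf lK; rewrite /partial_sum inner_suml; last 2 first.
- move=> k; apply: square_integrableD.
    exact/square_integrableZ/L2c.
  exact/square_integrableZ/L2s.
- exact: L2s.
rewrite (eq_bigr (fun k => 2^-1 * (ip f (s k) * (k == l)%:R) -
    2^-1 * (ip f (s k) * (k == - l)%:R))); last first.
  move=> k _; rewrite innerDl; [|exact/square_integrableZ/L2c|
    exact/square_integrableZ/L2s|exact: L2s].
  rewrite !innerZl; [|exact: L2s|exact: L2s|exact: L2c|exact: L2s].
  rewrite (innerC _ (c k)) inner_sc mulr0 add0r inner_ss subr_eq0 addr_eq0.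
  by rewrite mulrBr !(mulrCA _ 2^-1).
rewrite sumrB -!mulr_sumr !sum_seq_delta//; last exact: sK.
by rewrite inner_sN// mulrN opprK add_halves.
Qed.

Lemma inner_partial_sum K f g : L2 g ->
  ip (partial_sum K f) g =
  \sum_(k <- K) (ip f (c k) * ip g (c k) + ip f (s k) * ip g (s k)).
Proof.
move=> Lg; rewrite /partial_sum inner_suml//; last first.
  move=> k; apply: square_integrableD.
    exact/square_integrableZ/L2c.
  exact/square_integrableZ/L2s.
apply: eq_bigr => k _; rewrite innerDl; [|exact/square_integrableZ/L2c|
    exact/square_integrableZ/L2s|by []].
rewrite !innerZl//; [|exact: L2s|exact: L2c].
by rewrite (innerC _ (c k)) (innerC _ (s k)).
Qed.

Lemma inner_remainder K f : symmetric_seq K -> L2 f ->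
  ip (remainder K f) (remainder K f) = ip f f - \sum_(k <- K) energy f k.
Proof.
move=> sK Lf; have LP := L2_partial_sum K f; have Lr := L2_remainder K Lf.
have Pr : ip (partial_sum K f) (remainder K f) = 0.
  rewrite inner_partial_sum// big_seq big1// => k kK.
  rewrite !innerBl//; [|exact: L2s|exact: L2c].
  by rewrite partial_sum_cl// partial_sum_sl// !subrr !mulr0 addr0.
have fr : ip f (remainder K f) = ip f f - \sum_(k <- K) energy f k.
  rewrite innerC innerBl// inner_partial_sum//.
by rewrite {1}/remainder innerBl// Pr subr0.
Qed.

Lemma bessel K f : uniq K -> L2 f -> \sum_(k <- K) energy f k <= ip f f.
Proof.
move=> uK Lf; have := inner_ge0 mu (remainder (symmetrize K) f).
rewrite inner_remainder ?subr_ge0//; last exact: symmetrizeP.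
apply: le_trans; have [uS _] := symmetrizeP K.
rewrite [leRHS](bigID (mem K)) /= -[X in _ <= X + _]big_filter.
rewrite [X in _ <= X + _](perm_big K) ?lerDl; last first.
  apply: uniq_perm; rewrite ?filter_uniq// => k.
  by rewrite mem_filter; case kK: (k \in K) => //=; apply: sub_symmetrize.
by apply: sumr_ge0 => k _; exact: energy_ge0.
Qed.

Lemma remainder_mono K K' f : L2 f -> symmetric_seq K -> symmetric_seq K' ->
  {subset K <= K'} -> ip (remainder K' f) (remainder K' f) <=
                      ip (remainder K f) (remainder K f).
Proof.
move=> Lf sK sK' KK'; rewrite !inner_remainder// lerD2l lerN2.
have [uK _] := sK; have [uK' _] := sK'.
rewrite [leRHS](bigID (mem K)) /= -[X in _ <= X + _]big_filter.
rewrite [X in _ <= X + _](perm_big K) ?lerDl; last first.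
  apply: uniq_perm; rewrite ?filter_uniq// => k.
  by rewrite mem_filter; case kK: (k \in K) => //=; apply: KK'.
by apply: sumr_ge0 => k _; exact: energy_ge0.
Qed.

Lemma remainder_lin K a f g x : L2 f -> L2 g ->
  remainder K (fun x => a * f x + g x) x = a * remainder K f x + remainder K g x.
Proof.
move=> Lf Lg; rewrite /remainder mulrBr addrACA -opprD; congr (_ - _).
rewrite /partial_sum mulr_sumr -big_split; apply: eq_bigr => k _ /=.
have Laf := square_integrableZ a Lf.
rewrite !innerDl//; [|exact: L2s|exact: L2c].
rewrite !innerZl//; [|exact: L2s|exact: L2c].
by rewrite !mulrDl mulrDr !mulrA addrACA.
Qed.

Definition parseval f : Prop := L2 f /\ forall e : R, 0 < e ->
  exists2 K, symmetric_seq K & ip (remainder K f) (remainder K f) <= e.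

Lemma parseval_lin a f g : parseval f -> parseval g ->
  parseval (fun x => a * f x + g x).
Proof.
move=> [Lf hf] [Lg hg]; have Laf := square_integrableZ a Lf.
split=> [|e e0]; first exact: square_integrableD.
have a0 : 0 < a ^+ 2 + 1 by rewrite ltr_wpDl// sqr_ge0.
have e40 : 0 < e / 2 / 2 by rewrite !divr_gt0.
have [K1 sK1 h1] := hf _ (divr_gt0 e40 a0).
have [K2 sK2 h2] := hg _ e40.
pose K := symmetrize (K1 ++ K2); have sK : symmetric_seq K := symmetrizeP _.
have {}h1 : ip (remainder K f) (remainder K f) <= e / 2 / 2 / (a ^+ 2 + 1).
  apply: le_trans h1; apply: remainder_mono => // k kK.
  by apply: sub_symmetrize; rewrite mem_cat kK.
have {}h2 : ip (remainder K g) (remainder K g) <= e / 2 / 2.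
  apply: le_trans h2; apply: remainder_mono => // k kK.
  by apply: sub_symmetrize; rewrite mem_cat kK orbT.
exists K => //.
rewrite (_ : remainder K _ = fun x => a * remainder K f x + remainder K g x);
  last by apply/funext => x; exact: remainder_lin.
have Lrf := L2_remainder K Lf; have Lrg := L2_remainder K Lg.
have Larf := square_integrableZ a Lrf.
apply: (le_trans (innerDD Larf Lrg)).
have -> : ip (fun x => a * remainder K f x) (fun x => a * remainder K f x) =
    a ^+ 2 * ip (remainder K f) (remainder K f).
  by rewrite innerZl// innerC innerZl// mulrA -expr2.
have h3 : a ^+ 2 * ip (remainder K f) (remainder K f) <= e / 2 / 2.
  move: h1; rewrite ler_pdivlMr//; apply: le_trans.
  by rewrite mulrC ler_wpM2l ?inner_ge0// lerDl.
move: h2 h3; move: (ip _ _) (_ * ip _ _) => p q; lra.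
Qed.

(** By Bessel's inequality the remainder of [f - g] is no larger than [f - g], and remainders are
    additive. *)
Lemma parseval_limit f : L2 f -> (forall e : R, 0 < e -> exists g, [/\ parseval g,
    L2 g & ip (fun x => f x - g x) (fun x => f x - g x) <= e]) -> parseval f.
Proof.
move=> Lf h; split=> // e e0.
have e40 : 0 < e / 2 / 2 by rewrite !divr_gt0.
have [g [[Lg pg] _ fg]] := h _ e40; have [K sK hK] := pg _ e40.
exists K => //; have Lfg := square_integrableB Lf Lg.
rewrite (_ : remainder K f =
    fun x => remainder K (fun x => f x - g x) x + remainder K g x); last first.
  apply/funext => x; rewrite -[X in X + _]mul1r -remainder_lin//.
  by congr (remainder K _ x); apply/funext => z; rewrite mul1r subrK.
apply: (le_trans (innerDD (L2_remainder K Lfg) (L2_remainder K Lg))).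
have : ip (remainder K (fun x => f x - g x)) (remainder K (fun x => f x - g x)) <=
    e / 2 / 2.
  rewrite inner_remainder// (le_trans _ fg)// gerBl sumr_ge0// => k _.
  exact: energy_ge0.
move: hK; move: (ip _ _) (ip _ _) => p q; lra.
Qed.

Lemma parseval_trig_class f : trig_class c s f -> parseval f.
Proof.
have sum0 K (F : 'rV[int]_d -> R) (x : R) : x = \sum_(k <- K) F k ->
    x - \sum_(k <- K) F k = 0 by move=> ->; rewrite subrr.
have zero K h : (forall x, remainder K h x = 0) ->
    ip (remainder K h) (remainder K h) = 0.
  move=> h0; have -> : remainder K h = cst 0 by apply/funext => x; rewrite h0.
  by rewrite /inner; under eq_Rintegral do rewrite mulr0; rewrite Rintegral_cst// mul0r.
elim=> {f} [l|l|a f g _ hf _ hg|u f M cu hu uM uf].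
- split=> [|e e0]; first exact: L2c.
  have sK := symmetrizeP [:: l]; have [uK nK] := sK.
  have lK : l \in symmetrize [:: l] by apply: sub_symmetrize; rewrite inE.
  (* The remainder of a generator is exactly 0 as soon as the list contains [l] and [- l]. *)
  exists (symmetrize [:: l]) => //; rewrite zero ?(ltW e0)// => x; apply: sum0.
  rewrite (eq_bigr (fun k => 2^-1 * (c k x * (k == - l)%:R) +
    2^-1 * (c k x * (k == l)%:R))); last first.
    move=> k _; rewrite (innerC _ _ (s k)) inner_sc mul0r addr0.
    rewrite innerC inner_cc addr_eq0 subr_eq0 mulrC.
    by rewrite mulrDr !(mulrCA _ 2^-1).
  rewrite big_split -!mulr_sumr /= !sum_seq_delta//; last exact: nK.
  by rewrite (trig_cN cs) add_halves.
- split=> [|e e0]; first exact: L2s.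
  have sK := symmetrizeP [:: l]; have [uK nK] := sK.
  have lK : l \in symmetrize [:: l] by apply: sub_symmetrize; rewrite inE.
  exists (symmetrize [:: l]) => //; rewrite zero ?(ltW e0)// => x; apply: sum0.
  rewrite (eq_bigr (fun k => 2^-1 * (s k x * (k == l)%:R) -
    2^-1 * (s k x * (k == - l)%:R))); last first.
    move=> k _; rewrite inner_sc mul0r add0r.
    rewrite innerC inner_ss subr_eq0 addr_eq0 mulrC.
    by rewrite mulrBr !(mulrCA _ 2^-1).
  rewrite sumrB -!mulr_sumr /= !sum_seq_delta//; last exact: nK.
  by rewrite (trig_sN cs) mulrN opprK add_halves.
- exact: parseval_lin.
- have cf : trig_class c s f := trig_class_lim cu uM uf.
  apply: parseval_limit => [|e e0]; first exact: L2_trig_class.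
  have E0 : \int[mu]_x (0 : R) = 0 by rewrite Rintegral_cst// mul0r.
  have [N fN] := trig_class_bounded cs cf.
  have : ip (fun x => f x - u n x) (fun x => f x - u n x) @[n --> \oo] --> (0 : R).
    rewrite -[X in _ --> X]E0.
    apply: (@Rintegral_cvg _ T R mu (fun n x => (f x - u n x) * (f x - u n x)) _
      (cst ((N + M) * (N + M)))).
    + move=> n; apply: measurable_funM; apply: measurable_funB;
        exact: measurable_trig_class.
    + move=> n x; have b : `|f x - u n x| <= N + M.
        by rewrite (le_trans (ler_normB _ _))// lerD.
      by rewrite normrM ler_pM.
    + exact: finite_measure_integrable_cst.
    + move=> x; rewrite -[X in _ --> X](mulr0 0) -(subrr (f x)).
      by apply: cvgM; apply: cvgB => //; exact: cvg_cst.
  move=> /cvgrPdist_le /(_ _ e0) [n _ /(_ n (leqnn n))].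
  rewrite sub0r normrN => h; exists (u n); split=> //.
    exact: L2_trig_class.
  by rewrite (le_trans _ h)// ler_norm.
Qed.

Lemma parseval_L2 f : L2 f -> parseval f.
Proof.
have nneg g : L2 g -> (forall x, 0 <= g x) -> parseval g.
  move=> Lg g0; apply: parseval_limit => //.
  apply: square_integrable_nneg_approx => // h [r [A [mA ->]]].
  apply: parseval_trig_class; apply: trig_class_sum => // y.
  exact/trig_classZ/borel.
move=> Lf; have [mf f2] := Lf.
have Lnorm : L2 (fun x => `|f x|).
  split; first exact: measurableT_comp.
  by under eq_fun do rewrite real_normK ?num_real//.
have pos : parseval (fun x => 2^-1 * (`|f x| + f x)).
  apply: nneg => [|x]; first exact/square_integrableZ/square_integrableD.
  by rewrite mulr_ge0 ?invr_ge0// -lerBlDr sub0r -normrN ler_norm.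
have neg : parseval (fun x => 2^-1 * (`|f x| - f x)).
  apply: nneg => [|x]; first exact/square_integrableZ/square_integrableB.
  by rewrite mulr_ge0 ?invr_ge0// subr_ge0 ler_norm.
have := parseval_lin (-1) neg pos; congr parseval.
by apply/funext => x; move: `|f x| (f x) => p q; lra.
Qed.

Lemma parseval_energy f (e : R) : L2 f -> 0 < e ->
  exists2 K, uniq K & ip f f - e <= \sum_(k <- K) energy f k.
Proof.
move=> Lf e0; have [_ /(_ e e0)[K sK]] := parseval_L2 Lf.
rewrite inner_remainder// => h; exists K; first by case: sK.
by rewrite lerBlDr -lerBlDl.
Qed.

End Parseval.

Section SumOfWeights.
Context (R : realType) (I : choiceType).
Implicit Types (w : I -> R) (E : set I).

(** The sum is finite under the Bessel bound assumed below, so [fine] loses nothing. *)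
Definition weight w E : R := fine (\esum_(k in E) (w k)%:E).

Context (w : I -> R) (w0 : forall k, 0 <= w k) (M : R).
Context (wM : forall K : seq I, uniq K -> \sum_(k <- K) w k <= M).

Lemma weight_esum_le E (N : R) :
  (forall K : seq I, uniq K -> (forall k, k \in K -> E k) ->
     \sum_(k <- K) w k <= N) ->
  (\esum_(k in E) (w k)%:E <= N%:E)%E.
Proof.
move=> wN; apply: ge_ereal_sup => _ [X [finX XE] <-].
rewrite fsbig_finite//= sumEFin lee_fin; apply: wN; first exact: finmap.fset_uniq.
by move=> k; rewrite in_fset_set// inE; exact: XE.
Qed.

Lemma weight_fin E : (\esum_(k in E) (w k)%:E)%E \is a fin_num.
Proof.
rewrite ge0_fin_numE; last by apply: esum_ge0 => k _; rewrite lee_fin.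
by rewrite (le_lt_trans (weight_esum_le (N := M) _)) ?ltry// => K uK _; exact: wM.
Qed.

Lemma weight_le E (N : R) :
  (forall K : seq I, uniq K -> (forall k, k \in K -> E k) ->
     \sum_(k <- K) w k <= N) -> weight w E <= N.
Proof.
move=> wN; rewrite -lee_fin fineK ?weight_fin//; exact: weight_esum_le.
Qed.

Lemma weight_ge E (K : seq I) : uniq K -> (forall k, k \in K -> E k) ->
  \sum_(k <- K) w k <= weight w E.
Proof.
move=> uK KE; rewrite -lee_fin fineK ?weight_fin// -sumEFin fsbig_seq//.
by apply: esum_ge; exists [set` K] => //; split => //; exact: finite_seq.
Qed.

Lemma weight_ge0 E : 0 <= weight w E.
Proof. by have := @weight_ge E [::] isT; rewrite big_nil; apply. Qed.

Lemma weightU E F : E `&` F = set0 -> weight w (E `|` F) = weight w E + weight w F.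
Proof.
move=> EF; apply: EFin_inj; rewrite EFinD !fineK ?weight_fin//.
rewrite (esumID E) => [|k _]; last by rewrite lee_fin.
congr (_ + _)%E; congr (esum _ _); first exact: (setIidr (@subsetUl _ E F)).
rewrite setIUl setICr set0U; apply/setIidPl => k Fk Ek.
suff : set0 k by [].
by rewrite -EF.
Qed.

Lemma weight_reindex (e : I -> I) E : bijective e ->
  weight w E = weight (fun k => w (e k)) [set k | E (e k)].
Proof.
move=> [e' ee' e'e]; congr fine; apply: reindex_esum; split.
- by move=> k.
- by move=> j k _ _; exact: (can_inj ee').
- by move=> j Ej; exists (e' j) => //=; rewrite e'e.
Qed.

End SumOfWeights.

(** Weighted arithmetic-geometric inequality: the first factor may be as close to 1 as desired, at
    the expense of a term that will tend to 0 in the application. *)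
Lemma sqr_perturb (R : realType) (p q e : R) : 0 < e ->
  (p + q) ^+ 2 <= (1 + e) * p ^+ 2 + (1 + e^-1) * q ^+ 2.
Proof.
move=> e0; have ee : e * e^-1 = 1 by rewrite mulfV// gt_eqF.
have := sqr_ge0 (e * p - q); rewrite -(pmulr_rge0 _ (_ : 0 < e^-1)) ?invr_gt0//.
have -> : e^-1 * (e * p - q) ^+ 2 =
    (e * e^-1) * (e * p ^+ 2) - 2 * (e * e^-1) * (p * q) + e^-1 * q ^+ 2.
  by ring.
by rewrite ee; lra.
Qed.

(** * The limit mean of the Fourier energies *)

Section EnergyMean.
Context dsp (T : measurableType dsp) (R : realType) (d : nat).
Context (c s : 'rV[int]_d -> T -> R) (cs : trig_family c s).
Context (mc : forall k, measurable_fun setT (c k)).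
Context (ms : forall k, measurable_fun setT (s k)).
Context (borel : forall A, measurable A -> trig_class c s \1_A).
Context (mu : probability T R).
Context (Ec : forall k, k != 0 -> \int[mu]_x c k x = 0).
Context (Es : forall k, k != 0 -> \int[mu]_x s k x = 0).
Local Notation L2 := (square_integrable mu).
Local Notation ip := (inner mu).
Local Notation en := (energy c s mu).

Lemma energy_perturb f g (e : R) k : L2 f -> L2 g -> 0 < e ->
  en g k <= (1 + e) * en f k + (1 + e^-1) * en (fun x => g x - f x) k.
Proof.
move=> Lf Lg e0; have Lgf := square_integrableB Lg Lf.
have Lc := L2c cs mc ms mu k; have Ls := L2s cs mc ms mu k.
have gE h : L2 h -> ip g h = ip f h + ip (fun x => g x - f x) h.
  by move=> Lh; rewrite innerBl// addrC subrK.
rewrite /energy !gE// !mulrDr addrACA.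
by apply: lerD; exact: sqr_perturb.
Qed.

Lemma energy_sum_le f : L2 f -> forall K, uniq K -> \sum_(k <- K) en f k <= ip f f.
Proof. by move=> Lf K uK; exact: (bessel cs mc ms Ec Es). Qed.

Lemma energy0 f : L2 f -> \int[mu]_x f x = 0 -> en f 0 = 0.
Proof.
move=> Lf f0; rewrite /energy /inner.
under eq_Rintegral do rewrite (trig_c0 cs) mulr1.
under [X in _ + X ^+ 2]eq_Rintegral do rewrite (trig_s0 cs) mulr0.
by rewrite f0 Rintegral_cst// mul0r expr0n addr0.
Qed.

Lemma weight_energyT f : L2 f -> ip f f <= weight (en f) setT.
Proof.
move=> Lf; apply/ler_addgt0Pr => e e0; rewrite -lerBlDr.
have [K uK hK] := parseval_energy cs mc ms borel Ec Es Lf e0.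
apply: le_trans hK _; apply: (weight_ge (energy_ge0 c s mu f) (energy_sum_le Lf) uK).
by [].
Qed.

Lemma weight_energy_perturb f g (e : R) E : L2 f -> L2 g -> 0 < e ->
  weight (en g) E <= (1 + e) * weight (en f) E +
    (1 + e^-1) * ip (fun x => g x - f x) (fun x => g x - f x).
Proof.
move=> Lf Lg e0; have Lgf := square_integrableB Lg Lf.
apply: (weight_le (energy_ge0 c s mu g) (energy_sum_le Lg)) => K uK KE.
apply: (@le_trans _ _ (\sum_(k <- K) ((1 + e) * en f k +
    (1 + e^-1) * en (fun x => g x - f x) k))).
  by apply: ler_sum => k _; exact: energy_perturb.
rewrite big_split -!mulr_sumr lerD// ler_wpM2l ?addr_ge0 ?invr_ge0 ?(ltW e0)//.
  exact: (weight_ge (energy_ge0 c s mu f) (energy_sum_le Lf) uK KE).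
exact: energy_sum_le.
Qed.

Context (xi : nat -> T -> R) (Lxi : forall n, L2 (xi n)).
Context (xi1 : forall n, ip (xi n) (xi n) <= 1).
Context (xi2 : forall n, 2^-1 <= ip (xi n) (xi n)).
Context (xi0 : forall n, \int[mu]_x xi n x = 0).

Definition energy_mean (E : set 'rV[int]_d) : R :=
  ulim (fun n => weight (en (xi n)) E).

Lemma weight_energy_norm n E : `|weight (en (xi n)) E| <= 1.
Proof.
have w0 := energy_ge0 c s mu (xi n); have wM := energy_sum_le (Lxi n).
rewrite (ger0_norm (weight_ge0 w0 wM E)).
apply: (weight_le w0 wM) => K uK _; exact: le_trans (wM K uK) (xi1 n).
Qed.

Lemma energy_mean_is_mean : is_mean energy_mean.
Proof.
have FU := @free_ultra_proper.
split=> [E|E F EF].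
  have <- : ulim (fun=> 0 : R) = 0 by apply: ulim_unique; exact: cvg_cst.
  apply: (ler_ulim (M := 1) (M' := 1)).
  - by move=> n; rewrite normr0.
  - by move=> n; exact: weight_energy_norm.
  - move=> n; exact: (weight_ge0 (energy_ge0 c s mu (xi n)) (energy_sum_le (Lxi n))).
apply: ulim_unique.
rewrite (_ : (fun n => _) = fun n => weight (en (xi n)) E + weight (en (xi n)) F).
  by apply: cvgD; apply: (ulim_cvg (M := 1)) => n; exact: weight_energy_norm.
apply/funext => n.
exact: (weightU (energy_ge0 c s mu (xi n)) (energy_sum_le (Lxi n)) EF).
Qed.

Lemma energy_meanT : 0 < energy_mean setT.
Proof.
apply: (@lt_le_trans _ _ 2^-1); first by rewrite invr_gt0.
have FU := @free_ultra_proper.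
have <- : ulim (fun=> 2^-1 : R) = 2^-1 by apply: ulim_unique; exact: cvg_cst.
apply: (ler_ulim (M := 2^-1) (M' := 1)).
- by move=> n; rewrite ger0_norm// invr_ge0.
- by move=> n; exact: weight_energy_norm.
- by move=> n; exact: le_trans (xi2 n) (weight_energyT (Lxi n)).
Qed.

Lemma energy_mean0 : energy_mean [set 0] = 0.
Proof.
have FU := @free_ultra_proper.
apply: ulim_unique; rewrite (_ : (fun n => _) = cst 0); first exact: cvg_cst.
apply/funext => n; by rewrite /weight esum_set1 ?energy0//.
Qed.

(** The energies of [h n] exceed those of [xi n] by at most a factor [1 + e] and an error vanishing
    in the limit; then [e] tends to 0. One inequality for all [E] is enough, since the inverse group
    element will give the other. *)
Lemma energy_mean_invariant (h : nat -> T -> R) (a : 'rV[int]_d -> 'rV[int]_d) :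
  (forall n, L2 (h n)) -> bijective a ->
  (forall n k, en (h n) k = en (xi n) (a k)) ->
  ip (fun x => h n x - xi n x) (fun x => h n x - xi n x) @[n --> \oo] --> (0 : R) ->
  forall E, energy_mean E <= energy_mean [set k | E (a k)].
Proof.
move=> Lh aB hE h0 E; have FU := @free_ultra_proper.
have c1 := ulim_cvg (fun n => weight_energy_norm n E).
have c2 := ulim_cvg (fun n => weight_energy_norm n [set k | E (a k)]).
set m1 := energy_mean E; set m2 := energy_mean _.
have key (e : R) : 0 < e -> m1 <= (1 + e) * m2.
  move=> e0; have c3 := cvg_free_ultra h0.
  have c4 : (1 + e) * weight (en (xi n)) [set k | E (a k)] + (1 + e^-1) *
      ip (fun x => h n x - xi n x) (fun x => h n x - xi n x) @[n --> @free_ultra]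
      --> (1 + e) * m2 + (1 + e^-1) * 0.
    apply: cvgD; apply: cvgM => //; exact: cvg_cst.
  rewrite mulr0 addr0 in c4.
  apply: (ler_cvg_to c1 c4); apply: nearW => n /=.
  rewrite (weight_reindex _ E aB).
  rewrite (_ : (fun k => _) = en (h n)); last by apply/funext => k; rewrite hE.
  exact: weight_energy_perturb.
have m20 : 0 <= m2 := mean_ge0 energy_mean_is_mean _.
apply/ler_addgt0Pr => e e0.
have m21 : 0 < m2 + 1 by rewrite ltr_wpDl.
apply: le_trans (key (e / (m2 + 1)) (divr_gt0 e0 m21)) _.
rewrite mulrDl mul1r lerD2l mulrAC ler_pdivrMr// ler_wpM2l ?(ltW e0)//.
by rewrite lerDl.
Qed.

End EnergyMean.

(** * Characters and Borel sets of the torus *)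

Section PeriodicFunctions.
Context (R : realType).
Local Notation turn := (pi *+ 2 : R).

Lemma periodicz (f : R -> R) (T x : R) (z : int) : periodic f T ->
  f (x + T * z%:~R) = f x.
Proof.
move=> fT; case: z => n; first by rewrite -pmulrn mulr_natr periodicn.
rewrite NegzE mulrNz mulrN -[LHS](periodicn fT n.+1).
by rewrite -pmulrn mulr_natr subrK.
Qed.

(** Cosine decreases on [0, pi], so it bounds the distance from [x] to its nearest integer, the
    floor of [x + 2^-1]. The reduction to [e <= 2^-1] keeps the angle [2 pi e] in that interval. *)
Lemma cos_near1 (e : R) : 0 < e -> exists2 delta : R, 0 < delta &
  forall x, 1 - cos (turn * x) < delta -> exists m : int, `|x - m%:~R| < e.
Proof.
move=> e0; wlog e2 : e e0 / e <= 2^-1.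
  move=> H; have e'0 : 0 < Num.min e 2^-1 by rewrite lt_min e0 invr_gt0 ltr0n.
  have [|delta d0 hd] := H _ e'0; first by rewrite ge_min lexx orbT.
  exists delta => // x /hd[m]; rewrite lt_min => /andP[hm _].
  by exists m.
have pi0 := pi_gt0 R.
have te0 : 0 < turn * e by rewrite mulr_gt0// pmulrn_lgt0.
have tepi : turn * e <= pi.
  rewrite -mulr_natl mulrC mulrA; have : e * 2 <= 1 by lra.
  by move=> h; rewrite ger_pMl.
exists (1 - cos (turn * e)).
  rewrite subr_gt0 -[X in _ < X](@cos0 R) ltr_cos// in_itv /=.
    by rewrite lexx ltW.
  by rewrite ltW.
move=> x; rewrite ltrD2l ltrN2 => cx.
exists (Num.floor (x + 2^-1)); set m := Num.floor _.
have /andP[h1 h2] := floor_itv (x + 2^-1); rewrite -/m in h1 h2.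
rewrite intrD in h2; have {}h2 : x - m%:~R < 2^-1 by move: h2; move: m%:~R => z; lra.
have {}h1 : - 2^-1 <= x - m%:~R by move: h1; move: m%:~R => z; lra.
rewrite ltNge; apply/negP => he; move: cx; apply/negP; rewrite -leNgt.
have -> : cos (turn * x) = cos (turn * `|x - m%:~R|).
  rewrite -[x in LHS](subrK m%:~R) mulrDr periodicz; last exact: cosD2pi.
  rewrite -(cos_norm (turn * _)) normrM [`|turn|]gtr0_norm// pmulrn_lgt0//.
have r2 : `|x - m%:~R| <= 2^-1 by rewrite ler_norml h1 ltW.
have rpi : turn * `|x - m%:~R| <= pi.
  rewrite -mulr_natl mulrC mulrA; have : `|x - m%:~R| * 2 <= 1 by lra.
  by move=> h; rewrite ger_pMl.
rewrite leNgt ltr_cos ?in_itv /=.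
- by rewrite -leNgt ler_pM2l// pmulrn_lgt0.
- by rewrite rpi andbT mulr_ge0 // mulrn_wge0 // ltW.
- by rewrite (ltW te0).
Qed.

End PeriodicFunctions.

Section Characters.
Context (R : realType) (V : vectType R) (Delta : zmodClosed V).
Context (b : (\dim {: V}).-tuple V) (bV : basis_of {: V} b).
Context (bD : forall v : V, v \in Delta <-> inIntSpan b v).
Local Notation d := (\dim {: V}).
Local Notation turn := (pi *+ 2 : R).

Lemma free_b : free b. Proof. by move: bV => /andP[_]. Qed.

Lemma coord_b (v : V) : v = \sum_i coord b i v *: b`_i.
Proof. by apply: (coord_basis bV); exact: memvf. Qed.

Lemma b_Delta i : (i < d)%N -> b`_i \in Delta.
Proof.
move=> id; apply/bD; exists [ffun j : 'I_d => (j == Ordinal id)%:Z].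
rewrite (bigD1 (Ordinal id))//= ffunE eqxx mulr1z big1 ?addr0// => j /negbTE ji.
by rewrite ffunE ji mulr0z.
Qed.

Lemma coord_Delta v i : v \in Delta -> exists z : int, coord b i v = z%:~R.
Proof.
move=> /bD[a ->]; exists (a i).
under eq_bigr do rewrite -scaler_int.
exact: coord_sum_free free_b.
Qed.

(** An integral row vector stands for an element of the dual lattice, and its phase is the argument
    of the corresponding character. *)
Definition phase (k : 'rV[int]_d) (v : V) : R :=
  turn * \sum_i (k 0 i)%:~R * coord b i v.

Lemma phaseDr k u v : phase k (u + v) = phase k u + phase k v.
Proof.
rewrite /phase -mulrDr -big_split; congr (_ * _); apply: eq_bigr => i _.
by rewrite linearD mulrDr.
Qed.

Lemma phaseZ k a v : phase k (a *: v) = a * phase k v.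
Proof.
rewrite /phase [RHS]mulrCA; congr (_ * _); rewrite mulr_sumr; apply: eq_bigr => i _.
by rewrite linearZ /= mulrCA.
Qed.

Lemma phase_sum k I (r : seq I) (F : I -> V) :
  phase k (\sum_(i <- r) F i) = \sum_(i <- r) phase k (F i).
Proof.
elim: r => [|i r IH]; last by rewrite !big_cons phaseDr IH.
by rewrite !big_nil -(scale0r 0) phaseZ mul0r.
Qed.

Lemma phaseDl k l v : phase (k + l) v = phase k v + phase l v.
Proof.
rewrite /phase -mulrDr -big_split; congr (_ * _); apply: eq_bigr => i _.
by rewrite mxE intrD mulrDl.
Qed.

Lemma phaseNl k v : phase (- k) v = - phase k v.
Proof.
rewrite /phase -mulrN -sumrN; congr (_ * _); apply: eq_bigr => i _.
by rewrite mxE mulrNz mulNr.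
Qed.

Lemma phase0l v : phase 0 v = 0.
Proof. by rewrite /phase big1 ?mulr0// => i _; rewrite mxE mul0r. Qed.

Lemma phase_Delta k v : v \in Delta -> exists z : int, phase k v = turn * z%:~R.
Proof.
move=> vD; pose z i := sval (cid (coord_Delta i vD)).
exists (\sum_i k 0 i * z i); rewrite rmorph_sum; congr (_ * _).
apply: eq_bigr => i _; rewrite rmorphM /=; congr (_ * _).
by rewrite /z; case: cid.
Qed.

(** Real part of the character of [k]; by [tcos_pi] the value does not depend on the
    representative. *)
Definition tcos (k : 'rV[int]_d) (t : torus Delta) : R :=
  cos (phase k (repr (t : ring_quotient.Quotient.quot Delta))).
Definition tsin (k : 'rV[int]_d) (t : torus Delta) : R :=
  sin (phase k (repr (t : ring_quotient.Quotient.quot Delta))).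

Lemma phase_repr k v : exists z : int,
  phase k (repr (torus_pi Delta v : ring_quotient.Quotient.quot Delta)) =
  phase k v + turn * z%:~R.
Proof.
set w := repr _.
have wv : w - v \in Delta by apply/torus_piP; exact: torus_piK.
have [z hz] := phase_Delta k wv; exists z.
by rewrite -hz -phaseDr addrC subrK.
Qed.

Lemma tcos_pi k v : tcos k (torus_pi Delta v) = cos (phase k v).
Proof.
by rewrite /tcos; have [z ->] := phase_repr k v; rewrite periodicz//; exact: cosD2pi.
Qed.

Lemma tsin_pi k v : tsin k (torus_pi Delta v) = sin (phase k v).
Proof.
by rewrite /tsin; have [z ->] := phase_repr k v; rewrite periodicz//; exact: sinD2pi.
Qed.

Lemma trig_family_torus : trig_family tcos tsin.
Proof.
split=> *; rewrite /tcos /tsin.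
- by rewrite phase0l cos0.
- by rewrite phaseDl cosD.
- by rewrite phaseDl sinD.
- by rewrite phaseNl cosN.
- by rewrite phaseNl sinN.
- exact: cos2Dsin2.
Qed.

Lemma tcosD k (t u : torus Delta) :
  tcos k (t + u) = tcos k t * tcos k u - tsin k t * tsin k u.
Proof.
rewrite -(torus_piK t) -(torus_piK u) -torus_piD !tcos_pi !tsin_pi phaseDr.
exact: cosD.
Qed.

Lemma tsinD k (t u : torus Delta) :
  tsin k (t + u) = tsin k t * tcos k u + tcos k t * tsin k u.
Proof.
rewrite -(torus_piK t) -(torus_piK u) -torus_piD !tcos_pi !tsin_pi phaseDr.
exact: sinD.
Qed.

(* The floor is exact: g maps the lattice basis into the lattice. *)
Definition lattice_mx (g : autT Delta) : 'M[int]_d :=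
  \matrix_(i, j) Num.floor (coord b i ((g : 'End(V)) b`_j)).

Lemma lattice_mxE (g : autT Delta) i (j : 'I_d) :
  (lattice_mx g i j)%:~R = coord b i ((g : 'End(V)) b`_j).
Proof.
rewrite mxE; have gb : (g : 'End(V)) b`_j \in Delta.
  by apply: autT_Delta; exact: b_Delta.
by have [z ->] := coord_Delta i gb; rewrite intrKfloor.
Qed.

Lemma coord_lattice_mx (g : autT Delta) i v :
  coord b i ((g : 'End(V)) v) = \sum_j (lattice_mx g i j)%:~R * coord b j v.
Proof.
rewrite {1}(coord_b v) !linear_sum /=; apply: eq_bigr => j _.
by rewrite !linearZ /= lattice_mxE mulrC.
Qed.

Lemma lattice_mx1 : lattice_mx 1%g = 1%:M.
Proof.
apply/matrixP => i j; apply: (@intr_inj R); rewrite lattice_mxE id_lfunE.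
by rewrite coord_free ?free_b// mxE eq_sym natz.
Qed.

Lemma lattice_mxM (g h : autT Delta) :
  lattice_mx (g * h)%g = lattice_mx g *m lattice_mx h.
Proof.
apply/matrixP => i j; apply: (@intr_inj R); rewrite lattice_mxE comp_lfunE.
rewrite coord_lattice_mx mxE rmorph_sum; apply: eq_bigr => l _.
by rewrite rmorphM /= (lattice_mxE h).
Qed.

(** The dual action: an automorphism acts on frequencies by right multiplication, which is why
    frequencies are row vectors. *)
Lemma phase_lattice_mx (g : autT Delta) k v :
  phase k ((g : 'End(V)) v) = phase (k *m lattice_mx g) v.
Proof.
rewrite /phase; congr (_ * _).
under eq_bigr do rewrite coord_lattice_mx mulr_sumr.
rewrite exchange_big; apply: eq_bigr => j _ /=; rewrite mxE rmorph_sum mulr_suml.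
by apply: eq_bigr => i _; rewrite rmorphM /= mulrA.
Qed.

Lemma tcos_act (g : autT Delta) k t :
  tcos k (autT_act g t) = tcos (k *m lattice_mx g) t.
Proof. by rewrite -(torus_piK t) autT_act_pi !tcos_pi phase_lattice_mx. Qed.

Lemma tsin_act (g : autT Delta) k t :
  tsin k (autT_act g t) = tsin (k *m lattice_mx g) t.
Proof. by rewrite -(torus_piK t) autT_act_pi !tsin_pi phase_lattice_mx. Qed.

End Characters.

Lemma continuous_sumr (R : realType) (T : topologicalType) (I : Type)
    (r : seq I) (F : I -> T -> R) :
  (forall i, continuous (F i)) -> continuous (fun x => \sum_(i <- r) F i x).
Proof.
move=> cF; elim: r => [|i r IH].
  rewrite (_ : (fun x => _) = cst 0); first exact: cst_continuous.
  by apply/funext => x; rewrite big_nil.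
rewrite (_ : (fun x => _) = fun x => F i x + \sum_(j <- r) F j x).
  by move=> x; apply: cvgD; [exact: cF|exact: IH].
by apply/funext => x; rewrite big_cons.
Qed.

Section BorelTorus.
Context (R : realType) (V : vectType R) (Delta : zmodClosed V).
Context (b : (\dim {: V}).-tuple V) (bV : basis_of {: V} b).
Context (bD : forall v : V, v \in Delta <-> inIntSpan b v).
Local Notation d := (\dim {: V}).
Local Notation turn := (pi *+ 2 : R).

Lemma open_torusE (A : set (torus Delta)) : open A <->
  exists2 B : set 'rV[R]_d, open B &
    @vect_coord R V @^-1` B = [set v | A (torus_pi Delta v)].
Proof. by []. Qed.

Lemma open_gt_phase (F : R -> R) (k : 'rV[int]_d) (x : R)
    (f : torus Delta -> R) : continuous F ->
  (forall v, f (torus_pi Delta v) = F (phase b k v)) ->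
  open [set t | x < f t].
Proof.
move=> cF fF; apply/open_torusE.
pose L (w : 'rV[R]_d) := \sum_j w 0 j * phase b k (vbasis {: V})`_j.
have LE v : L (vect_coord v) = phase b k v.
  rewrite {2}(coord_vbasis (memvf v)) phase_sum; apply: eq_bigr => j _.
  by rewrite phaseZ mxE.
have cL : continuous L.
  apply: continuous_sumr => j w.
  apply: (@cvgM R _ (nbhs w) (nbhs_filter w) (fun w : 'rV[R]_d => w 0 j)
      (cst (phase b k _))).
    exact: coord_continuous.
  exact: cvg_cst.
exists [set w | x < F (L w)]; last first.
  by apply/seteqP; split=> v /=; rewrite LE fF.
rewrite (_ : [set w | _] = (F \o L) @^-1` [set y | x < y]) //.
apply: open_comp; last exact: open_gt.
by move=> w _; apply: continuous_comp; [exact: cL|exact: cF].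
Qed.

Lemma measurable_gt_phase (F : R -> R) (k : 'rV[int]_d)
    (f : torus Delta -> R) : continuous F ->
  (forall v, f (torus_pi Delta v) = F (phase b k v)) ->
  measurable_fun [set: borel_torus Delta] (f : borel_torus Delta -> R).
Proof.
move=> cF fF; apply: (measurability _ (RGenOInfty.measurableE R)).
move=> _ [_ [x ->] <-]; rewrite setTI; apply: sub_sigma_algebra.
rewrite (_ : _ @^-1` _ = [set t | x < f t]); first exact: (open_gt_phase x cF fF).
by apply/seteqP; split=> t /=; rewrite in_itv /= andbT.
Qed.

Lemma measurable_tcos k :
  measurable_fun [set: borel_torus Delta] (tcos b k : borel_torus Delta -> R).
Proof. by apply: measurable_gt_phase (@continuous_cos R) _; exact: tcos_pi. Qed.

Lemma measurable_tsin k :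
  measurable_fun [set: borel_torus Delta] (tsin b k : borel_torus Delta -> R).
Proof. by apply: measurable_gt_phase (@continuous_sin R) _; exact: tsin_pi. Qed.

(** The topology is defined through [vbasis], the lattice through [b]: the constant [C] bounds the
    change of basis, and the integers [m] are removed by a lattice translation. *)
Lemma open_torus_box (A : set (torus Delta)) (v0 : V) : open A ->
  A (torus_pi Delta v0) -> exists2 e : R, 0 < e &
  forall v, (forall i, exists m : int, `|coord b i v - coord b i v0 - m%:~R| < e) ->
    A (torus_pi Delta v).
Proof.
move=> /open_torusE[B oB BA] Av0.
have Bv0 : B (vect_coord v0) by move/seteqP: BA => [_]; exact.
have [e e0 eB] : exists2 e : R, 0 < e & ball (vect_coord v0) e `<=` B.
  by have /nbhs_ballP[e /= e0 eB] := open_nbhs_nbhs (conj oB Bv0); exists e.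
pose C : R := \sum_(i < d) nrm1 (vect_coord (b`_i)).
have C0 : 0 <= C by apply: sumr_ge0 => i _; exact: nrm1_ge0.
have C1 : 0 < C + 1 by rewrite ltr_wpDl.
exists (e / (C + 1)); first by rewrite divr_gt0.
move=> v hv; pose m i := sval (cid (hv i)).
have hm i : `|coord b i v - coord b i v0 - (m i)%:~R| < e / (C + 1).
  by rewrite /m; case: cid.
pose w := v - \sum_(i < d) (m i)%:~R *: b`_i.
have wE : torus_pi Delta w = torus_pi Delta v.
  apply/torus_piP; rewrite /w addrAC subrr add0r rpredN.
  apply: rpred_sum => i _; rewrite scaler_int rpredMz//.
  exact: (b_Delta bD).
rewrite -wE; suff : B (vect_coord w).
  by move/seteqP: BA => [h _]; exact: h.
have wv0 : w - v0 =
    \sum_(i < d) (coord b i v - coord b i v0 - (m i)%:~R) *: b`_i.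
  rewrite /w {1}(coord_b bV v) {1}(coord_b bV v0) addrAC -!sumrB.
  by apply: eq_bigr => i _; rewrite !scalerBl.
apply: eB; split=> [//|i j]; rewrite /ball /= ord1 !mxE -normrN opprB -linearB wv0 linear_sum.
apply: le_lt_trans (ler_norm_sum _ _ _) _.
apply: (@le_lt_trans _ _ (\sum_(l < d) e / (C + 1) * nrm1 (vect_coord (b`_l)))).
  apply: ler_sum => l _; rewrite linearZ normrM ler_pM// ?(ltW (hm l))//.
  by have := le_nrm1_entry (vect_coord (b`_l)) 0 j; rewrite mxE.
rewrite -mulr_sumr mulrAC ltr_pdivrMr// ltr_pM2l// ltrDl//.
Qed.

Lemma phase_delta i v : phase b (delta_mx 0 i) v = turn * coord b i v.
Proof.
rewrite /phase; congr (_ * _); rewrite (bigD1 i)//= mxE !eqxx mul1r.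
by rewrite big1 ?addr0// => j /negbTE ji; rewrite mxE ji andbF mul0r.
Qed.

(** A trigonometric polynomial playing the role of a distance to the point with rational coordinates
    [q], as [cos_dist_pi] shows. Its sublevel sets at the heights [n.+1%:R^-1] form a countable base
    of the topology. *)
Definition cos_dist (q : 'rV[rat]_d) (t : torus Delta) : R :=
  \sum_i (1 - (cos (turn * ratr (q 0 i)) * tcos b (delta_mx 0 i) t +
               sin (turn * ratr (q 0 i)) * tsin b (delta_mx 0 i) t)).

Lemma cos_dist_pi q v : cos_dist q (torus_pi Delta v) =
  \sum_i (1 - cos (turn * (coord b i v - ratr (q 0 i)))).
Proof.
apply: eq_bigr => i _; rewrite tcos_pi// tsin_pi// phase_delta mulrBr cosB.
by rewrite mulrC (mulrC (sin _)).
Qed.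

Lemma trig_class_cos_dist q : trig_class (tcos b) (tsin b) (cos_dist q).
Proof.
have cs := trig_family_torus Delta b.
apply: trig_class_sum => // i; apply: trig_classB; first exact: trig_class_cst.
apply: trig_classD => //; apply: trig_classZ => //.
  exact: trig_class_c.
exact: trig_class_s.
Qed.

Lemma open_torus_cos_dist (A : set (torus Delta)) (t : torus Delta) : open A ->
  A t -> exists (q : 'rV[rat]_d) (n : nat), cos_dist q t < n.+1%:R^-1 /\
    forall u, cos_dist q u < n.+1%:R^-1 -> A u.
Proof.
rewrite -(torus_piK t); set v0 := repr _ => oA At.
have [e e0 eA] := open_torus_box oA At.
have e2 : 0 < e / 2 by rewrite divr_gt0.
have [delta d0 hd] := cos_near1 e2.
pose n := Num.trunc delta^-1.
have nd : n.+1%:R^-1 < delta.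
  by rewrite -[ltRHS]invrK ltf_pV2 ?posrE ?invr_gt0// truncnS_gt.
(* Dividing by [d.+1] makes a sum of [d] terms, each at most [r], strictly less than
   [n.+1%:R^-1]. *)
pose r : R := n.+1%:R^-1 / (d.+1)%:R.
have r0 : 0 < r by rewrite divr_gt0// invr_gt0.
have [eta eta0 heta] : exists2 eta : R, 0 < eta &
    forall x, `|x| < eta -> 1 - cos (turn * x) < r.
  have c0 : (fun x => cos (turn * x)) x @[x --> (0 : R)] --> (1 : R).
    rewrite -[X in _ --> X](@cos0 R) -[X in cos X](mulr0 turn).
    apply: continuous_comp; last exact: continuous_cos.
    by apply: cvgM; [exact: cvg_cst|exact: cvg_id].
  move/cvgrPdist_lt : c0 => /(_ _ r0) /nbhs_ballP[eta /= eta0 h].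
  exists eta => // x xeta; have := h x; rewrite /ball /= sub0r normrN => /(_ xeta).
  exact: le_lt_trans (ler_norm _).
pose z := Num.min eta (e / 2); have z0 : 0 < z by rewrite lt_min eta0.
have hq (i : 'I_d) : exists q : rat, `|coord b i v0 - ratr q| < z.
  have xz : coord b i v0 - z < coord b i v0 + z by rewrite ltrD2l gtrN.
  have [q] := rat_in_itvoo xz.
  rewrite in_itv /= => /andP[h1 h2]; exists q; rewrite distrC ltr_norml.
  by rewrite ltrBrDl h1 ltrBlDl h2.
have [q qP] := choice hq.
exists (\row_i q i), n; split.
  rewrite cos_dist_pi; apply: (@le_lt_trans _ _ (\sum_(i < d) r)).
    apply: ler_sum => i _; rewrite mxE; apply/ltW/heta.
    by have := qP i; rewrite lt_min => /andP[].
  rewrite sumr_const card_ord -[r *+ _]mulr_natr /r mulrAC ltr_pdivrMr//.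
  by rewrite ltr_pM2l ?invr_gt0// ltr_nat.
move=> u; rewrite -(torus_piK u); set v := repr _; rewrite cos_dist_pi => hu.
apply: eA => i; have [m hm] : exists m : int, `|coord b i v - ratr (q i) - m%:~R| < e / 2.
  apply: hd; apply: le_lt_trans (lt_trans hu nd).
  rewrite [leRHS](bigD1 i)//= mxE lerDl sumr_ge0//.
exists m; have := qP i; rewrite lt_min => /andP[_ hqi].
rewrite (splitr e) -[X in X < _]normrN; apply: le_lt_trans (ltrD hm hqi).
rewrite normrN -(distrC (ratr _)); apply: le_trans (ler_normD _ _).
by rewrite le_eqVlt; apply/orP; left; apply/eqP; congr `|_|; ring.
Qed.

(** An open set is the union of the sublevel sets of the functions [cos_dist q] that it contains,
    enumerated by [unpickle]; the indicators of these lie in the class by [trig_class_pos]. *)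
Lemma trig_class_borel (A : set (borel_torus Delta)) : measurable A ->
  trig_class (tcos b) (tsin b) \1_A.
Proof.
have cs := trig_family_torus Delta b.
have sig := trig_class_sigma cs.
apply: (smallest_sub sig) => {}A oA /=.
pose B (p : 'rV[rat]_d * nat) := [set t | 0 < p.2.+1%:R^-1 - cos_dist p.1 t].
pose E n := if unpickle n is Some p then
  if `[< B p `<=` A >] then B p else set0 else set0.
have cE n : trig_class (tcos b) (tsin b) \1_(E n).
  have c0 : trig_class (tcos b) (tsin b) (\1_(set0 : set (torus Delta)) : _ -> R).
    by case: sig.
  rewrite /E; case: unpickle => [p|//]; case: asboolP => // _.
  apply: trig_class_pos => //; apply: trig_classB; last exact: trig_class_cos_dist.
  exact: trig_class_cst.
have -> : A = \bigcup_n E n.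
  apply/seteqP; split=> [t At|t [n _]].
    have [q [n [qt qA]]] := open_torus_cos_dist oA At.
    exists (pickle (q, n)) => //; rewrite /E pickleK; case: asboolP => [_|].
      by rewrite /B /= subr_gt0.
    by move=> h; exfalso; apply: h => u; rewrite /B /= subr_gt0; exact: qA.
  by rewrite /E; case: unpickle => [p|//]; case: asboolP => // BA /BA.
by case: sig => _ _ /(_ E cE).
Qed.

End BorelTorus.

(** * Almost invariant vectors *)

Section HaarMeasure.
Context (R : realType) (V : vectType R) (Delta : zmodClosed V).
Context (b : (\dim {: V}).-tuple V) (bV : basis_of {: V} b).
Context (bD : forall v : V, v \in Delta <-> inIntSpan b v).
Context (mu : probability (borel_torus Delta) R) (muH : is_haar mu).
Local Notation d := (\dim {: V}).
Local Notation T := (borel_torus Delta).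
Local Notation c := (tcos b : 'rV[int]_d -> T -> R).
Local Notation s := (tsin b : 'rV[int]_d -> T -> R).
Local Notation L2 := (square_integrable mu).
Local Notation ip := (inner mu).

Let cs : trig_family c s := trig_family_torus Delta b.
Let mc := measurable_tcos bV bD.
Let ms := measurable_tsin bV bD.
Let borel := @trig_class_borel _ _ _ _ bV bD.

(** The hypotheses say that the character of [k] composed with [phi] is [al k + i be k] times the
    character of [a k]; translations and affine maps are both of this form. *)
Lemma torus_measurable (phi : T -> T) (al be : 'rV[int]_d -> R)
    (a : 'rV[int]_d -> 'rV[int]_d) :
  (forall k x, c k (phi x) = al k * c (a k) x - be k * s (a k) x) ->
  (forall k x, s k (phi x) = al k * s (a k) x + be k * c (a k) x) ->
  measurable_fun setT phi.
Proof.
move=> hc hs; apply: (measurable_of_trig borel) => k.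
  rewrite (_ : _ \o _ = fun x => al k * c (a k) x - be k * s (a k) x).
    apply: measurable_funB; apply: measurable_funM;
      by [exact: measurable_cst|exact: mc|exact: ms].
  by apply/funext => x; exact: hc.
rewrite (_ : _ \o _ = fun x => al k * s (a k) x + be k * c (a k) x).
  apply: measurable_funD; apply: measurable_funM;
    by [exact: measurable_cst|exact: mc|exact: ms].
by apply/funext => x; exact: hs.
Qed.

Definition translate (u x : T) : T := (x : torus Delta) + u.

Lemma measurable_translate u : measurable_fun setT (translate u).
Proof.
apply: (@torus_measurable _ (fun k => c k u) (fun k => s k u) id) => k x.
  by rewrite /translate tcosD// mulrC [_ * s k u]mulrC.
by rewrite /translate tsinD// mulrC [_ * s k u]mulrC.
Qed.

Lemma haar_translate u A : measurable A -> mu (translate u @^-1` A) = mu A.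
Proof.
move=> mA; rewrite -[RHS](muH (- (u : torus Delta)) mA); congr (mu _).
apply/seteqP; split=> [x xA|_ [x xA <-]].
  by exists (translate u x) => //; rewrite addrC /translate addrK.
by rewrite /= /translate addrC addNKr.
Qed.

(** Translation by [u] changes the sign of the character, so its Haar integral equals its own
    opposite. The point lies half a period along a coordinate where [k] is nonzero. *)
Lemma half_period k : k != 0 -> exists u : T, c k u = -1 /\ s k u = 0.
Proof.
move=> k0; have [i ki] : exists i, k 0 i != 0.
  apply/existsP; apply: contraNT k0; rewrite negb_exists => /forallP h.
  by apply/eqP/rowP => j; rewrite mxE; apply/eqP; have := h j; rewrite negbK.
have ph : phase b k ((2 * (k 0 i)%:~R)^-1 *: b`_i) = pi.
  rewrite phaseZ /phase (bigD1 i)//= big1 ?addr0 => [|j ji]; last first.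
    by rewrite coord_free ?(basis_free bV)// eq_sym (negbTE ji) mulr0.
  rewrite coord_free ?(basis_free bV)// eqxx mulr1 -mulr_natr.
  by field; rewrite intr_eq0.
exists (torus_pi Delta ((2 * (k 0 i)%:~R)^-1 *: b`_i)).
by rewrite tcos_pi// tsin_pi// ph cospi sinpi.
Qed.

Lemma eq_opp0 (x : R) : - x = x -> x = 0.
Proof. by move=> h; lra. Qed.

Lemma Rintegral_tcos k : k != 0 -> \int[mu]_x c k x = 0.
Proof.
move=> k0; have [u [cu su]] := half_period k0.
apply: eq_opp0; rewrite -[in RHS](preserving_Rintegral (measurable_translate u)
  (haar_translate u) (integrable_c cs mc mu k)).
have -> : (fun x => c k (translate u x)) = (fun x => -1 * c k x).
  by apply/funext => x; rewrite /translate tcosD// cu su mulr0 subr0 mulrC.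
by rewrite RintegralZl ?mulN1r//; exact: (integrable_c cs mc mu k).
Qed.

Lemma Rintegral_tsin k : k != 0 -> \int[mu]_x s k x = 0.
Proof.
move=> k0; have [u [cu su]] := half_period k0.
apply: eq_opp0; rewrite -[in RHS](preserving_Rintegral (measurable_translate u)
  (haar_translate u) (integrable_s cs ms mu k)).
have -> : (fun x => s k (translate u x)) = (fun x => -1 * s k x).
  by apply/funext => x; rewrite /translate tsinD// cu su mulr0 addr0 mulrC.
by rewrite RintegralZl ?mulN1r//; exact: (integrable_s cs ms mu k).
Qed.

Lemma lattice_mx_eq0 (g : autT Delta) (k : 'rV[int]_d) :
  (k *m lattice_mx b g == 0) = (k == 0).
Proof.
apply/eqP/eqP => [k0|->]; last by rewrite mul0mx.
rewrite -[k]mulmx1 -(lattice_mx1 bV bD) -(mulgV g) (lattice_mxM bV bD) mulmxA k0.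
by rewrite mul0mx.
Qed.

Section Affine.
Context (h : affT Delta).
Local Notation act := (fun k => k *m lattice_mx b (affT_lin h)).
Local Notation u := (affT_trans h).

Lemma tcos_affT_act k x : c k (affT_act h x) = c k u * c (act k) x - s k u * s (act k) x.
Proof. by rewrite /affT_act tcosD// tcos_act// tsin_act// mulrC [_ * s k u]mulrC. Qed.

Lemma tsin_affT_act k x : s k (affT_act h x) = c k u * s (act k) x + s k u * c (act k) x.
Proof. by rewrite /affT_act tsinD// tcos_act// tsin_act// mulrC [_ * s k u]mulrC. Qed.

Lemma measurable_affT_act : measurable_fun [set: T] (affT_act h).
Proof. exact: torus_measurable tcos_affT_act tsin_affT_act. Qed.

(** [is_haar] gives invariance under translations only. For affine maps the integrals of characters
    are compared: they vanish at nonzero frequencies, and an automorphism permutes those. *)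
Lemma haar_affT_act A : measurable A -> mu (affT_act h @^-1` A) = mu A.
Proof.
have ic := integrable_c cs mc mu; have is_ := integrable_s cs ms mu.
have Rc := Rintegral_c cs Rintegral_tcos.
have Rs := Rintegral_s cs Rintegral_tsin.
apply: (preserving_of_trig cs mc ms borel measurable_affT_act) => k.
  have -> : (fun x => c k (affT_act h x)) =
      (fun x => c k u * c (act k) x + (- s k u) * s (act k) x).
    by apply/funext => x; rewrite tcos_affT_act mulNr.
  rewrite (Rintegral_comb _ _ (ic _) (is_ _)) !Rc Rs mulr0 addr0 lattice_mx_eq0.
  by case: eqVneq => [->|_]; rewrite ?mulr0// mulr1 (trig_c0 cs).
have -> : (fun x => s k (affT_act h x)) =
    (fun x => c k u * s (act k) x + s k u * c (act k) x).
  by apply/funext => x; rewrite tsin_affT_act.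
rewrite (Rintegral_comb _ _ (is_ _) (ic _)) !Rc !Rs mulr0 add0r lattice_mx_eq0.
by case: eqVneq => [->|_]; rewrite ?mulr0// (trig_s0 cs) mul0r.
Qed.

End Affine.

(** The translation part rotates the pair of cosine and sine coefficients by the angle of the
    character at [u], which leaves the sum of their squares unchanged. *)
Lemma energy_affT_act (h : affT Delta) f k : L2 f ->
  energy c s mu (f \o affT_act h^-1%g) k =
  energy c s mu f (k *m lattice_mx b (affT_lin h)).
Proof.
move=> Lf; set l := k *m _; set phi := affT_act h.
have mphi := measurable_affT_act h; have Pphi := @haar_affT_act h.
have Lpsi : L2 (f \o affT_act h^-1%g).
  exact: (preserving_square_integrable (measurable_affT_act h^-1%g)
    (@haar_affT_act h^-1%g) Lf).
have Lc j := L2c cs mc ms mu j; have Ls j := L2s cs mc ms mu j.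
have move_ g : L2 g -> ip (f \o affT_act h^-1%g) g = ip f (g \o phi).
  move=> Lg; rewrite /inner -(preserving_Rintegral mphi Pphi (integrableM Lpsi Lg)).
  by apply: eq_Rintegral => x _; rewrite /= -affT_actM mulVg affT_act1.
have ic := integrableM Lf (Lc l); have is_ := integrableM Lf (Ls l).
set u := affT_trans h.
have cE : ip (f \o affT_act h^-1%g) (c k) = c k u * ip f (c l) + (- s k u) * ip f (s l).
  rewrite move_// -(Rintegral_comb _ _ ic is_); apply: eq_Rintegral => x _.
  by rewrite /= tcos_affT_act; ring.
have sE : ip (f \o affT_act h^-1%g) (s k) = c k u * ip f (s l) + s k u * ip f (c l).
  rewrite move_// -(Rintegral_comb _ _ is_ ic); apply: eq_Rintegral => x _.
  by rewrite /= tsin_affT_act; ring.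
have cs1 : c k u ^+ 2 + s k u ^+ 2 = 1 by exact: cos2Dsin2.
rewrite /energy cE sE -[RHS]mul1r -cs1; ring.
Qed.

End HaarMeasure.

Lemma Lfun2_square_integrable dsp (T : measurableType dsp) (R : realType)
    (mu : probability T R) (f : T -> R) :
  f \in Lfun mu 2%:E -> square_integrable mu f.
Proof.
move=> Lf; split; last exact: Lfun2_integrable_sqr.
by move: Lf; rewrite inE => /andP[mf _]; move: mf; rewrite inE.
Qed.

Section AlmostInvariant.
Context dsp (T : measurableType dsp) (R : realType) (mu : probability T R).
Local Notation L2 := (square_integrable mu).
Local Notation ip := (inner mu).

Lemma L2norm_inner (f : T -> R[i]) :
  L2 (fun x => complex.Re (f x)) -> L2 (fun x => complex.Im (f x)) ->
  L2norm mu f = (Num.sqrt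
    (ip (fun x => complex.Re (f x)) (fun x => complex.Re (f x)) +
     ip (fun x => complex.Im (f x)) (fun x => complex.Im (f x))))%:E.
Proof.
set u := fun x => complex.Re _; set v := fun x => complex.Im _ => Lu Lv.
have iu := integrableM Lu Lu; have iv := integrableM Lv Lv.
rewrite /L2norm unlock /= -[in RHS]powR12_sqrt; last first.
  by apply: addr_ge0; exact: inner_ge0.
rewrite -poweR_EFin; congr (_ `^ _)%E.
rewrite /inner -RintegralD// /Rintegral fineK; last first.
  apply: integrable_fin_num => //.
  exact: (integrableD measurableT iu iv).
apply: eq_integral => x _; congr EFin.
rewrite ger0_norm; last by case: (f x) => a b; exact: sqrtr_ge0.
rewrite /u /v; case: (f x) => a b /=.
by rewrite powR_mulrn ?sqrtr_ge0// sqr_sqrtr ?addr_ge0 ?sqr_ge0// !expr2.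
Qed.

Context (G : groupType) (act : G -> T -> T) (H : set G).
Context (mact : forall h, H h -> measurable_fun setT (act h^-1%g)).
Context (Pact : forall h, H h -> forall A, measurable A ->
  mu (act h^-1%g @^-1` A) = mu A).

(** One of the real and imaginary parts of a unit vector has squared norm at least 1/2. It is
    selected for each [n] separately, and its displacement is at most that of the complex vector. *)
Lemma real_almost_invariant : ~ spectral_gap mu act H ->
  exists eta : nat -> T -> R,
  [/\ forall n, L2 (eta n), forall n, ip (eta n) (eta n) <= 1,
      forall n, 2^-1 <= ip (eta n) (eta n),
      forall n, \int[mu]_x eta n x = 0 &
      forall h, H h -> ip (fun x => (eta n \o act h^-1%g) x - eta n x)
        (fun x => (eta n \o act h^-1%g) x - eta n x) @[n --> \oo] --> (0 : R)].
Proof.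
move=> /contrapT[xi [xi1 xiH]].
pose u n x := complex.Re (xi n x); pose v n x := complex.Im (xi n x).
have Lu n : L2 (u n).
  case: (xi1 n) => -[[h _] _ _] _. exact: (Lfun2_square_integrable h).
have Lv n : L2 (v n).
  case: (xi1 n) => -[[_ h] _ _] _; exact: (Lfun2_square_integrable h).
have u0 n : \int[mu]_x u n x = 0 by case: (xi1 n) => -[_ e _] _; rewrite /Rintegral e.
have v0 n : \int[mu]_x v n x = 0 by case: (xi1 n) => -[_ _ e] _; rewrite /Rintegral e.
have uv1 n : ip (u n) (u n) + ip (v n) (v n) = 1.
  have := (xi1 n).2; rewrite (L2norm_inner (Lu n) (Lv n)) => e; have {}e := EFin_inj e.
  have q0 : 0 <= ip (u n) (u n) + ip (v n) (v n) by apply: addr_ge0; exact: inner_ge0.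
  by rewrite -(sqr_sqrtr q0) e expr1n.
pose eta n := if 2^-1 <= ip (u n) (u n) then u n else v n.
exists eta; split=> [n|n|n|n|h Hh]; rewrite ?/eta; try by case: ifP.
- have := uv1 n; have := inner_ge0 mu (u n); have := inner_ge0 mu (v n).
  by case: ifP => _; move: (ip (u n) _) (ip (v n) _) => p q ? ? ?; lra.
- case: ifPn => //; rewrite -ltNge; have := uv1 n.
  by move: (ip (u n) _) (ip (v n) _) => p q ? ?; lra.
pose du n x := u n (act h^-1%g x) - u n x; pose dv n x := v n (act h^-1%g x) - v n x.
have Ldu n : L2 (du n).
  apply: square_integrableB => //.
  exact: (preserving_square_integrable (mact Hh) (Pact Hh)).
have Ldv n : L2 (dv n).
  apply: square_integrableB => //.
  exact: (preserving_square_integrable (mact Hh) (Pact Hh)).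
have reB (p q : R[i]) : complex.Re (p - q) = complex.Re p - complex.Re q.
  by case: p q => [? ?] [].
have imB (p q : R[i]) : complex.Im (p - q) = complex.Im p - complex.Im q.
  by case: p q => [? ?] [].
have dE n : L2norm mu (fun x => koopman act h (xi n) x - xi n x) =
    (Num.sqrt (ip (du n) (du n) + ip (dv n) (dv n)))%:E.
  have e1 : (fun x => complex.Re (koopman act h (xi n) x - xi n x)) = du n.
    by apply/funext => x; rewrite reB.
  have e2 : (fun x => complex.Im (koopman act h (xi n) x - xi n x)) = dv n.
    by apply/funext => x; rewrite imB.
  by rewrite L2norm_inner ?e1 ?e2.
have d0 : (Num.sqrt (ip (du n) (du n) + ip (dv n) (dv n))) @[n --> \oo] --> (0 : R).
  rewrite (_ : (fun n => _) = fine \o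
      (fun n => L2norm mu (fun x => koopman act h (xi n) x - xi n x))).
    by apply: fine_cvg; exact: xiH.
  by apply/funext => n; rewrite /= dE.
have d2 : (ip (du n) (du n) + ip (dv n) (dv n)) @[n --> \oo] --> (0 : R).
  pose q n := Num.sqrt (ip (du n) (du n) + ip (dv n) (dv n)).
  rewrite (_ : (fun n => _) = q \* q); last first.
    apply/funext => n; rewrite /q /= -expr2 sqr_sqrtr//.
    by apply: addr_ge0; exact: inner_ge0.
  by rewrite -[X in _ --> X](mulr0 (0 : R)); apply: cvgM.
apply: (squeeze_cvgr _ (cvg_cst 0) d2); apply: nearW => n.
rewrite inner_ge0 /=; case: ifP => _.
  by rewrite lerDl; exact: inner_ge0.
by rewrite lerDr; exact: inner_ge0.
Qed.

End AlmostInvariant.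

(** * Commutators and irreducibility *)

Section CommutingSubgroup.
Context (G : groupType) (C : set G).
Local Open Scope group_scope.

Definition subgroup_pred : {pred G} := fun x => `[< C x >].

Context (Cgrp : is_subgroup C).

Fact subgroup_pred1 : 1 \in subgroup_pred.
Proof. by apply/asboolP; case: Cgrp. Qed.

Fact subgroup_predM : {in subgroup_pred &, forall a b, a * b \in subgroup_pred}.
Proof.
by move=> a b /asboolP Ca /asboolP Cb; apply/asboolP; case: Cgrp => _ + _; apply.
Qed.

Fact subgroup_predV : {in subgroup_pred, forall a, a^-1 \in subgroup_pred}.
Proof. by move=> a /asboolP Ca; apply/asboolP; case: Cgrp => _ _; apply. Qed.

Definition subgroup_closed : groupClosed G := HB.pack_for (groupClosed G)
  (subgroup_pred) (isMul1Closed.Build G (subgroup_pred) subgroup_pred1)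
  (isMulClosed.Build G (subgroup_pred) subgroup_predM)
  (isInvClosed.Build G (subgroup_pred) subgroup_predV).

Lemma virtually_abelian_fin_index (A : set G) : C `<=` A -> fin_index A C ->
  (forall a b, C a -> C b -> a * b = b * a) -> virtually_abelian A.
Proof.
move=> CA [F [c cP]] Cab; exists subgroup_closed.
have memC x : (x \in subgroup_closed) <-> C x by split=> /asboolP.
split=> [x /memC /CA//|a b /memC Ca /memC Cb|]; first exact: Cab.
pose coset (a : G) := (fun b : G => a * b) @` [set` subgroup_closed].
pose r (f : F) : G := xget 1 (fun a => A a /\ c a = f).
apply: (@sub_finite_set _ _ ((coset \o r) @` [set: F])); last first.
  exact/finite_image/finite_finset.
move=> _ [a Aa <-]; exists (c a) => //=.
have [Ar cr] : A (r (c a)) /\ c (r (c a)) = c a.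
  by apply: (@xgetPex _ 1 (fun x => A x /\ c x = c a)); exists a.
have [_ CM CV] := Cgrp; have Cra := cP _ _ Ar Aa cr.
apply/seteqP; split=> _ [x /memC Cx <-].
  exists (a^-1 * r (c a) * x); last by rewrite !mulgA mulgV mul1g.
  by apply/memC/CM => //; have := CV _ Cra; rewrite invgM invgK.
exists ((r (c a))^-1 * a * x); last by rewrite !mulgA mulgV mul1g.
by apply/memC/CM.
Qed.

End CommutingSubgroup.

(** A finite part of [P] whose span has maximal dimension already spans everything. *)
Lemma span_set (R : fieldType) (V : vectType R) (P : set V) :
  exists s : seq V, (forall w, w \in s -> P w) /\ forall w, P w -> w \in << s >>%VS.
Proof.
have exd : exists n, `[< exists2 s : seq V, forall w, w \in s -> P w & \dim << s >> = n >].
  by exists (\dim <<[::] : seq V>>); apply/asboolP; exists [::].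
have led n : `[< exists2 s : seq V, forall w, w \in s -> P w & \dim << s >> = n >] ->
    (n <= \dim {: V})%N.
  by move=> /asboolP[s _ <-]; exact/dimvS/subvf.
case: (ex_maxnP exd led) => n /asboolP[s sP <-] smax; exists s; split=> // w Pw.
apply: contraT => ws; have : (\dim << w :: s >> <= \dim << s >>)%N.
  apply/smax/asboolP; exists (w :: s) => // v; rewrite inE => /orP[/eqP ->//|].
  exact: sP.
have sub : (<< s >> <= << w :: s >>)%VS by rewrite span_cons addvSr.
rewrite (geq_leqif (dimv_leqif_sup sub)) => sub2; case/negP: ws.
by apply: (subvP sub2); rewrite memv_span// mem_head.
Qed.

Section CommutatorFixedForm.
Context (R : realType) (V : vectType R) (Delta : zmodClosed V).
Context (b : (\dim {: V}).-tuple V) (bV : basis_of {: V} b).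
Context (bD : forall v : V, v \in Delta <-> inIntSpan b v).
Local Notation d := (\dim {: V}).
Local Notation rho g := (map_mx intr (lattice_mx b g) : 'M[R]_d).

Lemma commutators_trivial (A C : set (autT Delta)) (u : 'rV[R]_d) :
  Q_irreducible A ->
  (forall a x, A a -> C x -> C (a * x * a^-1)%g) -> u != 0 ->
  (forall x y, C x -> C y -> u *m rho (rcommg x y) = u) ->
  forall x y, C x -> C y -> (x * y = y * x)%g.
Proof.
move=> irr Cn u0 uC.
pose comm : set (autT Delta) := [set z | exists x y, [/\ C x, C y & z = rcommg x y]].
pose P : set V := [set w | exists z (i : 'I_d), comm z /\ w = (z : 'End(V)) b`_i - b`_i].
have actM (p q : autT Delta) v : ((p * q)%g : 'End(V)) v = (p : 'End(V)) ((q : 'End(V)) v).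
  exact: comp_lfunE.
have [s [sP Ps]] := span_set P.
have PD w : P w -> w \in Delta.
  by move=> [z [i [_ ->]]]; rewrite rpredB// ?autT_Delta//; exact: (b_Delta bD).
have commJ a z : A a -> comm z -> comm (a * z * a^-1)%g.
  move=> Aa [x [y [Cx Cy ->]]]; exists (a * x * a^-1)%g, (a * y * a^-1)%g.
  by split; [exact: Cn|exact: Cn|rewrite /rcommg !invgM !invgK !mulgA !mulgVK].
have moved z v : comm z -> v \in Delta -> (z : 'End(V)) v - v \in << s >>%VS.
  move=> cz /bD[a ->]; rewrite linear_sum -sumrB memv_suml// => i _.
  by rewrite raddfMz -mulrzBl -scaler_int memvZ//; apply: Ps; exists z, i.
have [W0|WT] : << s >>%VS = 0%VS \/ << s >>%VS = fullv.
- apply: irr.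
    exists s; split=> // w ws; rewrite inE /= memv_span//; exact/PD/sP.
  move=> g Ag; rewrite limg_span; apply/span_subvP => _ /mapP[w /sP[z [j [cz ->]]] ->].
  have gb : (g : 'End(V)) b`_j \in Delta.
    by apply: autT_Delta; exact: (b_Delta bD).
  have -> : (g : 'End(V)) ((z : 'End(V)) b`_j - b`_j) =
      ((g * z * g^-1)%g : 'End(V)) ((g : 'End(V)) b`_j) - (g : 'End(V)) b`_j.
    by rewrite linearB /= -(actM g z) -(actM (g * z * g^-1)%g g) mulgVK.
  by apply: moved => //; exact: commJ.
- move=> x y Cx Cy; have cz : comm (rcommg x y) by exists x, y.
  have z1 : rcommg x y = 1%g.
    apply: val_inj; apply/lfunP => v; rewrite id_lfunE (coord_b bV v) linear_sum.
    apply: eq_bigr => i _; rewrite linearZ; congr (_ *: _); apply/eqP.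
    by rewrite -subr_eq0 -memv0 -W0; apply: Ps; exists (rcommg x y), i.
  by apply: divg1_eq; rewrite invgM mulgA.
(* [u] read as a linear form in the coordinates of [b]; [uC] says that commutators preserve it, so
   it vanishes on [P]. *)
pose ell (v : V) := \sum_i u 0 i * coord b i v.
have ell0 v : v \in << s >>%VS -> ell v = 0.
  have ell_s w : P w -> ell w = 0.
    move=> [z [i [[x [y [Cx Cy zE]]] ->]]]; rewrite /ell.
    under eq_bigr do rewrite linearB /= mulrBr.
    have := congr1 (fun M : 'rV[R]_d => M 0 i) (uC _ _ Cx Cy); rewrite mxE -zE.
    rewrite big_split /= => uE; apply/eqP; rewrite addr_eq0; apply/eqP.
    rewrite sumrN opprK [in RHS](bigD1 i)//= [X in _ = _ + X]big1 ?addr0 => [|k ki].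
      rewrite coord_free ?(basis_free bV)// eqxx mulr1 -[RHS]uE.
      by apply: eq_bigr => k _; rewrite mxE (lattice_mxE bV bD).
    by rewrite coord_free ?(basis_free bV)// eq_sym (negbTE ki) mulr0.
  move=> vs; have /coord_span -> : v \in << in_tuple s >>%VS by [].
  rewrite /ell.
  under eq_bigr do rewrite linear_sum mulr_sumr.
  rewrite exchange_big big1//= => j _.
  under eq_bigr do rewrite linearZ /= mulrCA.
  by rewrite -mulr_sumr [X in _ * X]ell_s ?mulr0//; apply: sP; rewrite mem_nth.
case/negP: u0; apply/eqP/rowP => j; rewrite mxE.
have := ell0 b`_j; rewrite WT memvf => /(_ isT) <-.
rewrite /ell (bigD1 j)//= big1 ?addr0 => [|i ij].
  by rewrite coord_free ?(basis_free bV)// eqxx mulr1.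
by rewrite coord_free ?(basis_free bV)// eq_sym (negbTE ij) mulr0.
Qed.

End CommutatorFixedForm.

Theorem corollary6 (R : realType) (V : vectType R) (Delta : zmodClosed V)
    (mu : probability (borel_torus Delta) R) (H : groupClosed (affT Delta)) :
  (0 < \dim {: V})%N ->
  is_lattice Delta ->
  is_haar mu ->
  countable [set` H] ->
  ~ virtually_abelian (@affT_lin R V Delta @` [set` H]) ->
  Q_irreducible (@affT_lin R V Delta @` [set` H]) ->
  spectral_gap mu (@affT_act R V Delta) [set` H].
Proof.
move=> _ [b [bV bD]] muH _ nva irr; apply: contrapT => ngap; apply: nva.
pose A := affT_lin @` [set` H].
have Agrp : is_subgroup A.
  split; first by exists 1%g => //; exact: gpred1.
    move=> _ _ [f Hf <-] [g Hg <-]; exists (f * g)%g => //.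
    exact: gpredM.
  by move=> _ [f Hf <-]; exists f^-1%g => //; exact: gpredVr.
have [h|h|eta [Leta eta1 eta2 eta0 etaH]] := real_almost_invariant _ _ ngap.
- by move=> _; exact: (measurable_affT_act bV bD).
- by move=> _; exact: (haar_affT_act bV bD muH).
have cs : trig_family (tcos b : _ -> borel_torus Delta -> R) (tsin b) :=
  trig_family_torus Delta b.
have mc := measurable_tcos bV bD; have ms := measurable_tsin bV bD.
have borel := @trig_class_borel _ _ _ _ bV bD.
have Ec := Rintegral_tcos bV bD muH; have Es := Rintegral_tsin bV bD muH.
pose em := energy_mean (tcos b : _ -> borel_torus Delta -> R) (tsin b) mu eta.
have emP : is_mean em := energy_mean_is_mean cs mc ms Ec Es Leta eta1.
have em_inv h E : h \in H -> em E <= em [set k | E (k *m lattice_mx b (affT_lin h))].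
  move=> Hh; apply: (energy_mean_invariant cs mc ms Ec Es Leta eta1
    (h := fun n => eta n \o affT_act h^-1%g)).
  - move=> n; exact: (preserving_square_integrable (measurable_affT_act bV bD _)
      (haar_affT_act bV bD muH h^-1%g) (Leta n)).
  - exists (fun k => k *m lattice_mx b (affT_lin h)^-1%g) => k.
      by rewrite -mulmxA -(lattice_mxM bV bD) mulgV (lattice_mx1 bV bD) mulmx1.
    by rewrite -mulmxA -(lattice_mxM bV bD) mulVg (lattice_mx1 bV bD) mulmx1.
  - by move=> n k; exact: (energy_affT_act bV bD muH).
  - exact: etaH.
(* The mean is pushed forward from integral to real row vectors, where it can be evaluated on real
   subspaces and cones. *)
pose m (E : set 'rV[R]_(\dim {: V})) := em [set k | E (map_mx intr k)].
have mP : is_mean m.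
  split=> [E|E F EF]; first exact: (mean_ge0 emP).
  case: emP => _ <- //; apply/seteqP; split=> // k [Ek Fk].
  by have : (E `&` F) (map_mx intr k) by []; rewrite EF.
have [|||| C [u [Cgrp CA finC Cn [u0 uC]]]] := fixed_vector_of_mean
    (lattice_mx1 bV bD) (lattice_mxM bV bD) mP Agrp.
- move=> _ [h Hh <-] E; rewrite /m.
  rewrite (_ : [set k | _] =
    [set k | E (map_mx intr (k *m lattice_mx b (affT_lin h)))]); last first.
    by apply/seteqP; split=> k /=; rewrite map_mxM.
  (* [em_inv] for [h] is one inequality; for [h^-1], applied to the preimage, it is the other. *)
  apply/eqP; rewrite eq_le (em_inv h [set k | E (map_mx intr k)])// andbT.
  apply: (le_trans (em_inv h^-1%g _ _)); first exact: gpredVr.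
  rewrite le_eqVlt; apply/orP; left; apply/eqP; congr em; apply/seteqP; split=> k /=;
    by rewrite -mulmxA -(lattice_mxM bV bD) mulVg (lattice_mx1 bV bD) mulmx1.
- rewrite /m (_ : [set k | _] = set0) ?(mean0 emP)//.
  by apply/seteqP; split=> // k /=; apply; exists k.
- rewrite /m (_ : [set k | _] = [set 0]); first exact: (energy_mean0 cs Leta eta0).
  apply/seteqP; split=> k /= => [k0|->]; last by rewrite map_mx0.
  apply/rowP => i; have := congr1 (fun v : 'rV[R]_(\dim {: V}) => v 0 i) k0.
  by rewrite !mxE => /eqP; rewrite intr_eq0 => /eqP.
- exact: (energy_meanT cs mc ms borel Ec Es Leta eta1 eta2).
apply: (virtually_abelian_fin_index Cgrp CA finC).
exact: (commutators_trivial bV bD irr Cn u0 uC).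
Qed.
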